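(* Let $0<w<1$ be a real number. Let $L>0$ be the real number with $$w=\sqrt{\frac{L(18+L)}{6(64+3L)}},\qquad\text{and set}\qquad M=\frac{18+L}{64+3L},$$ and let $x>0$ be determined by $$\frac{w^{1/2}}{x^{1/2}}=\frac{1}{2}\sqrt{4+\frac{2}{3}\left(\frac{L^{1/6}}{M^{1/6}}-4\frac{M^{1/6}}{L^{1/6}}\right)^2}+\frac{1}{2}\sqrt{\frac{2}{3}}\left(\frac{L^{1/6}}{M^{1/6}}-4\frac{M^{1/6}}{L^{1/6}}\right).$$ Assume $0<x<1$ (so that $k^{(-1)}(x)$ is defined) and put $w'=\sqrt{\sqrt{1-x^2}\,\sqrt{1-w^4/x^2}}$. Then $$R'\left(e^{-\pi\sqrt{k^{(-1)}(x)}}\right)=\frac{2^{4/3}x^{1/2}(1-x^2)}{5w^{1/6}w'^{2/3}}\left(\frac{w}{x}+\frac{w'}{\sqrt{1-x^2}}-\frac{ww'}{x\sqrt{1-x^2}}\right)^{1/2} R\left(e^{-\pi\sqrt{k^{(-1)}(x)}}\right)\frac{K(x)^2\,e^{\pi\sqrt{k^{(-1)}(x)}}}{\pi^2},$$ where $R'$ is the derivative of $R(q)$ with respect to $q$.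
   Context: For $0<x<1$ let $K(x)=\int_0^{\pi/2}\frac{dt}{\sqrt{1-x^2\sin^2 t}}$ be the complete elliptic integral of the first kind (argument is the modulus). For real $r>0$, $k_r\in(0,1)$ denotes the unique solution $k$ of $\frac{K(\sqrt{1-k^2})}{K(k)}=\sqrt r$. For $0<x<1$, $k^{(-1)}(x)$ denotes the unique $r>0$ with $k_r=x$. The Rogers–Ramanujan continued fraction is, for $0<q<1$, $R(q)=\cfrac{q^{1/5}}{1+\cfrac{q}{1+\cfrac{q^2}{1+\cfrac{q^3}{1+\cdots}}}}$ (limit of the convergents, with $q^{1/5}$ the positive real root). All fractional powers of positive reals are positive. *)

(* Defs.v *)
From Stdlib Require Export Reals.
From Coquelicot Require Export Coquelicot.
Open Scope R_scope.

(** Complete elliptic integral of the first kind; the argument is the modulus. *)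
Definition ellipticK (x : R) : R :=
  RInt (fun t => 1 / sqrt (1 - x ^ 2 * sin t ^ 2)) 0 (PI / 2).

(** [iota] is Coquelicot's definite description: [iota P] satisfies [P] as soon
    as exactly one real number does. *)

(** The singular modulus [k_r], meaningful for [0 < r]. *)
Definition singular_modulus (r : R) : R :=
  @iota R_CompleteSpace (fun k : R =>
    0 < k < 1 /\ ellipticK (sqrt (1 - k ^ 2)) / ellipticK k = sqrt r).

(** The inverse function [k^(-1)], meaningful for [0 < x < 1]. *)
Definition singular_modulus_inv (x : R) : R :=
  @iota R_CompleteSpace (fun r : R => 0 < r /\ singular_modulus r = x).

(** [rr_tail q j n] is the finite continued fraction
    [1 + q^j / (1 + q^(j+1) / (... + q^(j+n-1) / 1))]. *)
Fixpoint rr_tail (q : R) (j n : nat) : R :=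
  match n with
  | O => 1
  | S m => 1 + q ^ j / rr_tail q (S j) m
  end.

(** The Rogers-Ramanujan continued fraction, as the limit of its convergents;
    meaningful for [0 < q < 1], where [Rpower q (1 / 5)] is the positive fifth
    root. *)
Definition rogers_ramanujan (q : R) : R :=
  real (Lim_seq (fun n => Rpower q (1 / 5) / rr_tail q 1 n)).

(* Main.v *)
Require Import Defs.
From Stdlib Require Import Reals Lra Lia Psatz ZArith List FinFun ClassicalEpsilon.
From Stdlib Require Import FunctionalExtensionality.
From Coquelicot Require Import Coquelicot.
Import ListNotations.
Open Scope R_scope.

(** Put [q = exp (-t)] and let [x] be the modulus of nome [q], so that
    [t = PI K'(x) / K(x)]. The proof rests on three facts about theta functions.

    The logarithmic derivative. Schur's polynomials satisfy the recurrence of the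
    convergents, so [R(q) = q^(1/5) A / B] with [A] and [B] signed theta series
    whose product is [(q)(q^5)] by the triple product, where [(q)] is the
    Euler product ([rogers_ramanujan_theta], [rrA_rrB]). Their Wronskian is a double
    series over one residue class of Gaussian integers modulo the prime [2 - i];
    rotating by [i] compares it with the sum over all classes, which is given
    by Jacobi's series for [(q)^3]. This yields [q R'/R = (q)^5 / (5 (q^5))]
    ([rr_wronskian], [rogers_ramanujan_derive]).

    The modular equation of degree 5. The same decomposition modulo [2 - i],
    applied to the squares of the theta constants, evaluates
    [theta_2(q)^2 - theta_2(q^5)^2] and [theta_3(q)^2 - theta_3(q^5)^2] as
    Euler quotients. Together with [2 theta_2(q^2) theta_3(q^2) = theta_2(q)^2] and
    Jacobi's quartic identity they determine, by algebra alone, the relations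
    between the ratios [u], [v], [g] of [theta_2], [theta_3], [theta_4] at [q^5] and at [q]:
    the multiplier identity [v (u + g) - u g = 1] and the modular equation
    satisfied by [(u/v)^(1/2)] ([degree5]). The parametrization of [w] and [x] by [L]
    solves the same equation ([modular5_param]), and its root in [(0,1)] is unique
    ([modular5_inj]). Hence [w^2/x] is the modulus of nome [q^5], [w^2] and [w'^2] are the
    products of the two moduli and of the two complementary moduli, and the large
    square root in the theorem is [v^(-1) = (K(x)/K(w^2/x))^(1/2)].

    The elliptic integral. Landen's transformation is the duplication [q -> q^2] of
    theta constants; iterating it gives [K = PI/2 theta_3^2] and
    [PI K'/K = t], where the constants come from the behaviour of [K] at modulus 0
    and from its logarithmic singularity at modulus 1 ([ellipticK_modk],
    [ellipticK_modk']). As [K'/K] is strictly decreasing in the modulus, the singular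
    modulus and its inverse are what the definitions intend.

    Everything is then expressed by theta constants at [t] and [5 t], and the claim
    follows on comparing sixth powers ([euler_quotient]). *)

(** * Unconditional summation over an arbitrary index type *)

Definition eq_dec_cl {I : Type} (x y : I) : {x = y} + {x <> y} :=
  excluded_middle_informative (x = y).

Definition memb {I : Type} (l : list I) (x : I) : bool :=
  if in_dec eq_dec_cl x l then true else false.

Lemma memb_true {I : Type} (l : list I) x : memb l x = true <-> In x l.
Proof. unfold memb. destruct (in_dec eq_dec_cl x l); split; auto; discriminate. Qed.

Lemma memb_false {I : Type} (l : list I) x : memb l x = false <-> ~ In x l.
Proof. unfold memb. destruct (in_dec eq_dec_cl x l); split; auto; try discriminate; tauto. Qed.

Definition lsum {I : Type} (f : I -> R) (l : list I) : R :=
  fold_right (fun i s => f i + s) 0 l.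

Definition disjoint {I : Type} (l m : list I) : Prop := forall x, In x l -> ~ In x m.

Lemma lsum_app {I : Type} (f : I -> R) l m : lsum f (l ++ m) = lsum f l + lsum f m.
Proof. induction l; simpl; [ring | rewrite IHl; ring]. Qed.

Lemma lsum_ext_in {I : Type} (f g : I -> R) l :
  (forall x, In x l -> f x = g x) -> lsum f l = lsum g l.
Proof.
  induction l; simpl; intros H; auto. rewrite H, IHl; auto.
Qed.

Lemma lsum_le {I : Type} (f g : I -> R) l :
  (forall x, In x l -> f x <= g x) -> lsum f l <= lsum g l.
Proof.
  induction l; simpl; intros H; [lra|]. specialize (H a) as Ha.
  assert (lsum f l <= lsum g l) by auto. specialize (Ha (or_introl eq_refl)). lra.
Qed.

Lemma lsum_plus {I : Type} (f g : I -> R) l :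
  lsum (fun x => f x + g x) l = lsum f l + lsum g l.
Proof. induction l; simpl; [ring | rewrite IHl; ring]. Qed.

Lemma lsum_scal {I : Type} c (f : I -> R) l : lsum (fun x => c * f x) l = c * lsum f l.
Proof. induction l; simpl; [ring | rewrite IHl; ring]. Qed.

Lemma lsum_zero {I : Type} (f : I -> R) l : (forall x, In x l -> f x = 0) -> lsum f l = 0.
Proof.
  induction l; simpl; intros H; auto. rewrite (H a), IHl; auto; ring.
Qed.

Lemma lsum_nonneg {I : Type} (f : I -> R) l : (forall x, 0 <= f x) -> 0 <= lsum f l.
Proof. intros H. induction l; simpl; [lra|]. specialize (H a). lra. Qed.

Lemma lsum_Rabs {I : Type} (f : I -> R) l : Rabs (lsum f l) <= lsum (fun x => Rabs (f x)) l.
Proof.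
  induction l; simpl. rewrite Rabs_R0; lra.
  eapply Rle_trans; [apply Rabs_triang | lra].
Qed.

Lemma lsum_filter {I : Type} (p : I -> bool) (f : I -> R) l :
  lsum f l = lsum f (filter p l) + lsum f (filter (fun x => negb (p x)) l).
Proof.
  induction l; simpl; [ring|]. rewrite IHl. destruct (p a); simpl; ring.
Qed.

Lemma lsum_incl {I : Type} (f : I -> R) l m :
  (forall x, 0 <= f x) -> NoDup l -> incl l m -> lsum f l <= lsum f m.
Proof.
  intros Hf Hl. revert m. induction Hl as [|a l Ha Hl IH]; intros m Hm; simpl.
  - apply lsum_nonneg; auto.
  - destruct (in_split a m) as [m1 [m2 Em]]; [apply Hm; left; auto|]. subst m.
    assert (lsum f l <= lsum f (m1 ++ m2)) as H.
    { apply IH. intros x Hx. assert (x <> a) by congruence.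
      specialize (Hm x (or_intror Hx)). apply in_app_or in Hm. apply in_or_app.
      destruct Hm as [|[|]]; auto. congruence. }
    rewrite lsum_app in *. simpl. lra.
Qed.

Lemma lsum_split {I : Type} (f : I -> R) l m :
  NoDup l -> NoDup m -> incl m l ->
  lsum f l = lsum f m + lsum f (filter (fun x => negb (memb m x)) l).
Proof.
  intros Hl Hm Hi. rewrite (lsum_filter (memb m)). f_equal.
  enough (E : forall g : I -> R, (forall x, 0 <= g x) ->
            lsum g (filter (memb m) l) = lsum g m).
  { rewrite (lsum_ext_in f (fun x => Rmax (f x) 0 + -1 * Rmax (- f x) 0)).
    rewrite (lsum_ext_in f (fun x => Rmax (f x) 0 + -1 * Rmax (- f x) 0) m).
    rewrite !lsum_plus, !lsum_scal, !E; auto; intros; apply Rmax_r.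
    1,2: intros; unfold Rmax; repeat destruct Rle_dec; lra. }
  intros g Hg. apply Rle_antisym; apply lsum_incl; auto.
  - apply NoDup_filter; auto.
  - intros x Hx. apply filter_In in Hx. apply memb_true. tauto.
  - intros x Hx. apply filter_In. split; auto. apply memb_true; auto.
Qed.

Lemma lsum_list_prod {I J : Type} (f : I -> R) (g : J -> R) l m :
  lsum (fun p => f (fst p) * g (snd p)) (list_prod l m) = lsum f l * lsum g m.
Proof.
  induction l; simpl; [ring|]. rewrite lsum_app, IHl.
  enough (lsum (fun p => f (fst p) * g (snd p)) (map (fun y => (a, y)) m) = f a * lsum g m) by lra.
  clear. induction m; simpl; [ring | rewrite IHm; ring].
Qed.

Lemma NoDup_list_prod {I J : Type} (l : list I) (m : list J) :
  NoDup l -> NoDup m -> NoDup (list_prod l m).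
Proof.
  intros Hl Hm. induction Hl as [|a l Ha Hl IH]; simpl; [constructor|].
  apply NoDup_app; auto.
  - apply FinFun.Injective_map_NoDup; auto. intros x y E. congruence.
  - intros [x y] H H'. apply in_map_iff in H. destruct H as [z [E _]]. inversion E; subst.
    apply in_prod_iff in H'. tauto.
Qed.

Lemma lsum_map {I J : Type} (f : J -> R) (h : I -> J) l :
  lsum f (map h l) = lsum (fun i => f (h i)) l.
Proof. induction l; simpl; auto. rewrite IHl; auto. Qed.

Lemma filter_outside {I : Type} (l m : list I) :
  disjoint (filter (fun x => negb (memb m x)) l) m.
Proof.
  intros x Hx. apply filter_In in Hx. apply memb_false.
  destruct (memb m x); simpl in *; intuition; discriminate.
Qed.

(** Stating the smallness of the tails with absolute values makes the notion
    insensitive to the order of the terms, so that index sets without a natural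
    enumeration (such as the lattice of pairs of integers) can be rearranged
    freely. *)
Definition has_sum {I : Type} (f : I -> R) (s : R) : Prop :=
  forall eps, 0 < eps -> exists l0, NoDup l0 /\ Rabs (lsum f l0 - s) <= eps /\
    forall l, NoDup l -> disjoint l l0 -> lsum (fun x => Rabs (f x)) l <= eps.

Lemma has_sum_net {I : Type} (f : I -> R) s : has_sum f s ->
  forall eps, 0 < eps -> exists l0, NoDup l0 /\ forall l, NoDup l -> incl l0 l ->
    Rabs (lsum f l - s) <= eps /\
    forall m, NoDup m -> disjoint m l -> lsum (fun x => Rabs (f x)) m <= eps.
Proof.
  intros H eps He. destruct (H (eps / 2)) as [l0 [Hl0 [H1 H2]]]; [lra|].
  exists l0. split; auto. intros l Hl Hi. split.
  - rewrite (lsum_split f l l0) by auto.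
    assert (Rabs (lsum f (filter (fun x => negb (memb l0 x)) l)) <= eps / 2).
    { eapply Rle_trans; [apply lsum_Rabs|]. apply H2. apply NoDup_filter; auto. apply filter_outside. }
    revert H0 H1. unfold Rabs. repeat destruct Rcase_abs; lra.
  - intros m Hm Hd. apply Rle_trans with (eps / 2); [|lra]. apply H2; auto.
    intros x Hx Hx'. apply (Hd x); auto.
Qed.

Lemma common_refinement {I : Type} (l m : list I) : exists u, NoDup u /\ incl l u /\ incl m u.
Proof.
  exists (nodup eq_dec_cl (l ++ m)). split. apply NoDup_nodup.
  split; intros x Hx; apply nodup_In; apply in_or_app; auto.
Qed.

Lemma has_sum_unique {I : Type} (f : I -> R) s s' : has_sum f s -> has_sum f s' -> s = s'.
Proof.
  intros H H'. apply Rminus_diag_uniq.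
  destruct (Req_dec (s - s') 0) as [|N]; auto. exfalso.
  apply Rabs_pos_lt in N. set (e := Rabs (s - s')) in *.
  destruct (has_sum_net _ _ H (e / 4)) as [l [Hl L]]; [lra|].
  destruct (has_sum_net _ _ H' (e / 4)) as [m [Hm M]]; [lra|].
  destruct (common_refinement l m) as [u [Hu [Il Im]]].
  destruct (L u Hu Il) as [L1 _]. destruct (M u Hu Im) as [M1 _].
  assert (e <= e / 4 + e / 4); [|lra]. unfold e at 1.
  replace (s - s') with (- (lsum f u - s) + (lsum f u - s')) by ring.
  eapply Rle_trans; [apply Rabs_triang|]. rewrite Rabs_Ropp. lra.
Qed.

Lemma has_sum_eq {I : Type} (f g : I -> R) s s' :
  (forall x, f x = g x) -> s = s' -> has_sum f s -> has_sum g s'.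
Proof. intros E -> H. replace g with f; auto. apply functional_extensionality; auto. Qed.

Lemma has_sum_plus {I : Type} (f g : I -> R) s s' :
  has_sum f s -> has_sum g s' -> has_sum (fun x => f x + g x) (s + s').
Proof.
  intros H H' e He.
  destruct (has_sum_net _ _ H (e / 2)) as [l [Hl L]]; [lra|].
  destruct (has_sum_net _ _ H' (e / 2)) as [m [Hm M]]; [lra|].
  destruct (common_refinement l m) as [u [Hu [Il Im]]].
  destruct (L u Hu Il) as [L1 L2]. destruct (M u Hu Im) as [M1 M2].
  exists u. split; auto. split.
  - rewrite lsum_plus. replace (_ - _) with ((lsum f u - s) + (lsum g u - s')) by ring.
    eapply Rle_trans; [apply Rabs_triang | lra].
  - intros k Hk Hd. specialize (L2 k Hk Hd). specialize (M2 k Hk Hd).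
    apply Rle_trans with (lsum (fun x => Rabs (f x) + Rabs (g x)) k).
    apply lsum_le. intros; apply Rabs_triang. rewrite lsum_plus. lra.
Qed.

Lemma has_sum_scal {I : Type} c (f : I -> R) s :
  has_sum f s -> has_sum (fun x => c * f x) (c * s).
Proof.
  intros H e He. pose proof (Rabs_pos c).
  destruct (H (e / (Rabs c + 1))) as [l [Hl [L1 L2]]]. apply Rdiv_lt_0_compat; lra.
  assert (E : forall y, y <= e / (Rabs c + 1) -> Rabs c * y <= e).
  { intros y Hy. apply Rle_trans with (Rabs c * (e / (Rabs c + 1))).
    apply Rmult_le_compat_l; auto.
    apply Rmult_le_reg_r with (Rabs c + 1); [lra|]. field_simplify; [|lra]. nra. }
  exists l. split; auto. split.
  - rewrite lsum_scal, <- Rmult_minus_distr_l, Rabs_mult. auto.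
  - intros k Hk Hd. rewrite (lsum_ext_in _ (fun x => Rabs c * Rabs (f x))).
    rewrite lsum_scal. auto. intros; apply Rabs_mult.
Qed.

Lemma has_sum_minus {I : Type} (f g : I -> R) s s' :
  has_sum f s -> has_sum g s' -> has_sum (fun x => f x - g x) (s - s').
Proof.
  intros H H'. apply (has_sum_eq (fun x => f x + -1 * g x) _ (s + -1 * s')).
  intros; ring. ring. apply has_sum_plus; auto. apply has_sum_scal; auto.
Qed.

Lemma has_sum_finite {I : Type} (f : I -> R) l :
  NoDup l -> (forall x, ~ In x l -> f x = 0) -> has_sum f (lsum f l).
Proof.
  intros Hl H e He. exists l. split; auto. split.
  - rewrite Rminus_diag, Rabs_R0; lra.
  - intros k Hk Hd. rewrite lsum_zero; [lra|]. intros x Hx. rewrite H, Rabs_R0; auto.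
Qed.

(** Extending a family by zero outside the image of an injection [h] (with
    partial inverse [k] and range [r]) does not change its sum; all splittings
    into residue classes and all changes of variables below are instances. *)
Lemma has_sum_injection {I J : Type} (h : I -> J) (k : J -> I) (r : J -> bool)
  (f : J -> R) s :
  (forall i, k (h i) = i) -> (forall i, r (h i) = true) ->
  (forall j, r j = true -> h (k j) = j) ->
  has_sum (fun i => f (h i)) s -> has_sum (fun j => if r j then f j else 0) s.
Proof.
  intros K1 Rh K2 H e He. destruct (H e He) as [l [Hl [L1 L2]]].
  assert (Inj : forall x y, h x = h y -> x = y).
  { intros x y E. rewrite <- (K1 x), E; auto. }
  exists (map h l). split; [|split].
  - apply FinFun.Injective_map_NoDup; auto.
  - rewrite lsum_map. rewrite (lsum_ext_in _ (fun i => f (h i))); auto.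
    intros; rewrite Rh; auto.
  - intros m Hm Hd. rewrite (lsum_filter r).
    rewrite (lsum_zero _ (filter (fun x => negb (r x)) m)).
    2:{ intros x Hx. apply filter_In in Hx. destruct (r x); simpl in *; [|apply Rabs_R0].
        destruct Hx; discriminate. }
    rewrite Rplus_0_r.
    assert (E : map h (map k (filter r m)) = filter r m).
    { rewrite map_map.
      transitivity (map (fun x => x) (filter r m)); [|apply map_id].
      apply map_ext_in. intros a Ha. apply filter_In in Ha. apply K2; tauto. }
    rewrite <- E, lsum_map.
    rewrite (lsum_ext_in _ (fun i => Rabs (f (h i)))) by (intros; rewrite Rh; auto).
    apply L2.
    + apply (NoDup_map_inv h). rewrite E. apply NoDup_filter; auto.
    + intros x Hx Hx'. apply (in_map h) in Hx. rewrite E in Hx. apply filter_In in Hx.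
      apply (Hd (h x)); [tauto|]. apply in_map; auto.
Qed.

Lemma has_sum_reindex {I J : Type} (h : I -> J) (k : J -> I) (f : J -> R) s :
  (forall i, k (h i) = i) -> (forall j, h (k j) = j) ->
  has_sum (fun i => f (h i)) s -> has_sum f s.
Proof.
  intros K1 K2 H.
  apply (has_sum_eq (fun j => if true then f j else 0) _ s); auto.
  apply (has_sum_injection h k (fun _ => true)); auto.
Qed.

Lemma has_sum_partial {I : Type} (f : I -> R) s l :
  (forall x, 0 <= f x) -> has_sum f s -> NoDup l -> lsum f l <= s.
Proof.
  intros Hf H Hl. apply Rnot_lt_le. intros N.
  destruct (has_sum_net _ _ H ((lsum f l - s) / 2)) as [m [Hm M]]; [lra|].
  destruct (common_refinement l m) as [u [Hu [Il Im]]].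
  destruct (M u Hu Im) as [M1 _]. pose proof (lsum_incl f l u Hf Hl Il).
  apply Rabs_le_between in M1. lra.
Qed.

Lemma has_sum_nonneg_bounded {I : Type} (f : I -> R) B :
  (forall x, 0 <= f x) -> (forall l, NoDup l -> lsum f l <= B) -> exists s, has_sum f s.
Proof.
  intros Hf HB.
  destruct (completeness (fun y => exists l, NoDup l /\ y = lsum f l)) as [s [S1 S2]].
  - exists B. intros y [l [Hl ->]]. auto.
  - exists 0, []. split; [constructor | reflexivity].
  - exists s. intros e He.
    destruct (Classical_Prop.classic (exists l, NoDup l /\ s - e < lsum f l)) as [[l [Hl L]]|N].
    + exists l. split; auto.
      assert (lsum f l <= s) by (apply S1; exists l; auto).
      split. apply Rabs_le; lra.
      intros k Hk Hd.
      assert (lsum f (l ++ k) <= s).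
      { apply S1. exists (l ++ k). split; auto. apply NoDup_app; auto.
        intros x Hx Hx'. apply (Hd x); auto. }
      rewrite lsum_app in H0. rewrite (lsum_ext_in _ f). lra.
      intros; apply Rabs_pos_eq; auto.
    + exfalso. assert (s <= s - e); [|lra]. apply S2. intros y [l [Hl ->]].
      apply Rnot_lt_le. intros N'. apply N. exists l; auto.
Qed.

Lemma has_sum_dominated {I : Type} (f g : I -> R) G :
  (forall x, Rabs (f x) <= g x) -> has_sum g G -> exists s, has_sum f s.
Proof.
  intros Hfg HG.
  assert (Hg : forall x, 0 <= g x).
  { intros x. eapply Rle_trans; [apply Rabs_pos | apply Hfg]. }
  assert (P : forall h : I -> R, (forall x, 0 <= h x <= g x) -> exists s, has_sum h s).
  { intros h Hh. apply has_sum_nonneg_bounded with G. apply Hh.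
    intros l Hl. apply Rle_trans with (lsum g l). apply lsum_le; intros; apply Hh.
    apply has_sum_partial; auto. }
  destruct (P (fun x => Rmax (f x) 0)) as [s1 H1].
  { intros x. specialize (Hfg x). apply Rabs_le_between in Hfg. split. apply Rmax_r.
    apply Rmax_lub; auto. lra. }
  destruct (P (fun x => Rmax (- f x) 0)) as [s2 H2].
  { intros x. specialize (Hfg x). apply Rabs_le_between in Hfg. split. apply Rmax_r.
    apply Rmax_lub; auto. lra. }
  exists (s1 - s2). apply (has_sum_eq (fun x => Rmax (f x) 0 - Rmax (- f x) 0) _ (s1 - s2)); auto.
  { intros x. unfold Rmax. repeat destruct Rle_dec; lra. }
  apply has_sum_minus; auto.
Qed.

Lemma has_sum_Rabs_le {I : Type} (f g : I -> R) s G :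
  (forall x, Rabs (f x) <= g x) -> has_sum f s -> has_sum g G -> Rabs s <= G.
Proof.
  intros Hfg Hf HG. apply Rnot_lt_le. intros N.
  destruct (has_sum_net _ _ Hf ((Rabs s - G) / 2)) as [l [Hl L]]; [lra|].
  destruct (L l Hl) as [L1 _]; [intros x; auto|].
  assert (lsum g l <= G).
  { apply has_sum_partial; auto. intros x. eapply Rle_trans; [apply Rabs_pos | apply Hfg]. }
  assert (Rabs (lsum f l) <= lsum g l).
  { eapply Rle_trans; [apply lsum_Rabs | apply lsum_le; auto]. }
  revert L1 H0 N. unfold Rabs. repeat destruct Rcase_abs; lra.
Qed.

Lemma has_sum_product {I J : Type} (f : I -> R) (g : J -> R) a b :
  has_sum f a -> has_sum g b ->
  has_sum (fun p : I * J => f (fst p) * g (snd p)) (a * b).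
Proof.
  intros Hf Hg.
  assert (Bd : forall (K : Type) (h : K -> R) s, has_sum h s -> exists B, 0 < B /\
     forall l, NoDup l -> lsum (fun x => Rabs (h x)) l <= B).
  { intros K h s H. destruct (H 1) as [l0 [Hl0 [_ L]]]; [lra|].
    exists (lsum (fun x => Rabs (h x)) l0 + 1).
    assert (0 <= lsum (fun x => Rabs (h x)) l0) by (apply lsum_nonneg; intros; apply Rabs_pos).
    split; [lra|]. intros l Hl. destruct (common_refinement l l0) as [u [Hu [I1 I2]]].
    apply Rle_trans with (lsum (fun x => Rabs (h x)) u).
    apply lsum_incl; auto. intros; apply Rabs_pos.
    rewrite (lsum_split _ u l0); auto. apply Rplus_le_compat_l. apply L.
    apply NoDup_filter; auto. apply filter_outside. }
  destruct (Bd _ f a Hf) as [A [HA BA]]. destruct (Bd _ g b Hg) as [B [HB BB]].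
  intros e He.
  pose (d := Rmin 1 (e / (A + B + Rabs a + Rabs b + 1))).
  pose proof (Rabs_pos a) as Pa. pose proof (Rabs_pos b) as Pb.
  assert (Hd : 0 < d) by (apply Rmin_pos; [lra | apply Rdiv_lt_0_compat; lra]).
  assert (Hd1 : d <= 1) by apply Rmin_l.
  assert (Hde : d * (A + B + Rabs a + Rabs b + 1) <= e).
  { apply Rle_trans with (e / (A + B + Rabs a + Rabs b + 1) * (A + B + Rabs a + Rabs b + 1)).
    apply Rmult_le_compat_r; [lra | apply Rmin_r]. right. field. lra. }
  destruct (Hf d Hd) as [l0 [Hl0 [L1 L2]]]. destruct (Hg d Hd) as [m0 [Hm0 [M1 M2]]].
  exists (list_prod l0 m0). split; [|split].
  - apply NoDup_list_prod; auto.
  - rewrite lsum_list_prod.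
    replace (lsum f l0 * lsum g m0 - a * b)
      with ((lsum f l0 - a) * (lsum g m0 - b) + (lsum f l0 - a) * b + a * (lsum g m0 - b)) by ring.
    assert (Rabs ((lsum f l0 - a) * (lsum g m0 - b)) <= d * 1).
    { rewrite Rabs_mult. apply Rmult_le_compat; auto using Rabs_pos. lra. }
    assert (Rabs ((lsum f l0 - a) * b) <= d * Rabs b).
    { rewrite Rabs_mult. apply Rmult_le_compat_r; auto. }
    assert (Rabs (a * (lsum g m0 - b)) <= Rabs a * d).
    { rewrite Rabs_mult. apply Rmult_le_compat_l; auto. }
    eapply Rle_trans; [apply Rabs_triang|].
    eapply Rle_trans; [apply Rplus_le_compat_r; apply Rabs_triang|]. nra.
  - intros l Hl Dl.
    rewrite (lsum_ext_in _ (fun p => Rabs (f (fst p)) * Rabs (g (snd p)))).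
    2:{ intros; apply Rabs_mult. }
    set (l1 := nodup eq_dec_cl (map fst l)). set (m1 := nodup eq_dec_cl (map snd l)).
    set (l2 := filter (fun x => negb (memb l0 x)) l1).
    set (m2 := filter (fun x => negb (memb m0 x)) m1).
    assert (Nl1 : NoDup l1) by apply NoDup_nodup.
    assert (Nm1 : NoDup m1) by apply NoDup_nodup.
    assert (S1 : lsum (fun x => Rabs (f x)) l2 <= d).
    { apply L2. apply NoDup_filter; auto. apply filter_outside. }
    assert (S2 : lsum (fun x => Rabs (g x)) m2 <= d).
    { apply M2. apply NoDup_filter; auto. apply filter_outside. }
    apply Rle_trans with (lsum (fun p => Rabs (f (fst p)) * Rabs (g (snd p)))
       (list_prod l2 m1 ++ list_prod l1 m2)).
    + apply lsum_incl; auto.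
      { intros; apply Rmult_le_pos; apply Rabs_pos. }
      intros [x y] Hxy. assert (In x l1).
      { apply nodup_In. change x with (fst (x, y)). apply in_map; auto. }
      assert (In y m1).
      { apply nodup_In. change y with (snd (x, y)). apply in_map; auto. }
      apply in_or_app.
      destruct (memb l0 x) eqn:E1; [destruct (memb m0 y) eqn:E2|].
      * exfalso. apply (Dl (x, y)); auto. apply in_prod; apply memb_true; auto.
      * right. apply in_prod; auto. apply filter_In; split; auto. rewrite E2; auto.
      * left. apply in_prod; auto. apply filter_In; split; auto. rewrite E1; auto.
    + rewrite lsum_app.
      rewrite (lsum_list_prod (fun x => Rabs (f x)) (fun x => Rabs (g x))).
      rewrite (lsum_list_prod (fun x => Rabs (f x)) (fun x => Rabs (g x))).
      specialize (BA l1 Nl1). specialize (BB m1 Nm1).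
      assert (P : forall (K : Type) (h : K -> R) k, 0 <= lsum (fun x => Rabs (h x)) k).
      { intros. apply lsum_nonneg. intros; apply Rabs_pos. }
      pose proof (P _ f l2). pose proof (P _ g m2). pose proof (P _ f l1). pose proof (P _ g m1).
      assert (lsum (fun x => Rabs (f x)) l2 * lsum (fun x => Rabs (g x)) m1 <= d * B)
        by (apply Rmult_le_compat; auto).
      assert (lsum (fun x => Rabs (f x)) l1 * lsum (fun x => Rabs (g x)) m2 <= A * d)
        by (apply Rmult_le_compat; auto).
      nra.
Qed.

(** Outside a finite set of indices all the sums are small uniformly in [n], and
    on that set there is only a finite sum to which to pass to the limit. *)
Lemma has_sum_tannery {I : Type} (F : nat -> I -> R) (f g : I -> R) S s G :
  (forall n x, Rabs (F n x) <= g x) -> has_sum g G ->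
  (forall x, is_lim_seq (fun n => F n x) (f x)) ->
  (forall n, has_sum (F n) (S n)) -> has_sum f s -> is_lim_seq S s.
Proof.
  intros Hg HG Hl HS Hs.
  assert (Hfg : forall x, Rabs (f x) <= g x).
  { intros x. pose proof (is_lim_seq_abs _ _ (Hl x)) as A. simpl in A.
    apply (is_lim_seq_le _ (fun _ => g x) _ (g x) (fun n => Hg n x)) in A; auto.
    apply is_lim_seq_const. }
  apply is_lim_seq_spec. intros eps. destruct eps as [eps He]. simpl.
  destruct (HG (eps / 8)) as [l0 [Hl0 [_ T]]]; [lra|].
  assert (Lf : is_lim_seq (fun n => lsum (F n) l0) (lsum f l0)).
  { clear T Hl0. induction l0; simpl. apply is_lim_seq_const.
    apply is_lim_seq_plus'; auto. }
  apply is_lim_seq_spec in Lf. destruct (Lf (mkposreal (eps / 4) ltac:(lra))) as [N HN].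
  exists N. intros n Hn. specialize (HN n Hn). simpl in HN.
  assert (Q : forall h t, (forall x, Rabs (h x) <= g x) -> has_sum h t ->
     Rabs (lsum h l0 - t) <= eps / 4).
  { intros h t Hh Ht. destruct (has_sum_net _ _ Ht (eps / 8)) as [m [Hm M]]; [lra|].
    destruct (common_refinement l0 m) as [u [Hu [I1 I2]]]. destruct (M u Hu I2) as [M1 _].
    rewrite (lsum_split h u l0) in M1; auto.
    set (v := filter (fun x => negb (memb l0 x)) u) in *.
    assert (Rabs (lsum h v) <= eps / 8).
    { eapply Rle_trans; [apply lsum_Rabs|].
      apply Rle_trans with (lsum (fun x => Rabs (g x)) v).
      apply lsum_le. intros x _. eapply Rle_trans; [apply Hh | apply Rle_abs].
      apply T. apply NoDup_filter; auto. apply filter_outside. }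
    revert H M1. unfold Rabs. repeat destruct Rcase_abs; lra. }
  pose proof (Q _ _ (Hg n) (HS n)) as Q1. pose proof (Q _ _ Hfg Hs) as Q2.
  revert HN Q1 Q2. unfold Rabs. repeat destruct Rcase_abs; lra.
Qed.

Lemma exp_taylor1 (y : R) : Rabs (exp y - 1 - y) <= y ^ 2 * exp (Rabs y).
Proof.
  assert (A : forall z, exp z >= 1 + z).
  { intros z. destruct (Req_dec z 0) as [->|N]. rewrite exp_0; lra.
    apply Rgt_ge, exp_ineq1; auto. }
  assert (B : exp (Rabs y) >= 1).
  { pose proof (A (Rabs y)). pose proof (Rabs_pos y). lra. }
  pose proof (A y) as Ay. pose proof (A (- y)) as Ay'.
  rewrite Rabs_pos_eq by lra.
  (* [exp (-y) >= 1 - y] gives [exp y * (1 - y) <= 1]. *)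
  assert (C : exp y * (1 - y) <= 1).
  { rewrite <- (Rmult_1_r 1) at 2. pose proof (exp_pos y).
    assert (exp y * exp (- y) = 1) by (rewrite <- exp_plus, Rplus_opp_r, exp_0; auto). nra. }
  destruct (Rle_dec 0 y) as [H|H].
  - rewrite (Rabs_pos_eq y) by auto. pose proof (exp_pos y). nra.
  - rewrite (Rabs_left1 y) in * by lra. nra.
Qed.

(** Termwise differentiation of Dirichlet-like series in [t]: the Taylor
    remainder of each term is quadratic in the increment, with a summable
    coefficient. *)
Lemma has_sum_derive {I : Type} (c e : I -> R) (S : R -> R) t D :
  0 < t -> (forall i, 0 <= e i) ->
  (forall u, 0 < u -> has_sum (fun i => c i * exp (- (e i * u))) (S u)) ->
  has_sum (fun i => c i * (- e i) * exp (- (e i * t))) D ->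
  (exists G, has_sum (fun i => Rabs (c i) * e i ^ 2 * exp (- (e i * (t / 2)))) G) ->
  is_derive S t D.
Proof.
  intros Ht He HS HD [G HG].
  assert (K : forall h, Rabs h <= t / 2 -> Rabs (S (t + h) - S t - h * D) <= h ^ 2 * G).
  { intros h Hh. assert (0 < t + h) by (apply Rabs_le_between in Hh; lra).
    refine (has_sum_Rabs_le
      (fun i => c i * exp (- (e i * (t + h))) - c i * exp (- (e i * t))
          - h * (c i * (- e i) * exp (- (e i * t))))
      (fun i => h ^ 2 * (Rabs (c i) * e i ^ 2 * exp (- (e i * (t / 2))))) _ _ _ _ _).
    - intros i. specialize (He i).
      replace (_ - _ - _) with (c i * exp (- (e i * t)) * (exp (- (e i * h)) - 1 - (- (e i * h)))).
      2:{ replace (- (e i * (t + h))) with (- (e i * t) + - (e i * h)) by ring.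
          rewrite exp_plus. ring. }
      rewrite !Rabs_mult. pose proof (exp_taylor1 (- (e i * h))) as T.
      rewrite (Rabs_pos_eq (exp _)) by (left; apply exp_pos).
      pose proof (exp_pos (- (e i * t))).
      apply Rle_trans with (Rabs (c i) * exp (- (e i * t)) *
         ((- (e i * h)) ^ 2 * exp (Rabs (- (e i * h))))).
      { apply Rmult_le_compat_l; auto. apply Rmult_le_pos; [apply Rabs_pos | lra]. }
      replace (Rabs (c i) * exp (- (e i * t)) * ((- (e i * h)) ^ 2 * exp (Rabs (- (e i * h)))))
        with (h ^ 2 * (Rabs (c i) * e i ^ 2 * exp (- (e i * t) + Rabs (- (e i * h))))).
      2:{ rewrite exp_plus. ring. }
      apply Rmult_le_compat_l; [apply pow2_ge_0|].
      apply Rmult_le_compat_l. apply Rmult_le_pos; [apply Rabs_pos | apply pow2_ge_0].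
      rewrite Rabs_Ropp, Rabs_mult, (Rabs_pos_eq (e i)) by auto.
      assert (e i * Rabs h <= e i * (t / 2)) by (apply Rmult_le_compat_l; auto).
      destruct (Req_dec (- (e i * t) + e i * Rabs h) (- (e i * (t / 2)))) as [->|N]; [lra|].
      left. apply exp_increasing. lra.
    - apply has_sum_minus. apply has_sum_minus; apply HS; lra. apply has_sum_scal; auto.
    - apply has_sum_scal; auto. }
  apply is_derive_Reals. intros eps Heps.
  assert (Hd : 0 < Rmin (t / 2) (eps / (Rabs G + 1))).
  { apply Rmin_pos. lra. apply Rdiv_lt_0_compat; auto. pose proof (Rabs_pos G); lra. }
  exists (mkposreal _ Hd). simpl. intros h Hh0 Hh.
  assert (H1 : Rabs h < t / 2) by (eapply Rlt_le_trans; [apply Hh | apply Rmin_l]).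
  assert (H2 : Rabs h < eps / (Rabs G + 1)) by (eapply Rlt_le_trans; [apply Hh | apply Rmin_r]).
  specialize (K h (Rlt_le _ _ H1)).
  replace ((S (t + h) - S t) / h - D) with ((S (t + h) - S t - h * D) / h) by (field; auto).
  rewrite Rabs_div by auto. pose proof (Rabs_pos_lt h Hh0) as Ph.
  apply Rmult_lt_reg_r with (Rabs h); auto.
  replace (_ / Rabs h * Rabs h) with (Rabs (S (t + h) - S t - h * D)) by (field; lra).
  pose proof (Rabs_pos G). pose proof (Rle_abs G).
  assert (Rabs h * (Rabs G + 1) < eps).
  { apply Rmult_lt_reg_r with (/ (Rabs G + 1)). apply Rinv_0_lt_compat; lra.
    replace (_ * / _) with (Rabs h) by (field; lra). apply H2. }
  rewrite <- (pow2_abs h) in K. nra.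
Qed.

(** * Gaussian sums over the integers *)

Lemma exp_le (x y : R) : x <= y -> exp x <= exp y.
Proof. intros [H| ->]; [left; apply exp_increasing; auto | lra]. Qed.

Lemma exp_lt_1 (x : R) : 0 < x -> exp (- x) < 1.
Proof. intros H. rewrite <- exp_0. apply exp_increasing. lra. Qed.

Lemma exp_ge_1x (x : R) : 1 + x <= exp x.
Proof.
  destruct (Req_dec x 0) as [->|N]. rewrite exp_0; lra. left; apply exp_ineq1; auto.
Qed.

Lemma has_sum_exp_nat : exists s, has_sum (fun n : nat => exp (- INR n)) s.
Proof.
  apply has_sum_nonneg_bounded with (/ (1 - exp (- 1))).
  { intros; left; apply exp_pos. }
  assert (H1 : exp (-1) < 1) by (apply (exp_lt_1 1); lra).
  pose proof (exp_pos (-1)) as H0.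
  assert (G : forall n, lsum (fun n : nat => exp (- INR n)) (seq 0 n)
    <= / (1 - exp (-1)) - exp (- INR n) / (1 - exp (-1))).
  { induction n.
    - cbn [seq lsum fold_right INR]. rewrite Ropp_0, exp_0. right. field. lra.
    - rewrite seq_S, lsum_app. cbn [lsum fold_right]. rewrite Nat.add_0_l, S_INR.
      replace (- (INR n + 1)) with (- INR n + -1) by ring. rewrite exp_plus.
      eapply Rle_trans; [apply Rplus_le_compat_r, IHn|]. right. field. lra. }
  intros l Hl. apply Rle_trans with (lsum (fun n : nat => exp (- INR n)) (seq 0 (S (list_max l)))).
  - apply lsum_incl; auto. intros; left; apply exp_pos.
    intros x Hx. apply in_seq. pose proof (proj1 (list_max_le l (list_max l)) (le_n _)) as F.
    rewrite Forall_forall in F. specialize (F x Hx). lia.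
  - eapply Rle_trans; [apply G|]. pose proof (exp_pos (- INR (S (list_max l)))).
    assert (0 < exp (- INR (S (list_max l))) / (1 - exp (-1))) by (apply Rdiv_lt_0_compat; lra).
    lra.
Qed.

Lemma has_sum_exp_abs : exists s, has_sum (fun n : Z => exp (- Rabs (IZR n))) s.
Proof.
  destruct has_sum_exp_nat as [s Hs].
  assert (P : has_sum (fun n => if (0 <=? n)%Z then exp (- Rabs (IZR n)) else 0) s).
  { apply (has_sum_injection Z.of_nat Z.to_nat).
    - intros; lia.
    - intros; apply Z.leb_le; lia.
    - intros j Hj. apply Z.leb_le in Hj. lia.
    - apply (has_sum_eq (fun n => exp (- INR n)) _ s); auto.
      intros n. rewrite <- INR_IZR_INZ, Rabs_pos_eq; auto using pos_INR. }
  assert (N : has_sum (fun n => if (n <? 0)%Z then exp (- Rabs (IZR n)) else 0) (exp (-1) * s)).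
  { apply (has_sum_injection (fun n => - Z.of_nat (S n))%Z (fun z => Z.to_nat (- z - 1))%Z).
    - intros; lia.
    - intros; apply Z.ltb_lt; lia.
    - intros j Hj. apply Z.ltb_lt in Hj. lia.
    - apply (has_sum_eq (fun n => exp (-1) * exp (- INR n)) _ (exp (-1) * s)); auto.
      2: apply has_sum_scal; auto.
      intros n. rewrite <- exp_plus, opp_IZR, <- INR_IZR_INZ, Rabs_Ropp, Rabs_pos_eq by apply pos_INR.
      rewrite S_INR. f_equal. ring. }
  exists (s + exp (-1) * s). eapply has_sum_eq; [|reflexivity|apply has_sum_plus; [exact P | exact N]].
  intros n. simpl. destruct (Z.leb_spec 0 n), (Z.ltb_spec n 0); try lia; ring.
Qed.

(** The weight [|n|^k] is absorbed by one more exponential factor, and the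
    square in the exponent absorbs every linear term. *)
Lemma has_sum_gauss (k : nat) (a b c : R) : 0 < a ->
  exists s, has_sum (fun n : Z => Rabs (IZR n) ^ k * exp (- (a * IZR n ^ 2 + b * IZR n + c))) s.
Proof.
  intros Ha. destruct has_sum_exp_abs as [s Hs].
  set (d := INR k + Rabs b + 1).
  apply (has_sum_dominated _ (fun n => exp (d ^ 2 / (4 * a) - c) * exp (- Rabs (IZR n)))
    (exp (d ^ 2 / (4 * a) - c) * s)); [|apply has_sum_scal; auto].
  intros n. set (y := IZR n).
  assert (Hp : Rabs y ^ k <= exp (INR k * Rabs y)).
  { clear -k. induction k. simpl. rewrite Rmult_0_l, exp_0; lra.
    rewrite S_INR, Rmult_plus_distr_r, exp_plus, Rmult_1_l, (Rmult_comm (exp _)).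
    cbn [pow]. pose proof (Rabs_pos y).
    apply Rmult_le_compat; auto. apply pow_le; auto.
    pose proof (exp_ge_1x (Rabs y)). lra. }
  rewrite Rabs_pos_eq.
  2:{ apply Rmult_le_pos. apply pow_le, Rabs_pos. left; apply exp_pos. }
  eapply Rle_trans.
  { apply Rmult_le_compat_r; [left; apply exp_pos | exact Hp]. }
  rewrite <- !exp_plus. apply exp_le.
  assert (- (b * y) <= Rabs b * Rabs y).
  { rewrite <- Rabs_mult, <- Rabs_Ropp. apply Rle_abs. }
  rewrite <- (pow2_abs y). set (z := Rabs y) in *.
  assert (d ^ 2 / (4 * a) - d * z + a * z ^ 2 = (d - 2 * a * z) ^ 2 / (4 * a)) by (field; lra).
  assert (0 <= (d - 2 * a * z) ^ 2 / (4 * a)).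
  { apply Rmult_le_pos. apply pow2_ge_0. left; apply Rinv_0_lt_compat; lra. }
  unfold d in *. nra.
Qed.

Definition sgz (n : Z) : R := if Z.even n then 1 else -1.

Lemma sgz_add n m : sgz (n + m) = sgz n * sgz m.
Proof. unfold sgz. rewrite Z.even_add. destruct (Z.even n), (Z.even m); simpl; ring. Qed.

Lemma sgz_succ n : sgz (n + 1) = - sgz n.
Proof. rewrite sgz_add. unfold sgz at 2. simpl. ring. Qed.

Lemma Rabs_sgz n : Rabs (sgz n) = 1.
Proof. unfold sgz. destruct (Z.even n). apply Rabs_R1. rewrite Rabs_left; lra. Qed.

Lemma has_sum_gauss_weighted (w : Z -> R) (k : nat) (a b c : R) : 0 < a ->
  (forall n, Rabs (w n) <= Rabs (IZR n) ^ k) ->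
  exists s, has_sum (fun n : Z => w n * exp (- (a * IZR n ^ 2 + b * IZR n + c))) s.
Proof.
  intros Ha Hw. destruct (has_sum_gauss k a b c Ha) as [s Hs].
  eapply has_sum_dominated; [|exact Hs]. intros n. simpl.
  rewrite Rabs_mult, (Rabs_pos_eq (exp _)) by (left; apply exp_pos).
  apply Rmult_le_compat_r; auto. left; apply exp_pos.
Qed.

(** * The finite and infinite q-Pochhammer symbols, with [q = exp (-t)] *)

Fixpoint qp (t : R) (n : nat) : R :=
  match n with
  | O => 1
  | S m => qp t m * (1 - exp (- (INR (S m) * t)))
  end.

Definition Eu (t : R) : R := real (Lim_seq (qp t)).

Lemma qp_factor t n : 0 < t -> 0 < 1 - exp (- (INR (S n) * t)) < 1.
Proof.
  intros Ht. assert (0 < INR (S n) * t).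
  { apply Rmult_lt_0_compat; auto. apply lt_0_INR; lia. }
  pose proof (exp_lt_1 _ H). pose proof (exp_pos (- (INR (S n) * t))). lra.
Qed.

(** From [1 - x >= exp (- x / (1 - x))] and the geometric series. *)
Lemma qp_lower t n : 0 < t -> exp (- (exp (- t) / (1 - exp (- t)) ^ 2)) <= qp t n.
Proof.
  intros Ht. set (x := exp (- t)). assert (Hx : 0 < x < 1).
  { split; [apply exp_pos | apply exp_lt_1; auto]. }
  assert (P : forall n, exp (- ((x - exp (- (INR (S n) * t))) / (1 - x) ^ 2)) <= qp t n).
  { clear n. induction n.
    - simpl. replace (x - exp (- (1 * t))) with 0 by (unfold x; rewrite Rmult_1_l; ring).
      unfold Rdiv. rewrite Rmult_0_l, Ropp_0, exp_0. lra.
    - set (y := exp (- (INR (S n) * t))) in *.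
      assert (Ey : exp (- (INR (S (S n)) * t)) = y * x).
      { unfold x, y. rewrite <- exp_plus. f_equal. rewrite (S_INR (S n)). ring. }
      rewrite Ey. change (qp t (S n)) with (qp t n * (1 - y)).
      assert (Hy : 0 < y <= x).
      { split; [apply exp_pos|]. apply exp_le. rewrite S_INR.
        pose proof (pos_INR n). nra. }
      assert (F : exp (- (y / (1 - x))) <= 1 - y).
      { rewrite exp_Ropp. apply Rmult_le_reg_l with (exp (y / (1 - x))); [apply exp_pos|].
        rewrite Rinv_r by (apply Rgt_not_eq, exp_pos).
        pose proof (exp_ge_1x (y / (1 - x))) as G.
        assert (y / (1 - y) <= y / (1 - x)).
        { apply Rmult_le_compat_l; [lra|]. apply Rinv_le_contravar; lra. }
        assert (1 + y / (1 - y) = / (1 - y)) by (field; lra).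
        apply Rle_trans with (/ (1 - y) * (1 - y)). right; field; lra.
        apply Rmult_le_compat_r; lra. }
      replace (- ((x - y * x) / (1 - x) ^ 2)) with
        (- ((x - y) / (1 - x) ^ 2) + - (y / (1 - x))) by (field; lra).
      rewrite exp_plus. apply Rmult_le_compat; auto; left; apply exp_pos. }
  eapply Rle_trans; [|apply P]. apply exp_le. apply Ropp_le_contravar.
  apply Rmult_le_compat_r. left; apply Rinv_0_lt_compat, pow_lt; lra.
  pose proof (exp_pos (- (INR (S n) * t))). lra.
Qed.

Lemma qp_decr t n : 0 < t -> qp t (S n) <= qp t n.
Proof.
  intros Ht. pose proof (qp_lower t n Ht). pose proof (qp_factor t n Ht).
  pose proof (exp_pos (- (exp (- t) / (1 - exp (- t)) ^ 2))).
  change (qp t (S n)) with (qp t n * (1 - exp (- (INR (S n) * t)))). nra.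
Qed.

Lemma qp_pos t n : 0 < t -> 0 < qp t n.
Proof. intros Ht. eapply Rlt_le_trans; [apply exp_pos | apply qp_lower; auto]. Qed.

Lemma qp_le_1 t n : 0 < t -> qp t n <= 1.
Proof.
  intros Ht. induction n; simpl; [lra|]. eapply Rle_trans; [apply qp_decr; auto | auto].
Qed.

Lemma qp_lim t : 0 < t -> is_lim_seq (qp t) (Eu t).
Proof.
  intros Ht. assert (ex_finite_lim_seq (qp t)) as [l H].
  { apply ex_finite_lim_seq_decr with (exp (- (exp (- t) / (1 - exp (- t)) ^ 2))).
    intros; apply qp_decr; auto. intros; apply qp_lower; auto. }
  unfold Eu. rewrite (is_lim_seq_unique _ _ H). exact H.
Qed.

Lemma Eu_lower t : 0 < t -> exp (- (exp (- t) / (1 - exp (- t)) ^ 2)) <= Eu t.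
Proof.
  intros Ht. refine (is_lim_seq_le _ _ (Finite _) (Finite _) _ (is_lim_seq_const _) (qp_lim t Ht)).
  intros; apply qp_lower; auto.
Qed.

Lemma Eu_pos t : 0 < t -> 0 < Eu t.
Proof. intros Ht. eapply Rlt_le_trans; [apply exp_pos | apply Eu_lower; auto]. Qed.

Lemma Eu_le_qp t n : 0 < t -> Eu t <= qp t n.
Proof.
  intros Ht. pose proof (qp_lim t Ht) as H. apply (is_lim_seq_incr_n _ n) in H.
  refine (is_lim_seq_le _ _ (Finite _) (Finite _) _ H (is_lim_seq_const _)).
  intros m. induction m; simpl; [lra|]. eapply Rle_trans; [apply qp_decr; auto | auto].
Qed.

Lemma Eu_le_1 t : 0 < t -> Eu t <= 1.
Proof. intros Ht. apply (Eu_le_qp t 0 Ht). Qed.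

(** The reciprocal Pochhammer symbol extended by [0] to negative indices: with
    this convention [iqp_pred] holds for every integer, so that recurrences
    between q-binomial coefficients need no boundary cases. *)
Definition iqp (t : R) (n : Z) : R := if Z_lt_dec n 0 then 0 else / qp t (Z.to_nat n).

Lemma iqp_pred t n : 0 < t -> iqp t (n - 1) = (1 - exp (- (IZR n * t))) * iqp t n.
Proof.
  intros Ht. unfold iqp. destruct (Z_lt_dec (n - 1) 0), (Z_lt_dec n 0); try lia.
  - ring.
  - assert (n = 0%Z) by lia. subst. rewrite Rmult_0_l, Ropp_0, exp_0. ring.
  - replace (Z.to_nat n) with (S (Z.to_nat (n - 1))) by lia.
    change (qp t (S (Z.to_nat (n - 1)))) with
      (qp t (Z.to_nat (n - 1)) * (1 - exp (- (INR (S (Z.to_nat (n - 1))) * t)))).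
    pose proof (qp_factor t (Z.to_nat (n - 1)) Ht) as F.
    replace (IZR n) with (INR (S (Z.to_nat (n - 1)))).
    2:{ rewrite INR_IZR_INZ. f_equal. lia. }
    pose proof (qp_pos t (Z.to_nat (n - 1)) Ht). field. lra.
Qed.

Lemma iqp_bound t n : 0 < t -> 0 <= iqp t n <= / Eu t.
Proof.
  intros Ht. pose proof (Eu_pos t Ht). pose proof (Rinv_0_lt_compat _ H).
  unfold iqp. destruct Z_lt_dec; [lra|].
  pose proof (qp_pos t (Z.to_nat n) Ht). split.
  left; apply Rinv_0_lt_compat; auto. apply Rinv_le_contravar; auto. apply Eu_le_qp; auto.
Qed.

Lemma iqp_lim t (f : nat -> Z) : 0 < t ->
  (forall m : nat, exists N : nat, forall n, (N <= n)%nat -> (Z.of_nat m <= f n)%Z) ->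
  is_lim_seq (fun n => iqp t (f n)) (/ Eu t).
Proof.
  intros Ht Hf.
  apply (is_lim_seq_ext_loc (fun n => / qp t (Z.to_nat (f n)))).
  - destruct (Hf 0%nat) as [N HN]. exists N. intros n Hn. specialize (HN n Hn).
    unfold iqp. destruct Z_lt_dec; auto; lia.
  - apply (is_lim_seq_inv _ (Eu t)).
    + pose proof (qp_lim t Ht) as L. apply is_lim_seq_spec in L. apply is_lim_seq_spec.
      intros eps. destruct (L eps) as [M HM]. destruct (Hf M) as [N HN].
      exists N. intros n Hn. apply HM. specialize (HN n Hn). lia.
    + pose proof (Eu_pos t Ht). intros E. inversion E. lra.
Qed.

(** * The Jacobi triple product *)

(** The q-binomial coefficient [2N choose N+j] to the base [exp (-2t)]. *)
Definition jcoef (t : R) (N : nat) (j : Z) : R :=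
  qp (2 * t) (2 * N) * (iqp (2 * t) (Z.of_nat N - j) * iqp (2 * t) (Z.of_nat N + j)).

Fixpoint jprod (z t : R) (N : nat) : R :=
  match N with
  | O => 1
  | S m => jprod z t m * ((1 + z * exp (- ((2 * INR m + 1) * t)))
                          * (1 + exp (- ((2 * INR m + 1) * t)) / z))
  end.

Definition jterm (g : Z -> R) (t : R) (N : nat) (j : Z) : R :=
  jcoef t N j * (exp (- (t * IZR j ^ 2)) * g j).

Lemma jcoef_rec t N j : 0 < t ->
  jcoef t (S N) j = (1 + exp (- ((2 * INR N + 1) * t)) ^ 2) * jcoef t N j
    + exp (- (2 * t * (INR N + 1 - IZR j))) * jcoef t N (j - 1)
    + exp (- (2 * t * (INR N + 1 + IZR j))) * jcoef t N (j + 1).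
Proof.
  intros Ht. unfold jcoef. assert (H2 : 0 < 2 * t) by lra.
  set (n := Z.of_nat N).
  replace (Z.of_nat (S N)) with (n + 1)%Z by (unfold n; lia).
  pose proof (iqp_pred (2 * t) (n + 1 - j) H2) as A1.
  pose proof (iqp_pred (2 * t) (n - j) H2) as A2.
  pose proof (iqp_pred (2 * t) (n + 1 + j) H2) as B1.
  pose proof (iqp_pred (2 * t) (n + j) H2) as B2.
  replace (n + 1 - j - 1)%Z with (n - j)%Z in A1 by lia.
  replace (n + 1 + j - 1)%Z with (n + j)%Z in B1 by lia.
  replace (n - (j - 1))%Z with (n + 1 - j)%Z by lia.
  replace (n + (j - 1))%Z with (n + j - 1)%Z by lia.
  replace (n - (j + 1))%Z with (n - j - 1)%Z by lia.
  replace (n + (j + 1))%Z with (n + 1 + j)%Z by lia.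
  rewrite A2, A1, B2, B1.
  set (u := iqp (2 * t) (n + 1 - j)). set (v := iqp (2 * t) (n + 1 + j)).
  replace (2 * S N)%nat with (S (S (2 * N))) by lia.
  cbn [qp]. rewrite !S_INR, mult_INR. change (INR 2) with 2.
  rewrite !minus_IZR, !plus_IZR. unfold n. rewrite <- INR_IZR_INZ.
  (* X = Q^(N-j), Y = Q^(N+j) and Q, in which the claim is a polynomial identity *)
  set (X := exp (- ((INR N - IZR j) * (2 * t)))).
  set (Y := exp (- ((INR N + IZR j) * (2 * t)))).
  set (Q := exp (- (2 * t))).
  replace (exp (- ((INR N + 1 - IZR j) * (2 * t)))) with (X * Q)
    by (unfold X, Q; rewrite <- exp_plus; f_equal; ring).
  replace (exp (- ((INR N + 1 + IZR j) * (2 * t)))) with (Y * Q)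
    by (unfold Y, Q; rewrite <- exp_plus; f_equal; ring).
  replace (exp (- (2 * t * (INR N + 1 - IZR j)))) with (X * Q)
    by (unfold X, Q; rewrite <- exp_plus; f_equal; ring).
  replace (exp (- (2 * t * (INR N + 1 + IZR j)))) with (Y * Q)
    by (unfold Y, Q; rewrite <- exp_plus; f_equal; ring).
  replace (exp (- ((2 * INR N + 1) * (2 * t)))) with (X * Y * Q)
    by (unfold X, Y, Q; rewrite <- !exp_plus; f_equal; ring).
  replace (exp (- ((2 * INR N + 1 + 1) * (2 * t)))) with (X * Y * Q * Q)
    by (unfold X, Y, Q; rewrite <- !exp_plus; f_equal; ring).
  replace (exp (- ((2 * INR N + 1) * t)) ^ 2) with (X * Y * Q).
  2:{ unfold X, Y, Q. simpl. rewrite Rmult_1_r, <- !exp_plus; f_equal; ring. }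
  ring.
Qed.

Lemma jterm_rec g z t N j : 0 < t -> z <> 0 -> (forall j, g (j + 1)%Z = z * g j) ->
  let e := exp (- ((2 * INR N + 1) * t)) in
  jterm g t (S N) j =
    (1 + e ^ 2) * jterm g t N j + z * e * jterm g t N (j - 1) + e / z * jterm g t N (j + 1).
Proof.
  intros Ht Hz Hg e. unfold jterm. rewrite jcoef_rec by auto. fold e.
  rewrite Hg. replace (g j) with (z * g (j - 1)%Z) by (rewrite <- Hg; f_equal; lia).
  rewrite plus_IZR, minus_IZR.
  replace (exp (- (t * (IZR j - 1) ^ 2)))
    with (exp (- (t * IZR j ^ 2)) * (exp (- (2 * t * (INR N + 1 - IZR j))) / e)).
  2:{ unfold e, Rdiv. rewrite <- exp_Ropp, <- !exp_plus. f_equal. ring. }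
  replace (exp (- (t * (IZR j + 1) ^ 2)))
    with (exp (- (t * IZR j ^ 2)) * (exp (- (2 * t * (INR N + 1 + IZR j))) / e)).
  2:{ unfold e, Rdiv. rewrite <- exp_Ropp, <- !exp_plus. f_equal. ring. }
  field. split; auto. apply Rgt_not_eq, exp_pos.
Qed.

Lemma has_sum_shift (f : Z -> R) (k : Z) s : has_sum f s -> has_sum (fun j => f (j + k)%Z) s.
Proof.
  intros H. apply (has_sum_reindex (fun j => j - k)%Z (fun j => j + k)%Z); intros; try lia.
  eapply has_sum_eq; [|reflexivity|exact H]. intros; simpl. f_equal. lia.
Qed.

Lemma jterm_0 g t : g 0%Z = 1 -> forall j, jterm g t 0 j = if Z.eq_dec j 0 then 1 else 0.
Proof.
  intros Hg j. unfold jterm, jcoef, iqp. destruct (Z.eq_dec j 0) as [->|N].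
  - simpl. rewrite Hg. replace (- (t * (0 * (0 * 1)))) with 0 by ring. rewrite exp_0. field.
  - destruct (Z_lt_dec (Z.of_nat 0 - j)), (Z_lt_dec (Z.of_nat 0 + j)); try lia; ring.
Qed.

Lemma has_sum_jterm g z t N : 0 < t -> z <> 0 -> g 0%Z = 1 ->
  (forall j, g (j + 1)%Z = z * g j) -> has_sum (jterm g t N) (jprod z t N).
Proof.
  intros Ht Hz H0 Hg. induction N as [|N IH].
  - apply (has_sum_eq (jterm g t 0) _ (lsum (jterm g t 0) [0%Z])); auto.
    + cbn [lsum fold_right]. rewrite jterm_0 by auto. simpl. ring.
    + apply has_sum_finite.
      * constructor; auto; constructor.
      * intros x Hx. rewrite jterm_0 by auto. destruct (Z.eq_dec x 0); auto. subst.
        exfalso; apply Hx; left; auto.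
  - set (e := exp (- ((2 * INR N + 1) * t))).
    apply (has_sum_eq (fun j => (1 + e ^ 2) * jterm g t N j
       + z * e * jterm g t N (j + -1) + e / z * jterm g t N (j + 1)) _
       ((1 + e ^ 2) * jprod z t N + z * e * jprod z t N + e / z * jprod z t N)).
    + intros j. rewrite (jterm_rec g z) by auto. reflexivity.
    + simpl. fold e. field. auto.
    + repeat apply has_sum_plus; apply has_sum_scal; auto; apply has_sum_shift; auto.
Qed.

Lemma jcoef_bound t N j : 0 < t -> Rabs (jcoef t N j) <= / Eu (2 * t) ^ 2.
Proof.
  intros Ht. assert (H2 : 0 < 2 * t) by lra. unfold jcoef.
  pose proof (iqp_bound (2 * t) (Z.of_nat N - j) H2) as A.
  pose proof (iqp_bound (2 * t) (Z.of_nat N + j) H2) as B.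
  pose proof (qp_pos (2 * t) (2 * N) H2). pose proof (qp_le_1 (2 * t) (2 * N) H2).
  pose proof (Eu_pos (2 * t) H2).
  assert (0 <= iqp (2 * t) (Z.of_nat N - j) * iqp (2 * t) (Z.of_nat N + j)) by nra.
  rewrite Rabs_pos_eq by (apply Rmult_le_pos; lra).
  apply Rle_trans with (1 * (/ Eu (2 * t) * / Eu (2 * t))).
  - apply Rmult_le_compat; auto; try lra. apply Rmult_le_compat; lra.
  - right. field. lra.
Qed.

Lemma jcoef_lim t j : 0 < t -> is_lim_seq (fun N => jcoef t N j) (/ Eu (2 * t)).
Proof.
  intros Ht. assert (H2 : 0 < 2 * t) by lra. pose proof (Eu_pos (2 * t) H2).
  replace (/ Eu (2 * t)) with (Eu (2 * t) * (/ Eu (2 * t) * / Eu (2 * t))) by (field; lra).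
  apply is_lim_seq_mult'; [|apply is_lim_seq_mult'].
  - pose proof (qp_lim (2 * t) H2) as L. apply is_lim_seq_spec in L. apply is_lim_seq_spec.
    intros eps. destruct (L eps) as [M HM]. exists M. intros n Hn. apply HM. lia.
  - apply iqp_lim; auto. intros m. exists (Z.to_nat (Z.of_nat m + j)). intros; lia.
  - apply iqp_lim; auto. intros m. exists (Z.to_nat (Z.of_nat m - j)). intros; lia.
Qed.

(** The infinite product appears only as the limit of [jprod]: the products needed
    below recombine into q-Pochhammer symbols already at finite level, which
    saves a theory of infinite products. *)
Lemma jacobi_triple g z t S : 0 < t -> z <> 0 -> g 0%Z = 1 ->
  (forall j, g (j + 1)%Z = z * g j) ->
  (exists G, has_sum (fun j => Rabs (g j) * exp (- (t * IZR j ^ 2))) G) ->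
  has_sum (fun j => exp (- (t * IZR j ^ 2)) * g j) S ->
  is_lim_seq (jprod z t) (S / Eu (2 * t)).
Proof.
  intros Ht Hz H0 Hg [G HG] HS.
  apply (has_sum_tannery (jterm g t) (fun j => / Eu (2 * t) * (exp (- (t * IZR j ^ 2)) * g j))
    (fun j => / Eu (2 * t) ^ 2 * (Rabs (g j) * exp (- (t * IZR j ^ 2)))) _ _ (/ Eu (2 * t) ^ 2 * G)).
  - intros N j. unfold jterm. rewrite !Rabs_mult, (Rabs_pos_eq (exp _)) by (left; apply exp_pos).
    rewrite (Rmult_comm (Rabs (g j))). apply Rmult_le_compat_r.
    apply Rmult_le_pos; [left; apply exp_pos | apply Rabs_pos]. apply jcoef_bound; auto.
  - apply has_sum_scal; auto.
  - intros j. unfold jterm. apply is_lim_seq_mult'; [apply jcoef_lim; auto | apply is_lim_seq_const].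
  - intros N. apply has_sum_jterm; auto.
  - apply (has_sum_eq _ _ _ (S / Eu (2 * t)) (fun j => eq_refl) (Rmult_comm _ _)).
    apply has_sum_scal; auto.
Qed.

(** At [z = - exp (-t)] the finite triple products vanish; differentiating them
    with respect to [z] leaves [(q)_N (q)_(N-1)] with [q = exp (-2t)], whence
    the expansion of the cube of the Euler product. *)
Lemma has_sum_jterm_deriv t N : 0 < t ->
  let g j := sgz j * exp (- (t * IZR j)) in
  has_sum (jterm g t (S N)) 0 /\
  has_sum (fun j => IZR j * jterm g t (S N) j) (qp (2 * t) (S N) * qp (2 * t) N).
Proof.
  intros Ht g. set (z := - exp (- t)).
  assert (Hz : z <> 0) by (unfold z; pose proof (exp_pos (- t)); lra).
  assert (Hz' : exp (- t) <> 0) by (unfold z in Hz; lra).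
  assert (H0 : g 0%Z = 1).
  { unfold g, sgz. simpl. rewrite Rmult_0_r, Ropp_0, exp_0. ring. }
  assert (Hg : forall j, g (j + 1)%Z = z * g j).
  { intros j. unfold g, z. rewrite sgz_succ, plus_IZR.
    replace (- (t * (IZR j + 1))) with (- t + - (t * IZR j)) by ring. rewrite exp_plus. ring. }
  assert (T0 : forall n, has_sum (jterm g t (S n)) 0).
  { intros n. apply (has_sum_eq (jterm g t (S n)) _ (jprod z t (S n))); auto.
    2: apply has_sum_jterm; auto.
    induction n.
    - simpl. unfold z. replace (- ((2 * 0 + 1) * t)) with (- t) by ring. field. auto.
    - change (jprod z t (S (S n))) with (jprod z t (S n) * ((1 + z * exp (- ((2 * INR (S n) + 1) * t)))
                          * (1 + exp (- ((2 * INR (S n) + 1) * t)) / z))). rewrite IHn. ring. }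
  split; auto.
  assert (Step : forall n T D, has_sum (jterm g t n) T -> has_sum (fun j => IZR j * jterm g t n j) D ->
    let e := exp (- ((2 * INR n + 1) * t)) in
    has_sum (fun j => IZR j * jterm g t (S n) j)
      ((1 + e ^ 2) * D + (z * e * D + z * e * T) + (e / z * D + - (e / z) * T))).
  { intros n T D HT HD e.
    refine (has_sum_eq (fun j => (1 + e ^ 2) * (IZR j * jterm g t n j)
       + (z * e * (IZR (j + -1) * jterm g t n (j + -1)) + z * e * jterm g t n (j + -1))
       + (e / z * (IZR (j + 1) * jterm g t n (j + 1)) + - (e / z) * jterm g t n (j + 1)))
       _ _ _ _ eq_refl _).
    - intros j. rewrite (jterm_rec g z) by auto. fold e. rewrite !plus_IZR.
      change (j - 1)%Z with (j + -1)%Z. ring.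
    - repeat apply has_sum_plus; apply has_sum_scal; auto.
      apply (has_sum_shift (fun j => IZR j * jterm g t n j)); auto.
      apply has_sum_shift; auto.
      apply (has_sum_shift (fun j => IZR j * jterm g t n j)); auto.
      apply has_sum_shift; auto. }
  induction N as [|N IH].
  - assert (D0 : has_sum (fun j => IZR j * jterm g t 0 j) 0).
    { apply (has_sum_finite (fun j => IZR j * jterm g t 0 j) []). constructor.
      intros x _. rewrite jterm_0 by auto. destruct (Z.eq_dec x 0); subst; simpl; ring. }
    eapply has_sum_eq; [reflexivity| |apply (Step 0%nat 1 0); auto; apply (has_sum_jterm g z t 0); auto].
    simpl. replace (- ((2 * 0 + 1) * t)) with (- t) by ring.
    replace (- (1 * (2 * t))) with (- t + - t) by ring. rewrite exp_plus. unfold z. field. auto.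
  - eapply has_sum_eq; [reflexivity| |apply (Step (S N) 0 _ (T0 N) IH)].
    change (qp (2 * t) (S (S N))) with
      (qp (2 * t) (S N) * (1 - exp (- (INR (S (S N)) * (2 * t))))).
    replace (exp (- (INR (S (S N)) * (2 * t))))
      with (exp (- ((2 * INR (S N) + 1) * t)) * exp (- t)).
    2:{ rewrite <- exp_plus, (S_INR (S N)). f_equal. ring. }
    set (e := exp (- ((2 * INR (S N) + 1) * t))).
    change (qp (2 * t) (S N)) with
      (qp (2 * t) N * (1 - exp (- (INR (S N) * (2 * t))))).
    replace (exp (- (INR (S N) * (2 * t)))) with (e / exp (- t)).
    2:{ unfold e, Rdiv. rewrite <- exp_Ropp, <- exp_plus. f_equal. ring. }
    unfold z. field. auto.
Qed.

Lemma jacobi_cube t : 0 < t ->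
  has_sum (fun j => sgz j * IZR j * exp (- (t * (IZR j ^ 2 + IZR j) / 2))) (Eu t ^ 3).
Proof.
  intros Ht.
  set (w := fun j => sgz j * IZR j * exp (- (t * (IZR j ^ 2 + IZR j) / 2))).
  destruct (has_sum_gauss 1 (t / 2) (t / 2) 0) as [G HG]; [lra|].
  assert (Hb : forall j, Rabs (w j) = Rabs (IZR j) ^ 1 * exp (- (t / 2 * IZR j ^ 2 + t / 2 * IZR j + 0))).
  { intros j. unfold w. rewrite !Rabs_mult, Rabs_sgz, (Rabs_pos_eq (exp _)) by (left; apply exp_pos).
    rewrite Rmult_1_l, pow_1. do 2 f_equal. field. }
  destruct (has_sum_dominated w _ G (fun j => Req_le _ _ (Hb j)) HG) as [S HS].
  apply (has_sum_eq w _ S); auto.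
  pose (g := fun j => sgz j * exp (- (t / 2 * IZR j))).
  assert (Et : 2 * (t / 2) = t) by field.
  assert (F : forall N j, IZR j * jterm g (t / 2) N j = jcoef (t / 2) N j * w j).
  { intros N j. unfold jterm, g, w.
    replace (- (t * (IZR j ^ 2 + IZR j) / 2))
      with (- (t / 2 * IZR j ^ 2) + - (t / 2 * IZR j)) by field.
    rewrite exp_plus. ring. }
  assert (L : is_lim_seq (fun N => qp t (N + 1) * qp t N) (S / Eu t)).
  { apply (has_sum_tannery (fun N j => jcoef (t / 2) (N + 1) j * w j) (fun j => / Eu t * w j)
     (fun j => / Eu t ^ 2 * (Rabs (IZR j) ^ 1 * exp (- (t / 2 * IZR j ^ 2 + t / 2 * IZR j + 0)))) _ _
     (/ Eu t ^ 2 * G)).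
    - intros N j. rewrite Rabs_mult, Hb. apply Rmult_le_compat_r.
      rewrite <- Hb; apply Rabs_pos.
      replace (Eu t) with (Eu (2 * (t / 2))) by (rewrite Et; reflexivity). apply jcoef_bound. lra.
    - apply has_sum_scal; auto.
    - intros j. apply is_lim_seq_mult'; [|apply is_lim_seq_const].
      apply (is_lim_seq_incr_n (fun N => jcoef (t / 2) N j) 1).
      replace (Eu t) with (Eu (2 * (t / 2))) by (rewrite Et; reflexivity).
      apply jcoef_lim. lra.
    - intros N. replace (N + 1)%nat with (Datatypes.S N) by lia.
      destruct (has_sum_jterm_deriv (t / 2) N) as [_ H]; [lra|]. rewrite Et in H.
      eapply has_sum_eq; [|reflexivity|exact H]. apply F.
    - apply (has_sum_eq _ _ _ (S / Eu t) (fun j => eq_refl) (Rmult_comm _ _)).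
      apply has_sum_scal; auto. }
  assert (L' : is_lim_seq (fun N => qp t (N + 1) * qp t N) (Eu t * Eu t)).
  { apply is_lim_seq_mult'; [apply (is_lim_seq_incr_n (qp t) 1)|]; apply qp_lim; auto. }
  apply is_lim_seq_unique in L. apply is_lim_seq_unique in L'. rewrite L in L'.
  injection L' as E. pose proof (Eu_pos t Ht).
  replace (Eu t ^ 3) with (Eu t * (Eu t * Eu t)) by ring. rewrite <- E. field. lra.
Qed.

(** * Theta functions as Euler quotients *)

Fixpoint oddplus (t : R) (N : nat) : R :=
  match N with O => 1 | S m => oddplus t m * (1 + exp (- ((2 * INR m + 1) * t))) end.

Fixpoint oddminus (t : R) (N : nat) : R :=
  match N with O => 1 | S m => oddminus t m * (1 - exp (- ((2 * INR m + 1) * t))) end.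

Fixpoint allplus (t : R) (N : nat) : R :=
  match N with O => 1 | S m => allplus t m * (1 + exp (- ((INR m + 1) * t))) end.

Lemma is_lim_seq_dilate u l k : is_lim_seq u l -> is_lim_seq (fun N => u (S k * N)%nat) l.
Proof.
  intros H. apply (is_lim_seq_subseq u l (fun N => (S k * N)%nat)); auto.
  intros P [N HN]. exists N. intros n Hn. apply HN. lia.
Qed.

Lemma is_lim_seq_div_fin u v (a b : R) : is_lim_seq u a -> is_lim_seq v b -> b <> 0 ->
  is_lim_seq (fun n => u n / v n) (a / b).
Proof. intros; apply is_lim_seq_div'; auto. Qed.

Lemma lim_unique u (a b : R) : is_lim_seq u a -> is_lim_seq u b -> a = b.
Proof.
  intros Ha Hb. apply is_lim_seq_unique in Ha. apply is_lim_seq_unique in Hb.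
  rewrite Ha in Hb. injection Hb; auto.
Qed.

Lemma oddminus_pos t N : 0 < t -> 0 < oddminus t N.
Proof.
  intros Ht. induction N; simpl; [lra|]. apply Rmult_lt_0_compat; auto.
  assert (0 < (2 * INR N + 1) * t) by (pose proof (pos_INR N); nra).
  pose proof (exp_lt_1 _ H). lra.
Qed.

Lemma oddminus_lim t : 0 < t -> is_lim_seq (oddminus t) (Eu t / Eu (2 * t)).
Proof.
  intros Ht. assert (H2 : 0 < 2 * t) by lra. pose proof (Eu_pos _ H2).
  apply is_lim_seq_ext with (fun N => qp t (2 * N) / qp (2 * t) N).
  - intros N. pose proof (qp_pos (2 * t) N H2).
    enough (oddminus t N * qp (2 * t) N = qp t (2 * N)) as <- by (field; lra). clear H0.
    induction N. simpl; ring.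
    replace (2 * S N)%nat with (S (S (2 * N))) by lia. cbn [qp oddminus]. rewrite <- IHN.
    rewrite !S_INR, mult_INR. change (INR 2) with 2.
    replace ((2 * INR N + 1 + 1) * t) with ((INR N + 1) * (2 * t)) by ring. ring.
  - apply is_lim_seq_div_fin; [|apply qp_lim; auto|lra].
    apply (is_lim_seq_dilate (qp t) _ 1). apply qp_lim; auto.
Qed.

Lemma oddplus_lim t : 0 < t ->
  is_lim_seq (oddplus t) (Eu (2 * t) ^ 2 / (Eu t * Eu (4 * t))).
Proof.
  intros Ht. pose proof (Eu_pos t Ht). pose proof (Eu_pos (2 * t) ltac:(lra)).
  pose proof (Eu_pos (4 * t) ltac:(lra)).
  replace (Eu (2 * t) ^ 2 / (Eu t * Eu (4 * t)))
    with ((Eu (2 * t) / Eu (2 * (2 * t))) / (Eu t / Eu (2 * t))).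
  2:{ replace (2 * (2 * t)) with (4 * t) by ring. field. lra. }
  apply is_lim_seq_ext with (fun N => oddminus (2 * t) N / oddminus t N).
  - intros N. pose proof (oddminus_pos t N Ht).
    enough (oddplus t N * oddminus t N = oddminus (2 * t) N) as <- by (field; lra). clear H2.
    induction N. simpl; ring. cbn [oddplus oddminus]. rewrite <- IHN.
    replace (- ((2 * INR N + 1) * (2 * t)))
      with (- ((2 * INR N + 1) * t) + - ((2 * INR N + 1) * t)) by ring.
    rewrite exp_plus. ring.
  - apply is_lim_seq_div_fin; try (apply oddminus_lim; lra).
    apply Rgt_not_eq, Rdiv_lt_0_compat; lra.
Qed.

Lemma allplus_lim t : 0 < t -> is_lim_seq (allplus t) (Eu (2 * t) / Eu t).
Proof.
  intros Ht. pose proof (Eu_pos t Ht).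
  apply is_lim_seq_ext with (fun N => qp (2 * t) N / qp t N).
  - intros N. pose proof (qp_pos t N Ht).
    enough (allplus t N * qp t N = qp (2 * t) N) as <- by (field; lra). clear H0.
    induction N. simpl; ring. cbn [allplus qp]. rewrite <- IHN, !S_INR.
    replace (- ((INR N + 1) * (2 * t)))
      with (- ((INR N + 1) * t) + - ((INR N + 1) * t)) by ring.
    rewrite exp_plus. ring.
  - apply is_lim_seq_div_fin; try (apply qp_lim; lra). lra.
Qed.

Definition zsum {I : Type} (f : I -> R) : R := epsilon (inhabits 0) (has_sum f).

Lemma zsum_spec {I : Type} (f : I -> R) : (exists s, has_sum f s) -> has_sum f (zsum f).
Proof. intros H. unfold zsum. apply epsilon_spec; auto. Qed.

Lemma theta_plus t b : 0 < t ->
  has_sum (fun j => exp (- (t * IZR j ^ 2 + b * IZR j)))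
    (zsum (fun j => exp (- (t * IZR j ^ 2 + b * IZR j)))) /\
  is_lim_seq (jprod (exp (- b)) t)
    (zsum (fun j => exp (- (t * IZR j ^ 2 + b * IZR j))) / Eu (2 * t)).
Proof.
  intros Ht. set (f := fun j => exp (- (t * IZR j ^ 2 + b * IZR j))).
  assert (Hf : exists s, has_sum f s).
  { destruct (has_sum_gauss 0 t b 0 Ht) as [s Hs]. exists s.
    apply (has_sum_eq _ f _ s) in Hs; auto. intros j. unfold f. rewrite Rplus_0_r. simpl. ring. }
  apply zsum_spec in Hf. split; auto.
  apply (jacobi_triple (fun j => exp (- (b * IZR j)))); auto.
  - apply Rgt_not_eq, exp_pos.
  - rewrite Rmult_0_r, Ropp_0, exp_0; auto.
  - intros j. rewrite plus_IZR, <- exp_plus. f_equal; ring.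
  - exists (zsum f). eapply has_sum_eq; [|reflexivity|exact Hf].
    intros j. unfold f. rewrite Rabs_pos_eq by (left; apply exp_pos).
    rewrite <- exp_plus. f_equal; ring.
  - eapply has_sum_eq; [|reflexivity|exact Hf].
    intros j. unfold f. rewrite <- exp_plus. f_equal; ring.
Qed.

Lemma theta_minus t b : 0 < t ->
  has_sum (fun j => sgz j * exp (- (t * IZR j ^ 2 + b * IZR j)))
    (zsum (fun j => sgz j * exp (- (t * IZR j ^ 2 + b * IZR j)))) /\
  is_lim_seq (jprod (- exp (- b)) t)
    (zsum (fun j => sgz j * exp (- (t * IZR j ^ 2 + b * IZR j))) / Eu (2 * t)).
Proof.
  intros Ht. set (f := fun j => sgz j * exp (- (t * IZR j ^ 2 + b * IZR j))).
  destruct (has_sum_gauss 0 t b 0 Ht) as [G HG].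
  assert (Hb : forall j, Rabs (f j) = Rabs (IZR j) ^ 0 * exp (- (t * IZR j ^ 2 + b * IZR j + 0))).
  { intros j. unfold f. rewrite Rabs_mult, Rabs_sgz, (Rabs_pos_eq (exp _)) by (left; apply exp_pos).
    rewrite Rplus_0_r. reflexivity. }
  assert (Hf : exists s, has_sum f s).
  { apply (has_sum_dominated f _ G (fun j => Req_le _ _ (Hb j)) HG). }
  apply zsum_spec in Hf. split; auto.
  apply (jacobi_triple (fun j => sgz j * exp (- (b * IZR j)))); auto.
  - pose proof (exp_pos (- b)). lra.
  - unfold sgz; simpl. rewrite Rmult_0_r, Ropp_0, exp_0; ring.
  - intros j. rewrite sgz_succ, plus_IZR.
    replace (- (b * (IZR j + 1))) with (- b + - (b * IZR j)) by ring. rewrite exp_plus. ring.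
  - exists G. eapply has_sum_eq; [|reflexivity|exact HG].
    intros j. cbv beta. rewrite <- Hb. unfold f.
    rewrite !Rabs_mult. rewrite !(Rabs_pos_eq (exp _)) by (left; apply exp_pos).
    rewrite Rmult_assoc, <- exp_plus. do 2 f_equal; ring.
  - eapply has_sum_eq; [|reflexivity|exact Hf].
    intros j. unfold f. rewrite (Rmult_comm (exp _)), Rmult_assoc, <- exp_plus. do 2 f_equal; ring.
Qed.

Definition th3 (t : R) : R := Eu (2 * t) ^ 5 / (Eu t ^ 2 * Eu (4 * t) ^ 2).
Definition th4 (t : R) : R := Eu t ^ 2 / Eu (2 * t).
Definition th2 (t : R) : R := 2 * exp (- (t / 4)) * Eu (4 * t) ^ 2 / Eu (2 * t).

Lemma has_sum_th3 t : 0 < t -> has_sum (fun n => exp (- (t * IZR n ^ 2))) (th3 t).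
Proof.
  intros Ht. pose proof (Eu_pos t Ht). pose proof (Eu_pos (2 * t) ltac:(lra)).
  pose proof (Eu_pos (4 * t) ltac:(lra)).
  destruct (theta_plus t 0 Ht) as [HS L].
  set (S := zsum _) in *.
  apply (has_sum_eq _ (fun n => exp (- (t * IZR n ^ 2))) _ (th3 t)) in HS; auto.
  - intros j. f_equal. ring.
  - assert (L' : is_lim_seq (jprod (exp (- 0)) t)
      (Eu (2 * t) ^ 2 / (Eu t * Eu (4 * t)) * (Eu (2 * t) ^ 2 / (Eu t * Eu (4 * t))))).
    { apply is_lim_seq_ext with (fun N => oddplus t N * oddplus t N).
      - induction n; simpl; [ring|]. rewrite <- IHn, Ropp_0, exp_0. field.
      - apply is_lim_seq_mult'; apply oddplus_lim; auto. }
    pose proof (lim_unique _ _ _ L L') as E. unfold th3.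
    replace S with (S / Eu (2 * t) * Eu (2 * t)) by (field; lra). rewrite E. field. lra.
Qed.

Lemma has_sum_th4 t : 0 < t -> has_sum (fun n => sgz n * exp (- (t * IZR n ^ 2))) (th4 t).
Proof.
  intros Ht. pose proof (Eu_pos t Ht). pose proof (Eu_pos (2 * t) ltac:(lra)).
  destruct (theta_minus t 0 Ht) as [HS L].
  set (S := zsum _) in *.
  apply (has_sum_eq _ (fun n => sgz n * exp (- (t * IZR n ^ 2))) _ (th4 t)) in HS; auto.
  - intros j. do 2 f_equal. ring.
  - assert (L' : is_lim_seq (jprod (- exp (- 0)) t)
      (Eu t / Eu (2 * t) * (Eu t / Eu (2 * t)))).
    { apply is_lim_seq_ext with (fun N => oddminus t N * oddminus t N).
      - induction n; simpl; [ring|]. rewrite <- IHn, Ropp_0, exp_0. field.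
      - apply is_lim_seq_mult'; apply oddminus_lim; auto. }
    pose proof (lim_unique _ _ _ L L') as E. unfold th4.
    replace S with (S / Eu (2 * t) * Eu (2 * t)) by (field; lra). rewrite E. field. lra.
Qed.

Lemma has_sum_th2 t : 0 < t -> has_sum (fun n => exp (- (t * (IZR n + / 2) ^ 2))) (th2 t).
Proof.
  intros Ht. pose proof (Eu_pos t Ht). pose proof (Eu_pos (2 * t) ltac:(lra)).
  pose proof (Eu_pos (4 * t) ltac:(lra)).
  destruct (theta_plus t t Ht) as [HS L].
  set (S := zsum _) in *. apply (has_sum_scal (exp (- (t / 4)))) in HS.
  apply (has_sum_eq _ (fun n => exp (- (t * (IZR n + / 2) ^ 2))) _ (th2 t)) in HS; auto.
  - intros j. rewrite <- exp_plus. f_equal. field.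
  - assert (L2 : is_lim_seq (fun N => allplus (2 * t) (N + 1)) (Eu (4 * t) / Eu (2 * t))).
    { apply (is_lim_seq_incr_n (allplus (2 * t)) 1).
      replace (4 * t) with (2 * (2 * t)) by ring. apply allplus_lim; lra. }
    assert (L1 : is_lim_seq (allplus (2 * t)) (Eu (4 * t) / Eu (2 * t))).
    { apply (is_lim_seq_incr_n (allplus (2 * t)) 1). auto. }
    assert (L' : is_lim_seq (fun N => jprod (exp (- t)) t (N + 1))
      (2 * (Eu (4 * t) / Eu (2 * t)) * (Eu (4 * t) / Eu (2 * t)))).
    { apply is_lim_seq_ext with (fun N => 2 * allplus (2 * t) (N + 1) * allplus (2 * t) N).
      - intros N. rewrite Nat.add_1_r. induction N as [|n IHn].
        + simpl. replace (- ((2 * 0 + 1) * t)) with (- t) by ring.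
          replace (- ((0 + 1) * (2 * t))) with (- t + - t) by ring. rewrite exp_plus.
          field. apply Rgt_not_eq, exp_pos.
        + cbn [jprod allplus] in *. rewrite <- IHn, !S_INR.
          replace (exp (- ((2 * (INR n + 1) + 1) * t)))
            with (exp (- t) * exp (- ((INR n + 1) * (2 * t)))).
          2:{ rewrite <- exp_plus. f_equal. ring. }
          replace (exp (- ((INR n + 1 + 1) * (2 * t))))
            with (exp (- t) * exp (- t) * exp (- ((INR n + 1) * (2 * t)))).
          2:{ rewrite <- !exp_plus. f_equal. ring. }
          field. apply Rgt_not_eq, exp_pos.
      - apply is_lim_seq_mult'; auto. apply is_lim_seq_mult'; auto. apply is_lim_seq_const. }
    apply (is_lim_seq_incr_n _ 1) in L.
    pose proof (lim_unique _ _ _ L L') as E. unfold th2.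
    replace S with (S / Eu (2 * t) * Eu (2 * t)) by (field; lra). rewrite E. field. lra.
Qed.

(** ** Pairs of theta functions whose product is an Euler quotient

    The [N]-th factors of two triple products and of one product of the preceding
    kind exhaust the residue classes modulo 5 among the factors [5N, ..., 5N+4] of
    another product of that kind. *)

Ltac residues5 e c1 c2 c3 c4 c5 :=
  repeat match goal with |- context [exp ?x] => first
    [ replace (exp x) with (e c1) by (unfold e; f_equal; field)
    | replace (exp x) with (e c2) by (unfold e; f_equal; field)
    | replace (exp x) with (e c3) by (unfold e; f_equal; field)
    | replace (exp x) with (e c4) by (unfold e; f_equal; field)
    | replace (exp x) with (e c5) by (unfold e; f_equal; field) ] end;
  ring.

Lemma theta_pair_odd t : 0 < t -> exists S1 S2,
  has_sum (fun j => exp (- (5 * t * IZR j ^ 2 + 4 * t * IZR j))) S1 /\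
  has_sum (fun j => exp (- (5 * t * IZR j ^ 2 + 2 * t * IZR j))) S2 /\
  S1 * S2 = Eu (2 * t) ^ 2 * Eu (5 * t) * Eu (20 * t) / (Eu t * Eu (4 * t)).
Proof.
  intros Ht. pose proof (Eu_pos t Ht) as E1. pose proof (Eu_pos (2 * t) ltac:(lra)) as E2.
  pose proof (Eu_pos (4 * t) ltac:(lra)) as E4. pose proof (Eu_pos (5 * t) ltac:(lra)) as E5.
  pose proof (Eu_pos (10 * t) ltac:(lra)) as E10. pose proof (Eu_pos (20 * t) ltac:(lra)) as E20.
  destruct (theta_plus (5 * t) (4 * t)) as [H1 L1]; [lra|].
  destruct (theta_plus (5 * t) (2 * t)) as [H2 L2]; [lra|].
  exists (zsum (fun j => exp (- (5 * t * IZR j ^ 2 + 4 * t * IZR j)))).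
  exists (zsum (fun j => exp (- (5 * t * IZR j ^ 2 + 2 * t * IZR j)))).
  split; auto. split; auto. set (S1 := zsum _) in *. set (S2 := zsum _) in *.
  pose proof (is_lim_seq_mult' _ _ _ _ (is_lim_seq_mult' _ _ _ _ L1 L2)
     (oddplus_lim (5 * t) ltac:(lra))) as L.
  pose proof (is_lim_seq_dilate _ _ 4 (oddplus_lim t Ht)) as L'.
  assert (E : forall N, jprod (exp (- (4 * t))) (5 * t) N * jprod (exp (- (2 * t))) (5 * t) N
     * oddplus (5 * t) N = oddplus t (5 * N)).
  { induction N. simpl; ring.
    replace (5 * S N)%nat with (S (S (S (S (S (5 * N)))))) by lia.
    cbn [jprod oddplus]. rewrite <- IHN, !S_INR, mult_INR.
    replace (INR 5) with 5 by (simpl; ring). unfold Rdiv. rewrite <- !exp_Ropp, <- !exp_plus.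
    pose (e c := exp (- ((10 * INR N + c) * t))).
    residues5 e 1 3 5 7 9. }
  apply (is_lim_seq_ext _ _ _ E) in L. pose proof (lim_unique _ _ _ L L') as Q.
  replace (2 * (5 * t)) with (10 * t) in Q by ring. replace (4 * (5 * t)) with (20 * t) in Q by ring.
  apply Rmult_eq_reg_r with (/ Eu (10 * t) ^ 2 * (Eu (10 * t) ^ 2 / (Eu (5 * t) * Eu (20 * t)))).
  transitivity (Eu (2 * t) ^ 2 / (Eu t * Eu (4 * t))).
  - rewrite <- Q. field. repeat split; lra.
  - field. repeat split; lra.
  - apply Rmult_integral_contrapositive_currified.
    apply Rinv_neq_0_compat, pow_nonzero; lra.
    apply Rgt_not_eq, Rdiv_lt_0_compat. apply pow_lt; lra. apply Rmult_lt_0_compat; lra.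
Qed.

Lemma theta_pair_even t : 0 < t -> exists S1 S2,
  has_sum (fun j => exp (- (5 * t * IZR j ^ 2 + - (3 * t) * IZR j))) S1 /\
  has_sum (fun j => exp (- (5 * t * IZR j ^ 2 + t * IZR j))) S2 /\
  S1 * S2 = Eu (10 * t) ^ 3 * Eu (4 * t) / (Eu (20 * t) * Eu (2 * t)).
Proof.
  intros Ht. pose proof (Eu_pos (2 * t) ltac:(lra)) as E2.
  pose proof (Eu_pos (4 * t) ltac:(lra)) as E4.
  pose proof (Eu_pos (10 * t) ltac:(lra)) as E10. pose proof (Eu_pos (20 * t) ltac:(lra)) as E20.
  destruct (theta_plus (5 * t) (- (3 * t))) as [H1 L1]; [lra|].
  destruct (theta_plus (5 * t) t) as [H2 L2]; [lra|].
  exists (zsum (fun j => exp (- (5 * t * IZR j ^ 2 + - (3 * t) * IZR j)))).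
  exists (zsum (fun j => exp (- (5 * t * IZR j ^ 2 + t * IZR j)))).
  split; auto. split; auto. set (S1 := zsum _) in *. set (S2 := zsum _) in *.
  pose proof (is_lim_seq_mult' _ _ _ _ (is_lim_seq_mult' _ _ _ _ L1 L2)
     (allplus_lim (10 * t) ltac:(lra))) as L.
  pose proof (is_lim_seq_dilate _ _ 4 (allplus_lim (2 * t) ltac:(lra))) as L'.
  assert (E : forall N, jprod (exp (- - (3 * t))) (5 * t) N * jprod (exp (- t)) (5 * t) N
     * allplus (10 * t) N = allplus (2 * t) (5 * N)).
  { induction N. simpl; ring.
    replace (5 * S N)%nat with (S (S (S (S (S (5 * N)))))) by lia.
    cbn [jprod allplus]. rewrite <- IHN, !S_INR, mult_INR.
    replace (INR 5) with 5 by (simpl; ring). unfold Rdiv. rewrite <- !exp_Ropp, <- !exp_plus.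
    pose (e c := exp (- ((10 * INR N + c) * t))).
    residues5 e 2 4 6 8 10. }
  apply (is_lim_seq_ext _ _ _ E) in L. pose proof (lim_unique _ _ _ L L') as Q.
  replace (2 * (5 * t)) with (10 * t) in Q by ring. replace (2 * (10 * t)) with (20 * t) in Q by ring.
  replace (2 * (2 * t)) with (4 * t) in Q by ring.
  apply Rmult_eq_reg_r with (/ Eu (10 * t) ^ 2 * (Eu (20 * t) / Eu (10 * t))).
  transitivity (Eu (4 * t) / Eu (2 * t)).
  - rewrite <- Q. field. repeat split; lra.
  - field. repeat split; lra.
  - apply Rmult_integral_contrapositive_currified.
    apply Rinv_neq_0_compat, pow_nonzero; lra.
    apply Rgt_not_eq, Rdiv_lt_0_compat; lra.
Qed.

(** The theta series whose quotient is the Rogers-Ramanujan continued fraction. *)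
Definition rrA (t : R) : R :=
  zsum (fun j => sgz j * exp (- (5 * t / 2 * IZR j ^ 2 + - (3 * t / 2) * IZR j))).
Definition rrB (t : R) : R :=
  zsum (fun j => sgz j * exp (- (5 * t / 2 * IZR j ^ 2 + t / 2 * IZR j))).

Lemma has_sum_rrA t : 0 < t ->
  has_sum (fun j => sgz j * exp (- (5 * t / 2 * IZR j ^ 2 + - (3 * t / 2) * IZR j))) (rrA t).
Proof. intros Ht. apply theta_minus. lra. Qed.

Lemma has_sum_rrB t : 0 < t ->
  has_sum (fun j => sgz j * exp (- (5 * t / 2 * IZR j ^ 2 + t / 2 * IZR j))) (rrB t).
Proof. intros Ht. apply theta_minus. lra. Qed.

Lemma rrA_rrB t : 0 < t -> rrA t * rrB t = Eu t * Eu (5 * t).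
Proof.
  intros Ht. pose proof (Eu_pos t Ht) as E1. pose proof (Eu_pos (5 * t) ltac:(lra)) as E5.
  destruct (theta_minus (5 * t / 2) (- (3 * t / 2))) as [H1 L1]; [lra|].
  destruct (theta_minus (5 * t / 2) (t / 2)) as [H2 L2]; [lra|].
  fold (rrA t) in L1. fold (rrB t) in L2.
  pose proof (is_lim_seq_mult' _ _ _ _ (is_lim_seq_mult' _ _ _ _ L1 L2)
     (qp_lim (5 * t) ltac:(lra))) as L.
  pose proof (is_lim_seq_dilate _ _ 4 (qp_lim t Ht)) as L'.
  assert (E : forall N, jprod (- exp (- - (3 * t / 2))) (5 * t / 2) N
     * jprod (- exp (- (t / 2))) (5 * t / 2) N * qp (5 * t) N = qp t (5 * N)).
  { induction N. simpl; ring.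
    replace (5 * S N)%nat with (S (S (S (S (S (5 * N)))))) by lia.
    cbn [jprod qp]. rewrite <- IHN, !S_INR, mult_INR.
    replace (INR 5) with 5 by (simpl; ring). unfold Rdiv.
    rewrite !Rinv_opp, !Ropp_mult_distr_l_reverse, !Ropp_mult_distr_r_reverse.
    rewrite <- !exp_Ropp, <- !exp_plus.
    pose (e c := exp (- ((5 * INR N + c) * t))).
    residues5 e 1 2 3 4 5. }
  apply (is_lim_seq_ext _ _ _ E) in L. pose proof (lim_unique _ _ _ L L') as Q.
  replace (2 * (5 * t / 2)) with (5 * t) in Q by field. rewrite <- Q. field. lra.
Qed.

(** * Rearranging sums over the square lattice *)

Lemma has_sum_reindex' {I J : Type} (h : I -> J) (k : J -> I) (f : J -> R) (g : I -> R) s :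
  (forall i, k (h i) = i) -> (forall j, h (k j) = j) -> (forall i, f (h i) = g i) ->
  has_sum g s -> has_sum f s.
Proof.
  intros K1 K2 E H. apply (has_sum_reindex h k); auto.
  apply (has_sum_eq g _ s s); auto.
Qed.

(** The lattice points with [x + y] even are the image of the whole lattice under
    [(m, n) -> (m + n, m - n)], and those with [x + y] odd a translate of them. *)
Lemma has_sum_parity (F : Z * Z -> R) s0 s1 :
  has_sum (fun p : Z * Z => let (m, n) := p in F (m + n, m - n)%Z) s0 ->
  has_sum (fun p : Z * Z => let (m, n) := p in F (m + n + 1, m - n)%Z) s1 ->
  has_sum F (s0 + s1).
Proof.
  intros H0 H1.
  pose (r0 := fun p : Z * Z => let (x, y) := p in ((x + y) mod 2 =? 0)%Z).
  pose (r1 := fun p : Z * Z => let (x, y) := p in ((x + y) mod 2 =? 1)%Z).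
  assert (A : has_sum (fun p => if r0 p then F p else 0) s0).
  { apply (has_sum_injection (fun p : Z * Z => let (m, n) := p in (m + n, m - n)%Z)
      (fun p : Z * Z => let (x, y) := p in ((x + y) / 2, (x - y) / 2)%Z)).
    - intros [m n]. f_equal; Z.div_mod_to_equations; lia.
    - intros [m n]. unfold r0. apply Z.eqb_eq. Z.div_mod_to_equations; lia.
    - intros [x y] H. apply Z.eqb_eq in H. f_equal; Z.div_mod_to_equations; lia.
    - eapply has_sum_eq; [|reflexivity|exact H0]. intros [m n]; reflexivity. }
  assert (B : has_sum (fun p => if r1 p then F p else 0) s1).
  { apply (has_sum_injection (fun p : Z * Z => let (m, n) := p in (m + n + 1, m - n)%Z)
      (fun p : Z * Z => let (x, y) := p in ((x + y - 1) / 2, (x - y - 1) / 2)%Z)).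
    - intros [m n]. f_equal; Z.div_mod_to_equations; lia.
    - intros [m n]. unfold r1. apply Z.eqb_eq. Z.div_mod_to_equations; lia.
    - intros [x y] H. apply Z.eqb_eq in H. f_equal; Z.div_mod_to_equations; lia.
    - eapply has_sum_eq; [|reflexivity|exact H1]. intros [m n]; reflexivity. }
  refine (has_sum_eq _ _ _ _ _ eq_refl (has_sum_plus _ _ _ _ A B)).
  intros [x y]. unfold r0, r1.
  pose proof (Z.mod_pos_bound (x + y) 2).
  destruct (Z.eqb_spec ((x + y) mod 2) 0), (Z.eqb_spec ((x + y) mod 2) 1); try lia; ring.
Qed.

(** In the Gaussian integers [p + i q], the residue of [p + 2 q] modulo 5 is
    the class modulo the prime [2 - i] of norm 5, and the two hypotheses run over
    [(2 - i)(s + i d)] and [(2 - i)(m + i n) + 1]. Multiplication by [i] permutes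
    the four nonzero classes cyclically, so a summand invariant under it has
    the same sum over each of them. *)
Lemma has_sum_gaussian5 (F : Z * Z -> R) s0 s1 :
  (forall p q, F (- q, p)%Z = F (p, q)) ->
  has_sum (fun z : Z * Z => let (s, d) := z in F (2 * s + d, 2 * d - s)%Z) s0 ->
  has_sum (fun z : Z * Z => let (m, n) := z in F (2 * m + n + 1, 2 * n - m)%Z) s1 ->
  has_sum F (s0 + 4 * s1).
Proof.
  intros HF H0 H1.
  pose (r := fun (c : Z) (z : Z * Z) => let (p, q) := z in ((p + 2 * q) mod 5 =? c)%Z).
  assert (A0 : has_sum (fun z => if r 0%Z z then F z else 0) s0).
  { apply (has_sum_injection (fun z : Z * Z => let (s, d) := z in (2 * s + d, 2 * d - s)%Z)
      (fun z : Z * Z => let (p, q) := z in ((2 * p - q) / 5, (p + 2 * q) / 5)%Z)).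
    - intros [m n]. f_equal; Z.div_mod_to_equations; lia.
    - intros [m n]. unfold r. apply Z.eqb_eq. Z.div_mod_to_equations; lia.
    - intros [x y] H. apply Z.eqb_eq in H. f_equal; Z.div_mod_to_equations; lia.
    - eapply has_sum_eq; [|reflexivity|exact H0]. intros [m n]; reflexivity. }
  assert (A1 : has_sum (fun z => if r 1%Z z then F z else 0) s1).
  { apply (has_sum_injection (fun z : Z * Z => let (m, n) := z in (2 * m + n + 1, 2 * n - m)%Z)
      (fun z : Z * Z => let (p, q) := z in ((2 * p - 2 - q) / 5, (p - 1 + 2 * q) / 5)%Z)).
    - intros [m n]. f_equal; Z.div_mod_to_equations; lia.
    - intros [m n]. unfold r. apply Z.eqb_eq. Z.div_mod_to_equations; lia.
    - intros [x y] H. apply Z.eqb_eq in H. f_equal; Z.div_mod_to_equations; lia.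
    - eapply has_sum_eq; [|reflexivity|exact H1]. intros [m n]; reflexivity. }
  assert (Rot : forall c c', (0 <= c < 5)%Z -> c' = (2 * c mod 5)%Z ->
     has_sum (fun z => if r c z then F z else 0) s1 ->
     has_sum (fun z => if r c' z then F z else 0) s1).
  { intros c c' Hc Hc' H.
    apply (has_sum_reindex' (fun z : Z * Z => let (p, q) := z in (- q, p)%Z)
       (fun z : Z * Z => let (p, q) := z in (q, - p)%Z) _
       (fun z => if r c z then F z else 0)); auto.
    - intros [p q]; f_equal; lia.
    - intros [p q]; f_equal; lia.
    - intros [p q]. rewrite HF. unfold r.
      destruct (Z.eqb_spec ((p + 2 * q) mod 5) c), (Z.eqb_spec ((- q + 2 * p) mod 5) c'); auto;
      exfalso; Z.div_mod_to_equations; lia. }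
  assert (A2 := Rot 1%Z 2%Z ltac:(lia) eq_refl A1).
  assert (A4 := Rot 2%Z 4%Z ltac:(lia) eq_refl A2).
  assert (A3 := Rot 4%Z 3%Z ltac:(lia) eq_refl A4).
  replace (s0 + 4 * s1) with (s0 + s1 + s1 + s1 + s1) by ring.
  refine (has_sum_eq _ _ _ _ _ eq_refl (has_sum_plus _ _ _ _ (has_sum_plus _ _ _ _
    (has_sum_plus _ _ _ _ (has_sum_plus _ _ _ _ A0 A1) A2) A3) A4)).
  intros [p q]. unfold r. pose proof (Z.mod_pos_bound (p + 2 * q) 5).
  destruct (Z.eqb_spec ((p + 2 * q) mod 5) 0), (Z.eqb_spec ((p + 2 * q) mod 5) 1),
   (Z.eqb_spec ((p + 2 * q) mod 5) 2), (Z.eqb_spec ((p + 2 * q) mod 5) 3),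
   (Z.eqb_spec ((p + 2 * q) mod 5) 4); try lia; ring.
Qed.

Lemma has_sum_pair_eq (F : Z * Z -> R) (f g : Z -> R) c a b :
  (forall m n, F (m, n) = c * (f m * g n)) -> has_sum f a -> has_sum g b ->
  has_sum F (c * (a * b)).
Proof.
  intros E Hf Hg.
  refine (has_sum_eq _ _ _ _ _ eq_refl (has_sum_scal c _ _ (has_sum_product _ _ _ _ Hf Hg))).
  intros [m n]. simpl. symmetry; apply E.
Qed.

(** ** Quadratic identities between the theta functions *)

Lemma th3_sqr t : 0 < t -> th3 t ^ 2 = th3 (2 * t) ^ 2 + th2 (2 * t) ^ 2.
Proof.
  intros Ht. pose proof (has_sum_th3 t Ht) as H3.
  pose proof (has_sum_th3 (2 * t) ltac:(lra)) as K3. pose proof (has_sum_th2 (2 * t) ltac:(lra)) as K2.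
  pose (F := fun p : Z * Z => let (x, y) := p in exp (- (t * (IZR x ^ 2 + IZR y ^ 2)))).
  assert (A : has_sum F (1 * (th3 t * th3 t))).
  { eapply has_sum_pair_eq; [|exact H3|exact H3]. intros m n. unfold F.
    rewrite Rmult_1_l, <- exp_plus. f_equal; ring. }
  assert (B : has_sum F (1 * (th3 (2 * t) * th3 (2 * t)) + 1 * (th2 (2 * t) * th2 (2 * t)))).
  { apply has_sum_parity.
    - eapply has_sum_pair_eq; [|exact K3|exact K3]. intros m n. unfold F.
      rewrite Rmult_1_l, <- exp_plus, plus_IZR, minus_IZR. f_equal; ring.
    - eapply has_sum_pair_eq; [|exact K2|exact K2]. intros m n. unfold F.
      rewrite Rmult_1_l, <- exp_plus, !plus_IZR, minus_IZR. f_equal; field. }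
  pose proof (has_sum_unique _ _ _ A B). lra.
Qed.

Lemma sgz_double_plus m n : sgz (m + n) * sgz (m - n) = 1.
Proof.
  rewrite <- sgz_add. replace (m + n + (m - n))%Z with (m + m)%Z by lia. rewrite sgz_add.
  unfold sgz. destruct (Z.even m); ring.
Qed.

Lemma th4_sqr t : 0 < t -> th4 t ^ 2 = th3 (2 * t) ^ 2 - th2 (2 * t) ^ 2.
Proof.
  intros Ht. pose proof (has_sum_th4 t Ht) as H4.
  pose proof (has_sum_th3 (2 * t) ltac:(lra)) as K3. pose proof (has_sum_th2 (2 * t) ltac:(lra)) as K2.
  pose (F := fun p : Z * Z => let (x, y) := p in sgz x * sgz y * exp (- (t * (IZR x ^ 2 + IZR y ^ 2)))).
  assert (A : has_sum F (1 * (th4 t * th4 t))).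
  { eapply has_sum_pair_eq; [|exact H4|exact H4]. intros m n. unfold F.
    replace (- (t * (IZR m ^ 2 + IZR n ^ 2))) with (- (t * IZR m ^ 2) + - (t * IZR n ^ 2)) by ring.
    rewrite exp_plus. ring. }
  assert (B : has_sum F (1 * (th3 (2 * t) * th3 (2 * t)) + -1 * (th2 (2 * t) * th2 (2 * t)))).
  { apply has_sum_parity.
    - eapply has_sum_pair_eq; [|exact K3|exact K3]. intros m n. unfold F.
      rewrite sgz_double_plus, Rmult_1_l, <- exp_plus, plus_IZR, minus_IZR.
      rewrite Rmult_1_l. f_equal; ring.
    - eapply has_sum_pair_eq; [|exact K2|exact K2]. intros m n. unfold F.
      rewrite sgz_succ, Ropp_mult_distr_l_reverse, sgz_double_plus, <- exp_plus, !plus_IZR, minus_IZR.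
      f_equal. f_equal; field. }
  pose proof (has_sum_unique _ _ _ A B). lra.
Qed.

(** In [theta_3(q)^2], a sum over the Gaussian integers, the multiples of [2 - i]
    contribute [theta_3(q^5)^2]; over the class of 1 the norm form separates
    into two one-dimensional series. *)
Lemma th3_sqr_sub t : 0 < t ->
  th3 t ^ 2 - th3 (5 * t) ^ 2
    = 4 * exp (- t) * (Eu (2 * t) ^ 2 * Eu (5 * t) * Eu (20 * t) / (Eu t * Eu (4 * t))).
Proof.
  intros Ht. pose proof (has_sum_th3 t Ht) as H3.
  pose proof (has_sum_th3 (5 * t) ltac:(lra)) as K3.
  destruct (theta_pair_odd t Ht) as [S1 [S2 [K1 [K2 <-]]]].
  pose (F := fun p : Z * Z => let (x, y) := p in exp (- (t * (IZR x ^ 2 + IZR y ^ 2)))).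
  assert (A : has_sum F (1 * (th3 t * th3 t))).
  { eapply has_sum_pair_eq; [|exact H3|exact H3]. intros m n. unfold F.
    rewrite Rmult_1_l, <- exp_plus. f_equal; ring. }
  assert (B : has_sum F (1 * (th3 (5 * t) * th3 (5 * t)) + 4 * (exp (- t) * (S1 * S2)))).
  { apply has_sum_gaussian5.
    - intros p q. unfold F. f_equal. rewrite opp_IZR. ring.
    - eapply has_sum_pair_eq; [|exact K3|exact K3]. intros m n. unfold F.
      rewrite Rmult_1_l, <- exp_plus, plus_IZR, minus_IZR, !mult_IZR. f_equal; ring.
    - eapply has_sum_pair_eq; [|exact K1|exact K2]. intros m n. unfold F.
      rewrite <- !exp_plus, !plus_IZR, minus_IZR, !mult_IZR. f_equal; ring. }
  pose proof (has_sum_unique _ _ _ A B). lra.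
Qed.

(** The same argument for the Gaussian integers with odd real and imaginary parts. *)
Lemma th2_sqr_sub t : 0 < t ->
  th2 t ^ 2 - th2 (5 * t) ^ 2
    = 4 * exp (- (t / 2)) * (Eu (10 * t) ^ 3 * Eu (4 * t) / (Eu (20 * t) * Eu (2 * t))).
Proof.
  intros Ht. pose proof (has_sum_th2 t Ht) as H2.
  pose proof (has_sum_th2 (5 * t) ltac:(lra)) as K5.
  destruct (theta_pair_even t Ht) as [S1 [S2 [K1 [K2 <-]]]].
  pose (r := fun p : Z * Z => let (x, y) := p in ((x mod 2 =? 1) && (y mod 2 =? 1))%Z%bool).
  pose (E := fun p : Z * Z => let (x, y) := p in exp (- (t / 4 * (IZR x ^ 2 + IZR y ^ 2)))).
  pose (F := fun p : Z * Z => if r p then E p else 0).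
  assert (Odd : forall (G : Z * Z -> R) s,
    has_sum (fun p : Z * Z => let (m, n) := p in G (2 * m + 1, 2 * n + 1)%Z) s ->
    has_sum (fun p => if r p then G p else 0) s).
  { intros G s H. apply (has_sum_injection (fun p : Z * Z => let (m, n) := p in (2 * m + 1, 2 * n + 1)%Z)
      (fun p : Z * Z => let (x, y) := p in (x / 2, y / 2)%Z)).
    - intros [m n]. f_equal; Z.div_mod_to_equations; lia.
    - intros [m n]. unfold r. apply andb_true_intro. split; apply Z.eqb_eq; Z.div_mod_to_equations; lia.
    - intros [x y] Hr. apply andb_prop in Hr. destruct Hr as [Hx Hy].
      apply Z.eqb_eq in Hx. apply Z.eqb_eq in Hy. f_equal; Z.div_mod_to_equations; lia.
    - eapply has_sum_eq; [|reflexivity|exact H]. intros [m n]; reflexivity. }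
  assert (A : has_sum F (1 * (th2 t * th2 t))).
  { apply Odd. eapply has_sum_pair_eq; [|exact H2|exact H2]. intros m n. unfold E.
    rewrite Rmult_1_l, <- exp_plus, !plus_IZR, !mult_IZR. f_equal; field. }
  assert (B : has_sum F (1 * (th2 (5 * t) * th2 (5 * t)) + 4 * (exp (- (t / 2)) * (S1 * S2)))).
  { apply has_sum_gaussian5.
    - intros p q. unfold F, r, E. rewrite opp_IZR.
      replace ((- IZR q) ^ 2 + IZR p ^ 2) with (IZR p ^ 2 + IZR q ^ 2) by ring.
      destruct (Z.eqb_spec (- q mod 2) 1), (Z.eqb_spec (p mod 2) 1), (Z.eqb_spec (q mod 2) 1);
        cbn [andb]; auto; exfalso; Z.div_mod_to_equations; lia.
    - eapply has_sum_eq; [|reflexivity|].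
      2:{ apply (Odd (fun p : Z * Z => let (s, d) := p in exp (- (5 * t / 4 * (IZR s ^ 2 + IZR d ^ 2))))).
          eapply has_sum_pair_eq; [|exact K5|exact K5]. intros m n.
          rewrite Rmult_1_l, <- exp_plus, !plus_IZR, !mult_IZR. f_equal; field. }
      intros [s d]. unfold F, r, E.
      destruct (Z.eqb_spec (s mod 2) 1), (Z.eqb_spec (d mod 2) 1),
        (Z.eqb_spec ((2 * s + d) mod 2) 1), (Z.eqb_spec ((2 * d - s) mod 2) 1); cbn [andb]; auto;
        try (exfalso; Z.div_mod_to_equations; lia).
      repeat rewrite ?plus_IZR, ?minus_IZR, ?mult_IZR. f_equal; field.
    - apply (has_sum_eq (fun p : Z * Z => if (let (m, n) := p in (m mod 2 =? 1) && (n mod 2 =? 0))%Z%bool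
         then (let (m, n) := p in E (2 * m + n + 1, 2 * n - m)%Z) else 0) _
         (exp (- (t / 2)) * (S1 * S2))); auto.
      { intros [m n]. unfold F, r.
        destruct (Z.eqb_spec (m mod 2) 1), (Z.eqb_spec (n mod 2) 0),
        (Z.eqb_spec ((2 * m + n + 1) mod 2) 1), (Z.eqb_spec ((2 * n - m) mod 2) 1); cbn [andb]; auto;
        exfalso; Z.div_mod_to_equations; lia. }
      apply (has_sum_injection (fun p : Z * Z => let (i, j) := p in (2 * i - 1, 2 * j)%Z)
        (fun p : Z * Z => let (x, y) := p in ((x + 1) / 2, y / 2)%Z)).
      + intros [m n]. f_equal; Z.div_mod_to_equations; lia.
      + intros [m n]. apply andb_true_intro. split; apply Z.eqb_eq; Z.div_mod_to_equations; lia.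
      + intros [x y] Hr. apply andb_prop in Hr. destruct Hr as [Hx Hy].
        apply Z.eqb_eq in Hx. apply Z.eqb_eq in Hy. f_equal; Z.div_mod_to_equations; lia.
      + eapply has_sum_pair_eq; [|exact K1|exact K2]. intros m n. unfold E.
        rewrite <- !exp_plus. repeat rewrite ?plus_IZR, ?minus_IZR, ?mult_IZR. f_equal; field. }
  pose proof (has_sum_unique _ _ _ A B). lra.
Qed.

(** * The logarithmic derivative of the Rogers-Ramanujan quotient *)

Lemma rr_derive (b t : R) (S : R -> R) : 0 < t ->
  (forall j : Z, 0 <= 5 * IZR j ^ 2 + b * IZR j) ->
  (forall u, 0 < u -> has_sum (fun j => sgz j * exp (- ((5 * IZR j ^ 2 + b * IZR j) / 2 * u))) (S u)) ->
  exists D, is_derive S t D /\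
    has_sum (fun j => sgz j * (5 * IZR j ^ 2 + b * IZR j)
      * exp (- (5 * t / 2 * IZR j ^ 2 + b * t / 2 * IZR j + 0))) (- 2 * D).
Proof.
  intros Ht He HS.
  assert (Hw : forall (k : nat) (a c : R), 0 < a -> exists s,
    has_sum (fun j => (sgz j * IZR j ^ k) * exp (- (a * IZR j ^ 2 + c * IZR j + 0))) s).
  { intros k a c Ha. apply (has_sum_gauss_weighted _ k); auto. intros n.
    rewrite Rabs_mult, Rabs_sgz, RPow_abs. lra. }
  destruct (Hw 2%nat (5 * t / 2) (b * t / 2)) as [s2 H2]; [lra|].
  destruct (Hw 1%nat (5 * t / 2) (b * t / 2)) as [s1 H1]; [lra|].
  exists (- / 2 * (5 * s2 + b * s1)). split.
  - apply (has_sum_derive sgz (fun j => (5 * IZR j ^ 2 + b * IZR j) / 2)); auto.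
    + intros i. specialize (He i). lra.
    + refine (has_sum_eq _ _ _ _ _ eq_refl (has_sum_scal (- / 2) _ _ (has_sum_plus _ _ _ _
        (has_sum_scal 5 _ _ H2) (has_sum_scal b _ _ H1)))).
      intros j. simpl.
      replace (- ((5 * (IZR j * (IZR j * 1)) + b * IZR j) / 2 * t))
        with (- (5 * t / 2 * (IZR j * (IZR j * 1)) + b * t / 2 * IZR j + 0)) by field. field.
    + assert (Hp : forall (k : nat) (a c : R), 0 < a -> exists s,
        has_sum (fun j => IZR j ^ k * exp (- (a * IZR j ^ 2 + c * IZR j + 0))) s).
      { intros k a c Ha. apply (has_sum_gauss_weighted _ k); auto. intros n.
        rewrite RPow_abs. lra. }
      destruct (Hp 4%nat (5 * t / 4) (b * t / 4)) as [t4 T4]; [lra|].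
      destruct (Hp 3%nat (5 * t / 4) (b * t / 4)) as [t3 T3]; [lra|].
      destruct (Hp 2%nat (5 * t / 4) (b * t / 4)) as [t2 T2]; [lra|].
      exists (25 / 4 * t4 + 5 * b / 2 * t3 + b ^ 2 / 4 * t2).
      refine (has_sum_eq _ _ _ _ _ eq_refl (has_sum_plus _ _ _ _ (has_sum_plus _ _ _ _
        (has_sum_scal (25 / 4) _ _ T4) (has_sum_scal (5 * b / 2) _ _ T3)) (has_sum_scal (b ^ 2 / 4) _ _ T2))).
      intros j. rewrite Rabs_sgz.
      replace (- ((5 * IZR j ^ 2 + b * IZR j) / 2 * (t / 2)))
        with (- (5 * t / 4 * IZR j ^ 2 + b * t / 4 * IZR j + 0)) by field. field.
  - replace (-2 * (- / 2 * (5 * s2 + b * s1))) with (5 * s2 + b * s1) by field.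
    refine (has_sum_eq _ _ _ _ _ eq_refl (has_sum_plus _ _ _ _
        (has_sum_scal 5 _ _ H2) (has_sum_scal b _ _ H1))).
    intros j. simpl. ring.
Qed.

Lemma sgz_opp n : sgz (- n) = sgz n.
Proof. unfold sgz. rewrite Z.even_opp. reflexivity. Qed.

Lemma sgz_sqr n : sgz n * sgz n = 1.
Proof. unfold sgz. destruct (Z.even n); ring. Qed.

(** Signed sums over all triangular numbers cancel in pairs [j, -1-j]. *)
Lemma triangular_cancel t : 0 < t ->
  has_sum (fun j => sgz j * exp (- (t * (IZR j ^ 2 + IZR j) / 2))) 0.
Proof.
  intros Ht. set (f := fun j => sgz j * exp (- (t * (IZR j ^ 2 + IZR j) / 2))).
  destruct (has_sum_gauss_weighted sgz 0 (t / 2) (t / 2) 0) as [s Hs]; [lra| |].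
  { intros n. rewrite Rabs_sgz. simpl; lra. }
  assert (H : has_sum f s).
  { eapply has_sum_eq; [|reflexivity|exact Hs]. intros j. unfold f. simpl. do 2 f_equal. field. }
  assert (H' : has_sum f (-1 * s)).
  { apply (has_sum_reindex' (fun j => -1 - j)%Z (fun j => -1 - j)%Z f (fun j => -1 * f j)).
    - intros; lia.
    - intros; lia.
    - intros j. unfold f. replace (-1 - j)%Z with (- (j + 1))%Z by lia.
      rewrite sgz_opp, sgz_succ, opp_IZR, plus_IZR.
      replace ((- (IZR j + 1)) ^ 2 + - (IZR j + 1)) with (IZR j ^ 2 + IZR j) by ring. ring.
    - apply has_sum_scal; auto. }
  pose proof (has_sum_unique _ _ _ H H').
  replace 0 with s by lra. exact H.
Qed.

(** The double series of [A B / 5 - (A' B - A B')] runs over one class of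
    Gaussian integers modulo [2 - i]. The sum over all classes is twice a square by
    Jacobi's identity for the cube of the Euler product, and the class zero
    contributes nothing by antisymmetry; what is left is four times the class
    wanted. *)
Lemma rr_wronskian t : 0 < t -> exists DA DB,
  is_derive rrA t DA /\ is_derive rrB t DB /\
  DA * rrB t - rrA t * DB = (rrA t * rrB t - Eu t ^ 6) / 5.
Proof.
  intros Ht.
  destruct (rr_derive (-3) t rrA Ht) as [DA [HDA SA]].
  { intros j. replace (5 * IZR j ^ 2 + -3 * IZR j) with (IZR (5 * j * j + -3 * j))
      by (rewrite plus_IZR, !mult_IZR; ring).
    apply IZR_le. nia. }
  { intros u Hu. eapply has_sum_eq; [|reflexivity|apply has_sum_rrA; auto].
    intros j. simpl. do 2 f_equal. field. }
  destruct (rr_derive 1 t rrB Ht) as [DB [HDB SB]].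
  { intros j. replace (5 * IZR j ^ 2 + 1 * IZR j) with (IZR (5 * j * j + 1 * j))
      by (rewrite plus_IZR, !mult_IZR; ring).
    apply IZR_le. nia. }
  { intros u Hu. eapply has_sum_eq; [|reflexivity|apply has_sum_rrB; auto].
    intros j. simpl. do 2 f_equal. field. }
  exists DA, DB. split; auto. split; auto.
  pose proof (has_sum_rrA t Ht) as HA. pose proof (has_sum_rrB t Ht) as HB.
  set (A := rrA t) in *. set (B := rrB t) in *.
  pose (E := fun p q : Z => exp (- (t / 4 * (IZR p ^ 2 + IZR q ^ 2 - 1)))).
  pose (H := fun p q : Z => - sgz p * ((2 * IZR p - IZR q) * (IZR p + 2 * IZR q)) * E p q).
  pose (r := fun p : Z * Z => let (x, y) := p in ((x + y) mod 2 =? 1)%Z).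
  pose (G := fun z : Z * Z => if r z then (let (p, q) := z in H p q) else 0).
  (* Over all classes: for [p = m + n + 1] and [q = m - n] the weight becomes a
     polynomial in [2 m + 1] and [2 n + 1], and all but the mixed term is multiplied
     by a vanishing sum over triangular numbers. *)
  assert (T : has_sum G (8 * Eu t ^ 6)).
  { apply (has_sum_injection (fun p : Z * Z => let (m, n) := p in (m + n + 1, m - n)%Z)
      (fun p : Z * Z => let (x, y) := p in ((x + y - 1) / 2, (x - y - 1) / 2)%Z)).
    - intros [m n]. f_equal; Z.div_mod_to_equations; lia.
    - intros [m n]. apply Z.eqb_eq. Z.div_mod_to_equations; lia.
    - intros [x y] Hr. apply Z.eqb_eq in Hr. f_equal; Z.div_mod_to_equations; lia.
    - set (e := fun j => exp (- (t * (IZR j ^ 2 + IZR j) / 2))).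
      pose proof (triangular_cancel t Ht) as T0. pose proof (jacobi_cube t Ht) as T1.
      assert (P : has_sum (fun j => (2 * IZR j + 1) * (sgz j * e j)) (2 * Eu t ^ 3 + 0)).
      { refine (has_sum_eq _ _ _ _ _ eq_refl (has_sum_plus _ _ _ _ (has_sum_scal 2 _ _ T1) T0)).
        intros j. unfold e. ring. }
      destruct (has_sum_gauss_weighted (fun j => sgz j * IZR j ^ 2) 2 (t / 2) (t / 2) 0) as [s2 T2]; [lra| |].
      { intros n. rewrite Rabs_mult, Rabs_sgz, RPow_abs. lra. }
      assert (P2 : has_sum (fun j => (2 * IZR j + 1) ^ 2 * (sgz j * e j)) (4 * s2 + 4 * Eu t ^ 3 + 0)).
      { refine (has_sum_eq _ _ _ _ _ eq_refl (has_sum_plus _ _ _ _ (has_sum_plus _ _ _ _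
          (has_sum_scal 4 _ _ T2) (has_sum_scal 4 _ _ T1)) T0)).
        intros j. unfold e.
        replace (- (t / 2 * IZR j ^ 2 + t / 2 * IZR j + 0)) with (- (t * (IZR j ^ 2 + IZR j) / 2)) by field.
        ring. }
      pose proof (has_sum_product _ _ _ _ P P) as Q1.
      pose proof (has_sum_product _ _ _ _ P2 T0) as Q2.
      pose proof (has_sum_product _ _ _ _ T0 P2) as Q3.
      refine (has_sum_eq _ _ _ _ _ _ (has_sum_plus _ _ _ _ (has_sum_scal 2 _ _ Q1) (has_sum_minus _ _ _ _
         (has_sum_scal (3 / 4) _ _ Q2) (has_sum_scal (3 / 4) _ _ Q3)))).
      2: ring.
      intros [m n]. unfold H, E. cbn [fst snd].
      rewrite sgz_succ, sgz_add, !plus_IZR, minus_IZR. fold (e m) (e n).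
      replace (exp (- (t / 4 * ((IZR m + IZR n + 1) ^ 2 + (IZR m - IZR n) ^ 2 - 1)))) with (e m * e n).
      2:{ unfold e. rewrite <- exp_plus. f_equal. field. }
      field. }
  (* Class zero: for [p + i q = (2 - i)(s + i d)] the summand is odd in [s]. *)
  assert (Z0 : has_sum (fun z : Z * Z => let (s, d) := z in G (2 * s + d, 2 * d - s)%Z) 0).
  { set (f := fun z : Z * Z => let (s, d) := z in G (2 * s + d, 2 * d - s)%Z).
    destruct (has_sum_gauss 1 (5 * t / 4) 0 0) as [c Hc]; [lra|].
    pose proof (has_sum_scal (25 * exp (t / 4)) _ _ (has_sum_product _ _ _ _ Hc Hc)) as Hd.
    assert (Ef : forall s d, f (s, d) = if r (s, d) then
       - sgz d * (25 * IZR s * IZR d) * exp (- (t / 4 * (5 * IZR s ^ 2 + 5 * IZR d ^ 2 - 1))) else 0).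
    { intros s d. unfold f, G, H, E, r.
      destruct (Z.eqb_spec ((2 * s + d + (2 * d - s)) mod 2) 1), (Z.eqb_spec ((s + d) mod 2) 1);
       try (exfalso; Z.div_mod_to_equations; lia); auto.
      rewrite sgz_add. replace (2 * s)%Z with (s + s)%Z by lia. rewrite sgz_add, sgz_sqr.
      rewrite !plus_IZR, minus_IZR, !mult_IZR.
      replace ((IZR s + IZR s + IZR d) ^ 2 + (2 * IZR d - IZR s) ^ 2 - 1)
        with (5 * IZR s ^ 2 + 5 * IZR d ^ 2 - 1) by ring. ring. }
    edestruct (fun h => has_sum_dominated f _ _ h Hd) as [s Hs].
    { intros [s d]. rewrite Ef. cbn [fst snd].
      destruct (r (s, d)).
      - rewrite !Rabs_mult, Rabs_Ropp, Rabs_sgz, !(Rabs_pos_eq (exp _)) by (left; apply exp_pos).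
        rewrite (Rabs_pos_eq 25) by lra. right.
        replace (- (t / 4 * (5 * IZR s ^ 2 + 5 * IZR d ^ 2 - 1))) with
          (t / 4 + - (5 * t / 4 * IZR s ^ 2 + 0 * IZR s + 0) + - (5 * t / 4 * IZR d ^ 2 + 0 * IZR d + 0)) by field.
        rewrite !exp_plus. ring.
      - rewrite Rabs_R0. apply Rmult_le_pos. pose proof (exp_pos (t / 4)); lra.
        apply Rmult_le_pos; (apply Rmult_le_pos; [apply pow_le, Rabs_pos | left; apply exp_pos]). }
    assert (Hs' : has_sum f (-1 * s)).
    { apply (has_sum_reindex' (fun z : Z * Z => let (s, d) := z in (- s, d)%Z)
        (fun z : Z * Z => let (s, d) := z in (- s, d)%Z) f (fun z => -1 * f z)).
      - intros [a b]. f_equal; lia.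
      - intros [a b]. f_equal; lia.
      - intros [a b]. rewrite !Ef. unfold r. rewrite opp_IZR.
        replace ((- IZR a) ^ 2) with (IZR a ^ 2) by ring.
        destruct (Z.eqb_spec ((- a + b) mod 2) 1), (Z.eqb_spec ((a + b) mod 2) 1);
        try (exfalso; Z.div_mod_to_equations; lia); ring.
      - apply has_sum_scal; auto. }
    pose proof (has_sum_unique _ _ _ Hs Hs'). replace 0 with s by lra. exact Hs. }
  (* Class one: with [X = 10 i - 3] and [Y = 10 j + 1] the weight is [(X^2 - Y^2) / 4],
     and [X^2 / 40], [Y^2 / 40] are the exponents in the two series up to constants. *)
  assert (Z1 : has_sum (fun z : Z * Z => let (m, n) := z in G (2 * m + n + 1, 2 * n - m)%Z)
     (2 * A * B - 10 * (DA * B - A * DB))).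
  { apply (has_sum_eq (fun p : Z * Z => if (let (m, n) := p in ((m + n) mod 2 =? 0))%Z
         then (let (m, n) := p in H (2 * m + n + 1) (2 * n - m))%Z else 0) _
         (2 * A * B - 10 * (DA * B - A * DB))); auto.
    { intros [m n]. unfold G, r.
      destruct (Z.eqb_spec ((m + n) mod 2) 0), (Z.eqb_spec ((2 * m + n + 1 + (2 * n - m)) mod 2) 1); auto;
      exfalso; Z.div_mod_to_equations; lia. }
    apply (has_sum_injection (fun p : Z * Z => let (i, j) := p in (j - i, - (i + j))%Z)
      (fun p : Z * Z => let (m, n) := p in (- ((m + n) / 2), (m - n) / 2)%Z)).
    - intros [m n]. f_equal; Z.div_mod_to_equations; lia.
    - intros [m n]. apply Z.eqb_eq. Z.div_mod_to_equations; lia.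
    - intros [x y] Hr. apply Z.eqb_eq in Hr. f_equal; Z.div_mod_to_equations; lia.
    - assert (QA : has_sum (fun j => (10 * IZR j - 3) ^ 2
        * (sgz j * exp (- (5 * t / 2 * IZR j ^ 2 + - (3 * t / 2) * IZR j)))) (- 40 * DA + 9 * A)).
      { refine (has_sum_eq _ _ _ _ _ _ (has_sum_plus _ _ _ _ (has_sum_scal 20 _ _ SA) (has_sum_scal 9 _ _ HA))).
        2: ring. intros j. simpl.
        replace (- (5 * t / 2 * (IZR j * (IZR j * 1)) + -3 * t / 2 * IZR j + 0)) with
         (- (5 * t / 2 * (IZR j * (IZR j * 1)) + - (3 * t / 2) * IZR j)) by field. ring. }
      assert (QB : has_sum (fun j => (10 * IZR j + 1) ^ 2
        * (sgz j * exp (- (5 * t / 2 * IZR j ^ 2 + t / 2 * IZR j)))) (- 40 * DB + B)).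
      { refine (has_sum_eq _ _ _ _ _ _ (has_sum_plus _ _ _ _ (has_sum_scal 20 _ _ SB) HB)).
        2: ring. intros j. simpl.
        replace (- (5 * t / 2 * (IZR j * (IZR j * 1)) + 1 * t / 2 * IZR j + 0)) with
         (- (5 * t / 2 * (IZR j * (IZR j * 1)) + t / 2 * IZR j)) by field. ring. }
      refine (has_sum_eq _ _ _ _ _ _ (has_sum_scal (/ 4) _ _ (has_sum_minus _ _ _ _
         (has_sum_product _ _ _ _ QA HB) (has_sum_product _ _ _ _ HA QB)))).
      2: field.
      intros [i j]. unfold H, E. cbn [fst snd].
      replace (2 * (j - i))%Z with ((j - i) + (j - i))%Z by lia.
      rewrite sgz_succ, !sgz_add, sgz_sqr, sgz_opp, sgz_add.
      repeat rewrite ?plus_IZR, ?minus_IZR, ?mult_IZR, ?opp_IZR.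
      match goal with |- context [exp (- (t / 4 * ?x))] =>
        replace (exp (- (t / 4 * x))) with
        (exp (- (5 * t / 2 * IZR i ^ 2 + - (3 * t / 2) * IZR i))
          * exp (- (5 * t / 2 * IZR j ^ 2 + t / 2 * IZR j)))
          by (rewrite <- exp_plus; f_equal; field) end.
      field. }
  assert (S : has_sum G (0 + 4 * (2 * A * B - 10 * (DA * B - A * DB)))).
  { apply has_sum_gaussian5; auto.
    intros p q. unfold G, r, H, E. rewrite opp_IZR.
    replace ((- IZR q) ^ 2 + IZR p ^ 2) with (IZR p ^ 2 + IZR q ^ 2) by ring.
    destruct (Z.eqb_spec ((- q + p) mod 2) 1), (Z.eqb_spec ((p + q) mod 2) 1);
      try (exfalso; Z.div_mod_to_equations; lia); auto.
    assert (Es : sgz (- q) = - sgz p).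
    { replace (- q)%Z with (p + - (2 * ((p + q) / 2)) + - (1))%Z by (Z.div_mod_to_equations; lia).
      replace (2 * ((p + q) / 2))%Z with ((p + q) / 2 + (p + q) / 2)%Z by lia.
      rewrite !sgz_add, !sgz_opp, sgz_add, sgz_sqr. unfold sgz at 2. simpl. ring. }
    rewrite Es. ring. }
  pose proof (has_sum_unique _ _ _ T S). lra.
Qed.

(** * The continued fraction as a quotient of theta series *)

(** The q-binomial coefficient [n choose k], zero unless [0 <= k <= n]. *)
Definition qbin (t : R) (n : nat) (k : Z) : R :=
  qp t n * (iqp t k * iqp t (Z.of_nat n - k)).

Lemma qbin_pascal_l t n k : 0 < t ->
  qbin t (S n) k = qbin t n (k - 1) + exp (- (IZR k * t)) * qbin t n k.
Proof.
  intros Ht. unfold qbin.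
  pose proof (iqp_pred t k Ht) as A. pose proof (iqp_pred t (Z.of_nat n + 1 - k) Ht) as B.
  replace (Z.of_nat n + 1 - k - 1)%Z with (Z.of_nat n - k)%Z in B by lia.
  replace (Z.of_nat (S n) - k)%Z with (Z.of_nat n + 1 - k)%Z by lia.
  replace (Z.of_nat n - (k - 1))%Z with (Z.of_nat n + 1 - k)%Z by lia.
  rewrite A, B. cbn [qp]. rewrite S_INR, INR_IZR_INZ.
  replace (exp (- ((IZR (Z.of_nat n) + 1) * t)))
    with (exp (- (IZR k * t)) * exp (- (IZR (Z.of_nat n + 1 - k) * t))).
  2:{ rewrite <- exp_plus, minus_IZR, plus_IZR. f_equal. ring. }
  ring.
Qed.

Lemma qbin_pascal_r t n k : 0 < t ->
  qbin t (S n) k = qbin t n k + exp (- ((INR n + 1 - IZR k) * t)) * qbin t n (k - 1).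
Proof.
  intros Ht. unfold qbin.
  pose proof (iqp_pred t k Ht) as A. pose proof (iqp_pred t (Z.of_nat n + 1 - k) Ht) as B.
  replace (Z.of_nat n + 1 - k - 1)%Z with (Z.of_nat n - k)%Z in B by lia.
  replace (Z.of_nat (S n) - k)%Z with (Z.of_nat n + 1 - k)%Z by lia.
  replace (Z.of_nat n - (k - 1))%Z with (Z.of_nat n + 1 - k)%Z by lia.
  rewrite A, B, minus_IZR, plus_IZR, <- INR_IZR_INZ. cbn [qp]. rewrite S_INR.
  replace (exp (- ((INR n + 1) * t)))
    with (exp (- (IZR k * t)) * exp (- ((INR n + 1 - IZR k) * t))).
  2:{ rewrite <- exp_plus. f_equal. ring. }
  ring.
Qed.

Lemma qbin_bound t n k : 0 < t -> 0 <= qbin t n k <= / Eu t ^ 2.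
Proof.
  intros Ht. unfold qbin.
  pose proof (iqp_bound t k Ht) as A. pose proof (iqp_bound t (Z.of_nat n - k) Ht) as B.
  pose proof (qp_pos t n Ht). pose proof (qp_le_1 t n Ht). pose proof (Eu_pos t Ht).
  assert (0 <= iqp t k * iqp t (Z.of_nat n - k)) by nra. split.
  - apply Rmult_le_pos; lra.
  - apply Rle_trans with (1 * (/ Eu t * / Eu t)).
    + apply Rmult_le_compat; try lra. apply Rmult_le_compat; lra.
    + right. field. lra.
Qed.

(** Schur's polynomials. For [d = 0] and [d = 2] they are the numerators and the
    denominators of [rr_tail]; the exponent [(5 j^2 + (1 - 2 d) j) / 2] is dictated
    by the telescoping in [schur_rec]. *)
Definition schur_term (d : Z) (t : R) (n : nat) (j : Z) : R :=
  sgz j * exp (- (5 * t / 2 * IZR j ^ 2 + (1 - 2 * IZR d) * t / 2 * IZR j))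
    * qbin t n ((Z.of_nat n + d - 5 * j) / 2).

Definition schur (d : Z) (t : R) (n : nat) : R := zsum (schur_term d t n).

Lemma has_sum_gauss_bounded (w : Z -> R) (B a b : R) : 0 < a ->
  (forall j, Rabs (w j) <= B) ->
  exists s, has_sum (fun j => sgz j * exp (- (a * IZR j ^ 2 + b * IZR j)) * w j) s.
Proof.
  intros Ha Hw. destruct (has_sum_gauss 0 a b 0 Ha) as [s Hs].
  apply (has_sum_dominated _ _ (B * s)) with (2 := has_sum_scal B _ _ Hs).
  intros j. rewrite !Rabs_mult, Rabs_sgz, (Rabs_pos_eq (exp _)) by (left; apply exp_pos).
  rewrite Rplus_0_r. simpl. rewrite !Rmult_1_l, Rmult_comm.
  apply Rmult_le_compat_r; auto. left; apply exp_pos.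
Qed.

Lemma has_sum_schur d t n : 0 < t -> has_sum (schur_term d t n) (schur d t n).
Proof.
  intros Ht. apply zsum_spec. apply (has_sum_gauss_bounded _ (/ Eu t ^ 2)); [lra|].
  intros j. pose proof (qbin_bound t n ((Z.of_nat n + d - 5 * j) / 2) Ht).
  rewrite Rabs_pos_eq; lra.
Qed.

(** After two applications of Pascal's rule the defect of the recurrence is, for
    each [j], a difference [U j - U (j + 1)], where [U j] vanishes unless [j]
    has the parity of [n + d]. *)
Lemma schur_rec d t n : 0 < t ->
  schur d t (S (S n)) = schur d t (S n) + exp (- ((INR n + 1) * t)) * schur d t n.
Proof.
  intros Ht.
  pose (e := fun j => sgz j * exp (- (5 * t / 2 * IZR j ^ 2 + (1 - 2 * IZR d) * t / 2 * IZR j))).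
  pose (k := fun j => ((Z.of_nat n + 2 + d - 5 * j) / 2)%Z).
  pose (w := fun j => if ((Z.of_nat n + d - 5 * j) mod 2 =? 0)%Z
     then exp (- (IZR (k j) * t)) * qbin t n (k j) else 0).
  pose (U := fun j => e j * w j).
  assert (HU : exists u, has_sum U u).
  { apply (has_sum_gauss_bounded w (/ Eu t ^ 2)); [lra|].
    intros j. unfold w. pose proof (qbin_bound t n (k j) Ht) as Bd.
    destruct Z.eqb; [|rewrite Rabs_R0; lra].
    destruct (Z_lt_dec (k j) 0) as [N|N].
    - assert (qbin t n (k j) = 0) as ->.
      { unfold qbin, iqp at 1. destruct Z_lt_dec; [ring|lia]. }
      rewrite Rmult_0_r, Rabs_R0. lra.
    - pose proof (exp_pos (- (IZR (k j) * t))).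
      assert (exp (- (IZR (k j) * t)) <= 1).
      { rewrite <- exp_0. apply exp_le. assert (0 <= IZR (k j)) by (apply IZR_le; lia). nra. }
      rewrite Rabs_pos_eq by nra. nra. }
  destruct HU as [u Hu].
  assert (HD : has_sum (fun j => U j - U (j + 1)%Z) 0).
  { rewrite <- (Rminus_diag u). apply has_sum_minus; auto. apply has_sum_shift; auto. }
  pose proof (has_sum_schur d t (S (S n)) Ht) as H2.
  pose proof (has_sum_schur d t (S n) Ht) as H1. pose proof (has_sum_schur d t n Ht) as H0.
  pose proof (has_sum_minus _ _ _ _ (has_sum_minus _ _ _ _ H2 H1)
    (has_sum_scal (exp (- ((INR n + 1) * t))) _ _ H0)) as HE.
  enough (schur d t (S (S n)) - schur d t (S n) - exp (- ((INR n + 1) * t)) * schur d t n = 0) by lra.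
  refine (has_sum_unique _ _ _ HE _).
  refine (has_sum_eq _ _ _ _ _ eq_refl HD).
  intros j. unfold schur_term. fold (e j). unfold U, w.
  destruct (Z.eqb_spec ((Z.of_nat n + d - 5 * j) mod 2) 0) as [P|P],
    (Z.eqb_spec ((Z.of_nat n + d - 5 * (j + 1)) mod 2) 0) as [P'|P'];
    try (exfalso; Z.div_mod_to_equations; lia).
  - replace ((Z.of_nat (S (S n)) + d - 5 * j) / 2)%Z with (k j)
      by (unfold k; f_equal; lia).
    replace ((Z.of_nat (S n) + d - 5 * j) / 2)%Z with (k j - 1)%Z
      by (unfold k; Z.div_mod_to_equations; lia).
    replace ((Z.of_nat n + d - 5 * j) / 2)%Z with (k j - 1)%Z
      by (unfold k; Z.div_mod_to_equations; lia).
    rewrite (qbin_pascal_l t (S n)), (qbin_pascal_r t n (k j)) by auto.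
    replace (exp (- ((INR n + 1) * t)))
      with (exp (- (IZR (k j) * t)) * exp (- ((INR n + 1 - IZR (k j)) * t))).
    2:{ rewrite <- exp_plus. f_equal; ring. }
    ring.
  - set (l := k (j + 1)%Z).
    replace ((Z.of_nat (S (S n)) + d - 5 * j) / 2)%Z with (l + 2)%Z
      by (unfold l, k; Z.div_mod_to_equations; lia).
    replace ((Z.of_nat (S n) + d - 5 * j) / 2)%Z with (l + 2)%Z
      by (unfold l, k; Z.div_mod_to_equations; lia).
    replace ((Z.of_nat n + d - 5 * j) / 2)%Z with (l + 1)%Z
      by (unfold l, k; Z.div_mod_to_equations; lia).
    rewrite (qbin_pascal_r t (S n)) by auto.
    replace (l + 2 - 1)%Z with (l + 1)%Z by lia.
    rewrite (qbin_pascal_l t n (l + 1)) by auto.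
    replace (l + 1 - 1)%Z with l by lia.
    assert (El : (2 * l = Z.of_nat n + d - 5 * j - 3)%Z) by (unfold l, k; Z.div_mod_to_equations; lia).
    apply (f_equal IZR) in El.
    rewrite !minus_IZR, !plus_IZR, !mult_IZR, <- INR_IZR_INZ in El.
    assert (En : INR n = 2 * IZR l + 5 * IZR j + 3 - IZR d) by lra.
    assert (Ee : e (j + 1)%Z * exp (- (IZR l * t)) = - (e j * exp (- ((INR (S n) + 1 - IZR (l + 2)) * t)))).
    { unfold e. rewrite sgz_succ, !Rmult_assoc, <- !exp_plus, !Ropp_mult_distr_l_reverse.
      do 2 f_equal. f_equal. rewrite S_INR, En, !plus_IZR. field. }
    replace (0 * e j) with 0 by ring.
    replace (e j * 0 - e (j + 1)%Z * (exp (- (IZR l * t)) * qbin t n l))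
      with (- (e (j + 1)%Z * exp (- (IZR l * t))) * qbin t n l) by ring.
    rewrite Ee.
    replace (exp (- ((INR n + 1) * t)))
      with (exp (- ((INR (S n) + 1 - IZR (l + 2)) * t)) * exp (- (IZR (l + 1) * t))).
    2:{ rewrite <- exp_plus, S_INR, !plus_IZR. f_equal; ring. }
    ring.
Qed.

Lemma has_sum_singleton (f : Z -> R) : (forall j, j <> 0%Z -> f j = 0) -> has_sum f (f 0%Z).
Proof.
  intros H. replace (f 0%Z) with (lsum f [0%Z]) by (simpl; ring).
  apply has_sum_finite. constructor; [intros []|constructor].
  intros x Hx. apply H. intros ->. apply Hx; left; auto.
Qed.

Lemma qbin_out t n k : (k < 0 \/ Z.of_nat n < k)%Z -> qbin t n k = 0.
Proof. intros H. unfold qbin, iqp. destruct Z_lt_dec, Z_lt_dec; try ring. lia. Qed.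

Lemma schur_single d t n : 0 < t ->
  (forall j, j <> 0%Z -> let k := ((Z.of_nat n + d - 5 * j) / 2)%Z in k < 0 \/ Z.of_nat n < k)%Z ->
  schur d t n = schur_term d t n 0.
Proof.
  intros Ht H. apply (has_sum_unique _ _ _ (has_sum_schur d t n Ht)).
  apply has_sum_singleton. intros j Hj. unfold schur_term. rewrite qbin_out by auto. ring.
Qed.

Lemma schur_0_0 t : 0 < t -> schur 0 t 0 = 1.
Proof.
  intros Ht. rewrite schur_single by (auto; intros j Hj k; unfold k; Z.div_mod_to_equations; lia).
  unfold schur_term, qbin, sgz. simpl. change (0 / 2)%Z with 0%Z. unfold iqp. simpl.
  replace (- _) with 0 by field. rewrite exp_0. field.
Qed.

Lemma schur_0_1 t : 0 < t -> schur 0 t 1 = 1.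
Proof.
  intros Ht. rewrite schur_single by (auto; intros j Hj k; unfold k; Z.div_mod_to_equations; lia).
  unfold schur_term, qbin, sgz. simpl. change (1 / 2)%Z with 0%Z. unfold iqp. simpl.
  pose proof (exp_lt_1 (1 * t) ltac:(lra)).
  replace (- (5 * t / 2 * (0 * (0 * 1)) + (1 - 2 * 0) * t / 2 * 0)) with 0 by field.
  rewrite exp_0. field. lra.
Qed.

Lemma schur_2_0 t : 0 < t -> schur 2 t 0 = 0.
Proof.
  intros Ht. rewrite schur_single by (auto; intros j Hj k; unfold k; Z.div_mod_to_equations; lia).
  unfold schur_term. rewrite qbin_out by (simpl; Z.div_mod_to_equations; lia). ring.
Qed.

Lemma schur_2_1 t : 0 < t -> schur 2 t 1 = 1.
Proof.
  intros Ht. rewrite schur_single by (auto; intros j Hj k; unfold k; Z.div_mod_to_equations; lia).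
  unfold schur_term, qbin, sgz. simpl. change (3 / 2)%Z with 1%Z. unfold iqp. simpl.
  pose proof (exp_lt_1 (1 * t) ltac:(lra)).
  replace (- (5 * t / 2 * (0 * (0 * 1)) + (1 - 2 * 2) * t / 2 * 0)) with 0 by field.
  rewrite exp_0. unfold Pos.to_nat; simpl. field. lra.
Qed.

Lemma schur_lim d t S : 0 < t ->
  has_sum (fun j => sgz j * exp (- (5 * t / 2 * IZR j ^ 2 + (1 - 2 * IZR d) * t / 2 * IZR j))) S ->
  is_lim_seq (schur d t) (S / Eu t).
Proof.
  intros Ht HS. pose proof (Eu_pos t Ht) as E.
  destruct (has_sum_gauss 0 (5 * t / 2) ((1 - 2 * IZR d) * t / 2) 0) as [G HG]; [lra|].
  apply (has_sum_tannery (schur_term d t)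
    (fun j => / Eu t * (sgz j * exp (- (5 * t / 2 * IZR j ^ 2 + (1 - 2 * IZR d) * t / 2 * IZR j))))
    _ _ _ (/ Eu t ^ 2 * G)) with (2 := has_sum_scal (/ Eu t ^ 2) _ _ HG).
  - intros n j. unfold schur_term.
    rewrite !Rabs_mult, Rabs_sgz, (Rabs_pos_eq (exp _)) by (left; apply exp_pos).
    rewrite Rplus_0_r. simpl. rewrite !Rmult_1_l, Rmult_comm.
    apply Rmult_le_compat_r. left; apply exp_pos.
    pose proof (qbin_bound t n ((Z.of_nat n + d - 5 * j) / 2) Ht).
    simpl in H. rewrite Rabs_pos_eq; lra.
  - intros j. unfold schur_term. rewrite (Rmult_comm (/ Eu t)).
    apply is_lim_seq_mult'; [apply is_lim_seq_const|].
    replace (/ Eu t) with (Eu t * (/ Eu t * / Eu t)) by (field; lra).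
    apply is_lim_seq_mult'; [apply qp_lim; auto|]. apply is_lim_seq_mult'; apply iqp_lim; auto.
    + intros m. exists (Z.to_nat (2 * Z.of_nat m + Z.abs d + 5 * Z.abs j + 2)).
      intros n Hn. Z.div_mod_to_equations; lia.
    + intros m. exists (Z.to_nat (2 * Z.of_nat m + Z.abs d + 5 * Z.abs j + 2)).
      intros n Hn. Z.div_mod_to_equations; lia.
  - intros n. apply has_sum_schur; auto.
  - apply (has_sum_eq _ _ _ (S / Eu t) (fun j => eq_refl) (Rmult_comm _ _)).
    apply has_sum_scal; auto.
Qed.

(** Continuants of the continued fraction, expanded from the front as in
    [rr_tail]; [continuant_back] is the expansion from the end. *)
Fixpoint continuant (q : R) (j n : nat) : R :=
  match n with
  | O => 1
  | S m => match m with
           | O => 1 + q ^ j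
           | S p => continuant q (S j) m + q ^ j * continuant q (S (S j)) p
           end
  end.

Lemma continuant_SS q j n :
  continuant q j (S (S n)) = continuant q (S j) (S n) + q ^ j * continuant q (S (S j)) n.
Proof. reflexivity. Qed.

Lemma continuant_back q j n :
  continuant q j (S (S n)) = continuant q j (S n) + q ^ (j + S n) * continuant q j n.
Proof.
  enough (H : forall m j,
    continuant q j (S (S m)) = continuant q j (S m) + q ^ (j + S m) * continuant q j m /\
    continuant q j (S (S (S m))) = continuant q j (S (S m)) + q ^ (j + S (S m)) * continuant q j (S m))
    by (apply H).
  clear. induction m as [|m IH]; intros j.
  - simpl. rewrite !Nat.add_succ_r, Nat.add_0_r. simpl. split; ring.
  - split; [apply IH|].
    rewrite continuant_SS. destruct (IH (S j)) as [_ ->]. destruct (IH (S (S j))) as [-> _].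
    rewrite (continuant_SS q j (S m)), (continuant_SS q j m).
    replace (S (S j) + S m)%nat with (j + S (S (S m)))%nat by lia.
    replace (S j + S (S m))%nat with (j + S (S (S m)))%nat by lia. ring.
Qed.

Lemma continuant_pos q j n : 0 < q -> 0 < continuant q j n.
Proof.
  intros Hq. enough (H : forall m j, 0 < continuant q j m /\ 0 < continuant q j (S m)) by apply H.
  clear j n. induction m as [|m IH]; intros j.
  - simpl. pose proof (pow_lt q j Hq). lra.
  - split; [apply IH|]. rewrite continuant_SS.
    pose proof (pow_lt q j Hq). destruct (IH (S j)) as [_ A]. destruct (IH (S (S j))) as [B _].
    assert (0 < q ^ j * continuant q (S (S j)) m) by (apply Rmult_lt_0_compat; auto). lra.
Qed.

Lemma rr_tail_continuant q j n : 0 < q ->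
  rr_tail q j (S n) = continuant q j (S n) / continuant q (S j) n.
Proof.
  intros Hq. revert j. induction n as [|n IH]; intros j.
  - simpl. field.
  - change (rr_tail q j (S (S n))) with (1 + q ^ j / rr_tail q (S j) (S n)).
    rewrite IH, continuant_SS.
    pose proof (continuant_pos q (S j) (S n) Hq). pose proof (continuant_pos q (S (S j)) n Hq).
    field. lra.
Qed.

Lemma exp_pow (x : R) n : exp x ^ n = exp (INR n * x).
Proof.
  induction n. simpl. rewrite Rmult_0_l, exp_0; auto.
  rewrite S_INR. simpl. rewrite IHn, <- exp_plus. f_equal; ring.
Qed.

Lemma continuant_schur t n : 0 < t ->
  continuant (exp (- t)) 1 n = schur 0 t (S n) /\ continuant (exp (- t)) 2 n = schur 2 t (S (S n)).
Proof.
  intros Ht. set (q := exp (- t)).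
  assert (P : forall m, exp (- ((INR m + 1) * t)) = q ^ S m).
  { intros m. unfold q. rewrite exp_pow, S_INR. f_equal; ring. }
  assert (R0 : forall m, schur 0 t (S (S m)) = schur 0 t (S m) + q ^ S m * schur 0 t m).
  { intros m. rewrite schur_rec, P; auto. }
  assert (R2 : forall m, schur 2 t (S (S m)) = schur 2 t (S m) + q ^ S m * schur 2 t m).
  { intros m. rewrite schur_rec, P; auto. }
  enough (H : forall m,
    (continuant q 1 m = schur 0 t (S m) /\ continuant q 2 m = schur 2 t (S (S m))) /\
    (continuant q 1 (S m) = schur 0 t (S (S m)) /\ continuant q 2 (S m) = schur 2 t (S (S (S m)))))
    by (apply H).
  induction m as [|m IH].
  - rewrite (R2 1%nat), (R2 0%nat), (R0 0%nat), schur_0_0, schur_0_1, schur_2_0, schur_2_1 by auto.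
    simpl. repeat split; ring.
  - split; [apply IH|]. destruct IH as [[A B] [C D]].
    rewrite (continuant_back q 1 m), (continuant_back q 2 m), A, B, C, D, (R0 (S m)), (R2 (S (S m))).
    split; reflexivity.
Qed.

Lemma rogers_ramanujan_theta t : 0 < t ->
  rogers_ramanujan (exp (- t)) = exp (- (t / 5)) * (rrA t / rrB t).
Proof.
  intros Ht. pose proof (Eu_pos t Ht) as E1.
  assert (HAB : rrA t * rrB t <> 0).
  { rewrite rrA_rrB by auto. pose proof (Eu_pos (5 * t) ltac:(lra)). nra. }
  assert (HB : rrB t <> 0) by (intros E; rewrite E, Rmult_0_r in HAB; auto).
  assert (HA : rrA t <> 0) by (intros E; rewrite E, Rmult_0_l in HAB; auto).
  assert (L0 : is_lim_seq (schur 0 t) (rrB t / Eu t)).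
  { apply schur_lim; auto. eapply has_sum_eq; [|reflexivity|apply has_sum_rrB; auto].
    intros j; simpl. do 3 f_equal. field. }
  assert (L2 : is_lim_seq (schur 2 t) (rrA t / Eu t)).
  { apply schur_lim; auto. eapply has_sum_eq; [|reflexivity|apply has_sum_rrA; auto].
    intros j; simpl. do 3 f_equal. field. }
  unfold rogers_ramanujan.
  assert (EP : Rpower (exp (- t)) (1 / 5) = exp (- (t / 5))).
  { unfold Rpower. rewrite ln_exp. f_equal. field. }
  rewrite EP.
  enough (L : is_lim_seq (fun n => exp (- (t / 5)) / rr_tail (exp (- t)) 1 n)
    (exp (- (t / 5)) * (rrA t / rrB t))) by (rewrite (is_lim_seq_unique _ _ L); reflexivity).
  apply (is_lim_seq_incr_n _ 1).
  apply is_lim_seq_ext with (fun n => exp (- (t / 5)) * (schur 2 t (n + 2) / schur 0 t (n + 2))).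
  - intros n. rewrite Nat.add_1_r, (rr_tail_continuant _ 1 n) by apply exp_pos.
    pose proof (continuant_pos (exp (- t)) 1 (S n) (exp_pos _)).
    pose proof (continuant_pos (exp (- t)) 2 n (exp_pos _)).
    replace (n + 2)%nat with (S (S n)) by lia.
    rewrite <- (proj1 (continuant_schur t (S n) Ht)), <- (proj2 (continuant_schur t n Ht)).
    field. lra.
  - apply is_lim_seq_mult'; [apply is_lim_seq_const|].
    replace (rrA t / rrB t) with ((rrA t / Eu t) / (rrB t / Eu t)) by (field; lra).
    apply is_lim_seq_div_fin.
    apply (is_lim_seq_incr_n (schur 2 t) 2); auto. apply (is_lim_seq_incr_n (schur 0 t) 2); auto.
    unfold Rdiv. apply Rmult_integral_contrapositive_currified; auto.
    apply Rinv_neq_0_compat; lra.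
Qed.

(** With [F(t) = R(exp (-t))], the Wronskian and [A B = (q)(q^5)] turn
    [F'/F = -1/5 + (A' B - A B') / (A B)] into the Euler quotient. *)
Lemma rogers_ramanujan_derive t : 0 < t ->
  is_derive rogers_ramanujan (exp (- t))
    (rogers_ramanujan (exp (- t)) * (exp t / 5 * (Eu t ^ 5 / Eu (5 * t)))).
Proof.
  intros Ht. pose proof (Eu_pos t Ht) as E1. pose proof (Eu_pos (5 * t) ltac:(lra)) as E5.
  destruct (rr_wronskian t Ht) as [DA [DB [HDA [HDB W]]]].
  pose proof (rrA_rrB t Ht) as P.
  assert (HAB : rrA t * rrB t <> 0) by (rewrite P; nra).
  assert (HB : rrB t <> 0) by (intros E; rewrite E, Rmult_0_r in HAB; auto).
  assert (HA : rrA t <> 0) by (intros E; rewrite E, Rmult_0_l in HAB; auto).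
  set (F := fun u => exp (- (u / 5)) * (rrA u / rrB u)).
  assert (HF : is_derive F t (rogers_ramanujan (exp (- t)) * (- (Eu t ^ 5 / (5 * Eu (5 * t)))))).
  { rewrite rogers_ramanujan_theta by auto. unfold F.
    evar_last.
    - apply (is_derive_mult (fun u => exp (- (u / 5))) (fun u => rrA u / rrB u)).
      + auto_derive; [auto|reflexivity].
      + apply is_derive_div; [exact HDA|exact HDB|exact HB].
      + intros; apply Rmult_comm.
    - unfold plus, mult, minus, opp, scal; simpl.
      replace (DA * rrB t - rrA t * DB) with ((rrA t * rrB t - Eu t ^ 6) / 5) by lra.
      unfold Rdiv at 4. fold (t / 5). set (e := exp (- (t / 5))).
      replace (Eu (5 * t)) with (rrA t * rrB t / Eu t) by (rewrite P; field; lra).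
      field. repeat split; auto; lra. }
  apply (is_derive_ext_loc (fun q => F (- ln q))).
  - assert (L1 : exp (- t) < 1) by (apply exp_lt_1; auto). pose proof (exp_pos (- t)) as L0.
    apply (filter_imp (fun q => 0 < q /\ q < 1)).
    + intros q [Hq0 Hq1]. pose proof (ln_increasing q 1 Hq0 Hq1) as I. rewrite ln_1 in I.
      assert (0 < - ln q) by lra.
      rewrite <- (exp_ln q) at 2 by auto. rewrite <- (Ropp_involutive (ln q)).
      rewrite rogers_ramanujan_theta by auto. rewrite !Ropp_involutive. reflexivity.
    + apply filter_and; [apply (open_gt 0) | apply (open_lt 1)]; auto.
  - evar_last.
    + apply (is_derive_comp F (fun q => - ln q)).
      * replace (- ln (exp (- t))) with t by (rewrite ln_exp; ring). exact HF.
      * auto_derive; [apply exp_pos|reflexivity].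
    + unfold scal; simpl; unfold mult; simpl.
      rewrite exp_Ropp. pose proof (exp_pos t). field. lra.
Qed.

(** * The modular equation of degree 5 *)

Lemma th2_pos t : 0 < t -> 0 < th2 t.
Proof.
  intros Ht. pose proof (Eu_pos (2 * t) ltac:(lra)). pose proof (Eu_pos (4 * t) ltac:(lra)).
  pose proof (exp_pos (- (t / 4))). unfold th2. apply Rdiv_lt_0_compat; auto.
  apply Rmult_lt_0_compat. lra. apply pow_lt; auto.
Qed.

Lemma th3_pos t : 0 < t -> 0 < th3 t.
Proof.
  intros Ht. pose proof (Eu_pos (2 * t) ltac:(lra)). pose proof (Eu_pos (4 * t) ltac:(lra)).
  pose proof (Eu_pos t Ht). unfold th3. apply Rdiv_lt_0_compat. apply pow_lt; auto.
  apply Rmult_lt_0_compat; apply pow_lt; auto.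
Qed.

Lemma th4_pos t : 0 < t -> 0 < th4 t.
Proof.
  intros Ht. pose proof (Eu_pos (2 * t) ltac:(lra)).
  pose proof (Eu_pos t Ht). unfold th4. apply Rdiv_lt_0_compat; auto. apply pow_lt; auto.
Qed.

Lemma th2_th3 t : 0 < t -> 2 * (th2 (2 * t) * th3 (2 * t)) = th2 t ^ 2.
Proof.
  intros Ht. unfold th2, th3. replace (4 * (2 * t)) with (8 * t) by ring.
  replace (2 * (2 * t)) with (4 * t) by ring.
  pose proof (Eu_pos (2 * t) ltac:(lra)). pose proof (Eu_pos (4 * t) ltac:(lra)).
  pose proof (Eu_pos (8 * t) ltac:(lra)).
  replace (exp (- (2 * t / 4))) with (exp (- (t / 4)) * exp (- (t / 4)))
    by (rewrite <- exp_plus; f_equal; field).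
  field. lra.
Qed.

Lemma jacobi_quartic t : 0 < t -> th2 t ^ 4 + th4 t ^ 4 = th3 t ^ 4.
Proof.
  intros Ht. pose proof (th3_sqr t Ht). pose proof (th4_sqr t Ht). pose proof (th2_th3 t Ht).
  replace (th2 t ^ 4) with ((th2 t ^ 2) ^ 2) by ring.
  replace (th4 t ^ 4) with ((th4 t ^ 2) ^ 2) by ring.
  replace (th3 t ^ 4) with ((th3 t ^ 2) ^ 2) by ring.
  rewrite H, H0, <- H1. ring.
Qed.

(** As [2 th2 t * th3 t = th2 (t/2)^2], the last factor is once more a difference of
    squares of [th2], now at [t/2]; both sides are then Euler quotients. *)
Lemma th2_th3_product t : 0 < t ->
  (th2 t ^ 2 - th2 (5 * t) ^ 2) * (th3 t ^ 2 - th3 (5 * t) ^ 2)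
   = 4 * (th2 (5 * t) * th3 (5 * t)) * (th2 t * th3 t - th2 (5 * t) * th3 (5 * t)).
Proof.
  intros Ht. rewrite th2_sqr_sub, th3_sqr_sub by auto.
  pose proof (th2_th3 (t / 2) ltac:(lra)) as A. replace (2 * (t / 2)) with t in A by field.
  pose proof (th2_th3 (5 * t / 2) ltac:(lra)) as B.
  replace (2 * (5 * t / 2)) with (5 * t) in B by field.
  pose proof (th2_sqr_sub (t / 2) ltac:(lra)) as D.
  replace (5 * (t / 2)) with (5 * t / 2) in D by field.
  rewrite <- A, <- B in D.
  replace (th2 t * th3 t - th2 (5 * t) * th3 (5 * t)) with
    ((2 * (th2 t * th3 t) - 2 * (th2 (5 * t) * th3 (5 * t))) / 2) by field.
  rewrite D.
  replace (10 * (t / 2)) with (5 * t) by field. replace (4 * (t / 2)) with (2 * t) by field.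
  replace (20 * (t / 2)) with (10 * t) by field. replace (2 * (t / 2)) with t by field.
  unfold th2, th3. replace (2 * (5 * t)) with (10 * t) by ring.
  replace (4 * (5 * t)) with (20 * t) by ring.
  pose proof (Eu_pos t Ht). pose proof (Eu_pos (2 * t) ltac:(lra)).
  pose proof (Eu_pos (4 * t) ltac:(lra)). pose proof (Eu_pos (5 * t) ltac:(lra)).
  pose proof (Eu_pos (10 * t) ltac:(lra)). pose proof (Eu_pos (20 * t) ltac:(lra)).
  set (e := exp (- (t / 4))).
  replace (exp (- (t / 2 / 2))) with e by (unfold e; f_equal; field).
  replace (exp (- (t / 2))) with (e * e) by (unfold e; rewrite <- exp_plus; f_equal; field).
  replace (exp (- t)) with (e * e * e * e) by (unfold e; rewrite <- !exp_plus; f_equal; field).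
  replace (exp (- (5 * t / 4))) with (e * e * e * e * e)
    by (unfold e; rewrite <- !exp_plus; f_equal; field).
  field. repeat split; lra.
Qed.

Lemma th2_th3_ratio t : 0 < t ->
  (th2 t ^ 2 - th2 (5 * t) ^ 2) ^ 2 * (th2 (5 * t) * th3 t)
   = (th3 t ^ 2 - th3 (5 * t) ^ 2) ^ 2 * (th3 (5 * t) * th2 t).
Proof.
  intros Ht. rewrite th2_sqr_sub, th3_sqr_sub by auto.
  unfold th2, th3. replace (2 * (5 * t)) with (10 * t) by ring.
  replace (4 * (5 * t)) with (20 * t) by ring.
  pose proof (Eu_pos t Ht). pose proof (Eu_pos (2 * t) ltac:(lra)).
  pose proof (Eu_pos (4 * t) ltac:(lra)). pose proof (Eu_pos (5 * t) ltac:(lra)).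
  pose proof (Eu_pos (10 * t) ltac:(lra)). pose proof (Eu_pos (20 * t) ltac:(lra)).
  set (e := exp (- (t / 4))).
  replace (exp (- (t / 2))) with (e * e) by (unfold e; rewrite <- exp_plus; f_equal; field).
  replace (exp (- t)) with (e * e * e * e) by (unfold e; rewrite <- !exp_plus; f_equal; field).
  replace (exp (- (5 * t / 4))) with (e * e * e * e * e)
    by (unfold e; rewrite <- !exp_plus; f_equal; field).
  field. repeat split; lra.
Qed.

Lemma th3_decr t : 0 < t -> th3 (5 * t) < th3 t.
Proof.
  intros Ht. pose proof (th3_sqr_sub t Ht) as H. pose proof (th3_pos t Ht).
  pose proof (th3_pos (5 * t) ltac:(lra)).
  pose proof (Eu_pos (2 * t) ltac:(lra)). pose proof (Eu_pos (4 * t) ltac:(lra)).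
  pose proof (Eu_pos (5 * t) ltac:(lra)). pose proof (Eu_pos (20 * t) ltac:(lra)).
  pose proof (Eu_pos t Ht).
  assert (0 < 4 * exp (- t) * (Eu (2 * t) ^ 2 * Eu (5 * t) * Eu (20 * t) / (Eu t * Eu (4 * t)))).
  { apply Rmult_lt_0_compat. pose proof (exp_pos (- t)); lra.
    apply Rdiv_lt_0_compat; repeat apply Rmult_lt_0_compat; auto; try lra. }
  nra.
Qed.

Lemma pow4_inj x y : 0 <= x -> 0 <= y -> x ^ 4 = y ^ 4 -> x = y.
Proof.
  intros Hx Hy H. assert (E : (x ^ 2 - y ^ 2) * (x ^ 2 + y ^ 2) = 0) by (ring_simplify; lra).
  apply Rmult_integral in E. destruct E as [E|E].
  - assert ((x - y) * (x + y) = 0) as E' by (ring_simplify; lra).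
    apply Rmult_integral in E'. destruct E'; lra.
  - nra.
Qed.

(** With [u], [v], [g] the ratios of the three theta functions at [5t] and [t],
    and [p = u v], the two product identities give [(v-u)^2 = (1-p)(1-5p)], and
    Jacobi's quartic identities at [t] and [5t] give [g^2 = (1-p)/(1-5p)]. *)
Lemma theta_ratio_relation (a b c u v g : R) :
  0 < a -> 0 < b -> 0 < c -> 0 < u < 1 -> 0 < v < 1 -> 0 < g -> u < v ->
  a ^ 4 + c ^ 4 = b ^ 4 -> (u * a) ^ 4 + (g * c) ^ 4 = (v * b) ^ 4 ->
  (1 - u ^ 2) * (1 - v ^ 2) = 4 * (u * v) * (1 - u * v) ->
  a ^ 4 * (u * (1 - u ^ 2) ^ 2) = b ^ 4 * (v * (1 - v ^ 2) ^ 2) ->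
  v * (u + g) - u * g = 1.
Proof.
  intros Ha Hb Hc Hu Hv Hg Huv J1 J5 T Rt.
  set (X := u * (1 - u ^ 2) ^ 2) in *. set (Y := v * (1 - v ^ 2) ^ 2) in *.
  set (p := u * v) in *. set (d := v - u).
  assert (Hd : 0 < d) by (unfold d; lra). assert (Hp0 : 0 < p) by (unfold p; nra).
  assert (Hp1 : p < 1) by (unfold p; nra).
  assert (D2 : d ^ 2 = (1 - p) * (1 - 5 * p)).
  { unfold d. replace ((v - u) ^ 2) with ((1 + p ^ 2 - (1 - u ^ 2) * (1 - v ^ 2)) - 2 * p)
      by (unfold p; ring). rewrite T. ring. }
  (* Eliminating [c] by the quartic identities, then [a] by the last hypothesis. *)
  assert (G1 : g ^ 4 * (X - Y) = v ^ 4 * X - u ^ 4 * Y).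
  { apply Rmult_eq_reg_l with (b ^ 4); [|apply Rgt_not_eq, pow_lt; auto].
    assert (C : c ^ 4 * X = b ^ 4 * (X - Y)).
    { replace (c ^ 4) with (b ^ 4 - a ^ 4) by lra.
      replace ((b ^ 4 - a ^ 4) * X) with (b ^ 4 * X - a ^ 4 * X) by ring. rewrite Rt. ring. }
    replace (b ^ 4 * (g ^ 4 * (X - Y))) with (g ^ 4 * (b ^ 4 * (X - Y))) by ring.
    rewrite <- C.
    replace (g ^ 4 * (c ^ 4 * X)) with ((g * c) ^ 4 * X) by ring.
    replace ((g * c) ^ 4) with ((v * b) ^ 4 - (u * a) ^ 4) by lra.
    replace (((v * b) ^ 4 - (u * a) ^ 4) * X) with (v ^ 4 * (b ^ 4 * X) - u ^ 4 * (a ^ 4 * X)) by ring.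
    rewrite Rt. ring. }
  assert (S2 : u ^ 2 + v ^ 2 = 1 - 4 * p + 5 * p ^ 2).
  { unfold d in D2. replace (u ^ 2 + v ^ 2) with ((v - u) ^ 2 + 2 * p) by (unfold p; ring).
    rewrite D2. ring. }
  assert (E1 : X - Y = d * (p * (1 - p) * (1 - 5 * p) ^ 2)).
  { assert (I : X - Y = - d * (1 - 2 * ((u ^ 2 + v ^ 2) + p)
        + ((u ^ 2 + v ^ 2) ^ 2 + p * (u ^ 2 + v ^ 2) - p ^ 2))) by (unfold X, Y, d, p; ring).
    rewrite I, S2. ring. }
  assert (E2 : v ^ 4 * X - u ^ 4 * Y = p * (d * (1 - p) ^ 3)).
  { assert (I : v ^ 4 * X - u ^ 4 * Y = p * (d * ((u ^ 2 + v ^ 2) + p - 2 * p ^ 2 - p ^ 3)))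
      by (unfold X, Y, d, p; ring).
    rewrite I, S2. ring. }
  rewrite E1, E2 in G1.
  assert (G2 : g ^ 4 * (1 - 5 * p) ^ 2 = (1 - p) ^ 2).
  { apply Rmult_eq_reg_l with (d * (p * (1 - p))).
    2:{ apply Rgt_not_eq. repeat apply Rmult_lt_0_compat; lra. }
    replace (d * (p * (1 - p)) * (g ^ 4 * (1 - 5 * p) ^ 2))
      with (g ^ 4 * (d * (p * (1 - p) * (1 - 5 * p) ^ 2))) by ring.
    rewrite G1. ring. }
  assert (G3 : g * d = 1 - p).
  { apply pow4_inj; try nra.
    replace ((g * d) ^ 4) with (g ^ 4 * (d ^ 2) ^ 2) by ring. rewrite D2.
    replace (g ^ 4 * ((1 - p) * (1 - 5 * p)) ^ 2) with ((g ^ 4 * (1 - 5 * p) ^ 2) * (1 - p) ^ 2) by ring.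
    rewrite G2. ring. }
  unfold d, p in G3. lra.
Qed.

(** The modular equation of degree 5, as a condition on [p = (l/k)^(1/4)] where the
    nome of the modulus [l] is the fifth power of that of [k]. *)
Definition modular5 (k p : R) : R := 1 / p + 5 * p - 5 * p ^ 3 - p ^ 5 - 4 / k + 4 * k * p ^ 4.

Lemma modular5_of_ratios (k u v p : R) :
  0 < k -> 0 < u < 1 -> 0 < v < 1 -> 0 < p ->
  u = p ^ 2 * v ->
  (1 - u ^ 2) * (1 - v ^ 2) = 4 * (u * v) * (1 - u * v) ->
  k ^ 2 * (u * (1 - u ^ 2) ^ 2) = v * (1 - v ^ 2) ^ 2 ->
  modular5 k p = 0.
Proof.
  intros Hk Hu Hv Hp Eu T Rt.
  assert (Hu1 : 0 < 1 - u ^ 2) by nra. assert (Hv1 : 0 < 1 - v ^ 2) by nra.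
  assert (Ek : k = (1 - v ^ 2) / (p * (1 - u ^ 2))).
  { apply Rmult_eq_reg_r with (p * (1 - u ^ 2)); [|nra].
    replace ((1 - v ^ 2) / (p * (1 - u ^ 2)) * (p * (1 - u ^ 2))) with (1 - v ^ 2) by (field; lra).
    assert (Q : (k * (p * (1 - u ^ 2)) - (1 - v ^ 2)) * (k * (p * (1 - u ^ 2)) + (1 - v ^ 2)) = 0).
    { apply Rmult_eq_reg_l with v; [|lra].
      replace (v * ((k * (p * (1 - u ^ 2)) - (1 - v ^ 2)) * (k * (p * (1 - u ^ 2)) + (1 - v ^ 2))))
        with (k ^ 2 * ((p ^ 2 * v) * (1 - u ^ 2) ^ 2) - v * (1 - v ^ 2) ^ 2) by ring.
      rewrite <- Eu, Rt. ring. }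
    apply Rmult_integral in Q. destruct Q as [Q|Q]; [lra|].
    assert (0 < k * (p * (1 - u ^ 2))) by (repeat apply Rmult_lt_0_compat; lra). lra. }
  unfold modular5.
  apply Rmult_eq_reg_r with (p * ((1 - u ^ 2) * (1 - v ^ 2))).
  2:{ apply Rgt_not_eq. repeat apply Rmult_lt_0_compat; lra. }
  rewrite Rmult_0_l.
  transitivity ((1 + p ^ 2 - p ^ 4 - p ^ 6) * ((1 - u ^ 2) * (1 - v ^ 2) - 4 * (u * v) * (1 - u * v))).
  2:{ rewrite T. ring. }
  transitivity ((1 + 5 * p ^ 2 - 5 * p ^ 4 - p ^ 6) * ((1 - u ^ 2) * (1 - v ^ 2))
      - 4 * p ^ 2 * (1 - u ^ 2) ^ 2 + 4 * p ^ 4 * (1 - v ^ 2) ^ 2).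
  - rewrite Ek. field. lra.
  - rewrite Eu. ring.
Qed.

(** The function is strictly decreasing: its derivative is at most
    [- (1-p)^4 (5p^2+4p+1) / p^2]. *)
Lemma modular5_inj k p1 p2 : 0 < k < 1 -> 0 < p1 < 1 -> 0 < p2 < 1 ->
  modular5 k p1 = 0 -> modular5 k p2 = 0 -> p1 = p2.
Proof.
  intros Hk.
  assert (Inc : forall x y : R, 0 < x -> x < y -> y < 1 -> - modular5 k x < - modular5 k y).
  { intros x y Hx Hxy Hy.
    apply (incr_function (fun p => - modular5 k p) 0 1
      (fun p => 1 / p ^ 2 - 5 + 15 * p ^ 2 + 5 * p ^ 4 - 16 * k * p ^ 3)); auto.
    - intros z Hz0 Hz1. simpl in Hz0, Hz1. unfold modular5. auto_derive; [lra|]. field; lra.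
    - intros z Hz0 Hz1. simpl in Hz0, Hz1.
      assert (0 < (1 - z) ^ 4 * (5 * z ^ 2 + 4 * z + 1) / z ^ 2).
      { apply Rdiv_lt_0_compat. apply Rmult_lt_0_compat. apply pow_lt; lra. nra. apply pow_lt; lra. }
      assert (0 < 16 * (1 - k) * z ^ 3).
      { apply Rmult_lt_0_compat. lra. apply pow_lt; lra. }
      replace (1 / z ^ 2 - 5 + 15 * z ^ 2 + 5 * z ^ 4 - 16 * k * z ^ 3)
        with ((1 - z) ^ 4 * (5 * z ^ 2 + 4 * z + 1) / z ^ 2 + 16 * (1 - k) * z ^ 3) by (field; lra).
      lra. }
  intros H1 H2 E1 E2. destruct (Rtotal_order p1 p2) as [L|[E|L]]; auto.
  - pose proof (Inc p1 p2). lra.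
  - pose proof (Inc p2 p1). lra.
Qed.

(** The parametrization by [L] solves the modular equation: with
    [a = (L/M)^(1/6)] and [s = 1/p - p = sqrt (2/3) (4/a - a)] it amounts to
    [s^3 + 8 s = 4 (1/w - w)]. *)
Lemma modular5_param (w L M x : R) :
  0 < w < 1 -> 0 < L -> w = sqrt (L * (18 + L) / (6 * (64 + 3 * L))) ->
  M = (18 + L) / (64 + 3 * L) -> 0 < x ->
  sqrt w / sqrt x =
     1 / 2 * sqrt (4 + 2 / 3 *
        (Rpower L (1 / 6) / Rpower M (1 / 6)
         - 4 * (Rpower M (1 / 6) / Rpower L (1 / 6))) ^ 2)
     + 1 / 2 * sqrt (2 / 3) *
        (Rpower L (1 / 6) / Rpower M (1 / 6)
         - 4 * (Rpower M (1 / 6) / Rpower L (1 / 6))) ->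
  0 < sqrt (w / x) < 1 /\ modular5 x (sqrt (w / x)) = 0.
Proof.
  intros Hw HL Ew EM Hx E.
  assert (HM : 0 < M) by (rewrite EM; apply Rdiv_lt_0_compat; lra).
  assert (W2 : w ^ 2 = L * M / 6).
  { rewrite Ew, EM. simpl. rewrite Rmult_1_r, sqrt_sqrt. field; lra.
    left. apply Rdiv_lt_0_compat; [apply Rmult_lt_0_compat|]; lra. }
  set (l := Rpower L (1 / 6)) in *. set (m := Rpower M (1 / 6)) in *.
  assert (Hl : 0 < l) by apply exp_pos. assert (Hm : 0 < m) by apply exp_pos.
  assert (L6 : l ^ 6 = L).
  { unfold l. rewrite <- Rpower_pow by apply exp_pos. rewrite Rpower_mult.
    replace (1 / 6 * INR 6) with 1 by (simpl; field). apply Rpower_1; auto. }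
  assert (M6 : m ^ 6 = M).
  { unfold m. rewrite <- Rpower_pow by apply exp_pos. rewrite Rpower_mult.
    replace (1 / 6 * INR 6) with 1 by (simpl; field). apply Rpower_1; auto. }
  set (a := l / m). assert (Ha : 0 < a) by (apply Rdiv_lt_0_compat; auto).
  assert (Ema : m / l = / a) by (unfold a; field; lra). rewrite Ema in E.
  change (l / m) with a in E.
  set (r := sqrt 6). assert (Hr2 : r * r = 6) by (apply sqrt_sqrt; lra).
  assert (Hr : 0 < r) by (apply sqrt_lt_R0; lra).
  assert (E23 : sqrt (2 / 3) = r / 3).
  { apply sqrt_lem_1; lra. }
  set (p := sqrt (w / x)).
  assert (Hp : 0 < p) by (apply sqrt_lt_R0, Rdiv_lt_0_compat; lra).
  set (s := r / 3 * (4 / a - a)).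
  assert (Ep : p = 1 / 2 * (sqrt (4 + s ^ 2) - s)).
  { unfold p. rewrite sqrt_div_alt by auto. rewrite E, E23.
    replace (4 + 2 / 3 * (a - 4 * / a) ^ 2) with (4 + s ^ 2).
    2:{ unfold s. replace ((r / 3 * (4 / a - a)) ^ 2) with (r * r / 9 * (4 / a - a) ^ 2) by (field; lra).
        rewrite Hr2. field. lra. }
    unfold s. field. lra. }
  assert (Es : s = / p - p).
  { assert (Q : sqrt (4 + s ^ 2) * sqrt (4 + s ^ 2) = 4 + s ^ 2) by (apply sqrt_sqrt; nra).
    assert (Q2 : p * (p + s) = 1) by (rewrite Ep; nra).
    assert (/ p = p + s). { apply Rmult_eq_reg_l with p; [|lra]. rewrite Rinv_r by lra. lra. }
    lra. }
  (* [w^2 = L M / 6] and [a^6 = L / M] give [L] and [M] in terms of [w] and [a]. *)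
  assert (La : L = r * w * a ^ 3).
  { assert (H1 : L ^ 2 = (r * w * a ^ 3) ^ 2).
    { replace ((r * w * a ^ 3) ^ 2) with (r * r * w ^ 2 * a ^ 6) by ring.
      rewrite Hr2, W2. unfold a. rewrite <- L6, <- M6. field. lra. }
    assert (0 < a ^ 3) by (apply pow_lt; auto).
    assert (0 < r * w * a ^ 3) by (apply Rmult_lt_0_compat; [nra | auto]). nra. }
  assert (Ma : M = r * w / a ^ 3).
  { assert (0 < a ^ 3) by (apply pow_lt; auto).
    apply Rmult_eq_reg_l with L; [|lra]. rewrite La at 2.
    replace (L * M) with (6 * w ^ 2) by lra. rewrite <- Hr2. field. lra. }
  assert (W : 18 * (1 - w ^ 2) = r * w * (64 / a ^ 3 - a ^ 3)).
  { assert (H1 : M * (64 + 3 * L) = 18 + L) by (rewrite EM; field; lra).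
    assert (H2 : M * L = 6 * w ^ 2) by lra.
    replace (r * w * (64 / a ^ 3 - a ^ 3)) with (64 * (r * w / a ^ 3) - r * w * a ^ 3)
      by (field; lra).
    rewrite <- Ma, <- La. lra. }
  assert (C : s ^ 3 + 8 * s = 4 * (/ w - w)).
  { apply Rmult_eq_reg_l with w; [|lra].
    replace (w * (4 * (/ w - w))) with (4 * (18 * (1 - w ^ 2)) / 18) by (field; lra). rewrite W.
    unfold s.
    replace (w * ((r / 3 * (4 / a - a)) ^ 3 + 8 * (r / 3 * (4 / a - a))))
      with (w * r * ((r * r) / 27 * (4 / a - a) ^ 3 + 8 / 3 * (4 / a - a))) by (field; lra).
    rewrite Hr2. field. lra. }
  assert (Hs : 0 < s).
  { assert (0 < 4 * (/ w - w)).
    { assert (1 < / w). { rewrite <- Rinv_1. apply Rinv_lt_contravar; lra. } lra. }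
    rewrite <- C in H. nra. }
  assert (Hp1 : p < 1).
  { rewrite Es in Hs. apply Rnot_le_lt. intros N.
    assert (/ p <= 1) by (rewrite <- Rinv_1; apply Rinv_le_contravar; lra). lra. }
  split; [lra|].
  assert (Wp : w = x * p ^ 2).
  { unfold p. simpl. rewrite Rmult_1_r, sqrt_sqrt. field; lra. left; apply Rdiv_lt_0_compat; lra. }
  rewrite Es, Wp in C. unfold modular5.
  replace (1 / p + 5 * p - 5 * p ^ 3 - p ^ 5 - 4 / x + 4 * x * p ^ 4)
    with (p ^ 2 * (((/ p - p) ^ 3 + 8 * (/ p - p)) - 4 * (/ (x * p ^ 2) - x * p ^ 2))) by (field; lra).
  rewrite C. ring.
Qed.

(** * The complete elliptic integral *)

Definition Kint (x t : R) : R := 1 / sqrt (1 - x ^ 2 * sin t ^ 2).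

Lemma Kint_radicand x t : 0 <= x < 1 ->
  0 < 1 - x ^ 2 /\ 1 - x ^ 2 <= 1 - x ^ 2 * sin t ^ 2 <= 1.
Proof.
  intros Hx. pose proof (sin2_cos2 t) as H. unfold Rsqr in H.
  assert (0 <= x ^ 2 < 1) by nra. assert (0 <= sin t ^ 2 <= 1) by nra. nra.
Qed.

Lemma Kint_continuous x t : 0 <= x < 1 -> continuous (Kint x) t.
Proof.
  intros Hx. pose proof (Kint_radicand x t Hx).
  apply (ex_derive_continuous (Kint x)). unfold Kint. auto_derive.
  repeat split; auto; simpl in *; try (apply Rgt_not_eq, sqrt_lt_R0); lra.
Qed.

Lemma Kint_ex_RInt x a b : 0 <= x < 1 -> ex_RInt (Kint x) a b.
Proof. intros Hx. apply (ex_RInt_continuous (Kint x)). intros; apply Kint_continuous; auto. Qed.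

Lemma ellipticK_Kint x : ellipticK x = RInt (Kint x) 0 (PI / 2).
Proof. reflexivity. Qed.

Lemma PI2_pos : 0 < PI / 2.
Proof. pose proof PI_RGT_0. lra. Qed.

Lemma RInt_Kint_PI x : 0 <= x < 1 -> RInt (Kint x) 0 PI = 2 * ellipticK x.
Proof.
  intros Hx. rewrite <- (RInt_Chasles (Kint x) 0 (PI / 2) PI); try (apply Kint_ex_RInt; auto).
  assert (E : RInt (Kint x) (PI / 2) PI = ellipticK x).
  { rewrite <- (opp_RInt_swap (Kint x) PI (PI / 2)) by (apply Kint_ex_RInt; auto).
    pose proof (RInt_comp_lin (Kint x) (-1) PI 0 (PI / 2)) as C.
    replace (-1 * 0 + PI) with PI in C by ring. replace (-1 * (PI / 2) + PI) with (PI / 2) in C by field.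
    rewrite <- C by (apply Kint_ex_RInt; auto).
    rewrite RInt_scal.
    2:{ apply (ex_RInt_ext (Kint x)); [|apply Kint_ex_RInt; auto].
        intros y _. unfold Kint. replace (-1 * y + PI) with (PI - y) by ring. rewrite sin_PI_x; auto. }
    rewrite (RInt_ext (fun y => Kint x (-1 * y + PI)) (Kint x)).
    2:{ intros y _. unfold Kint. replace (-1 * y + PI) with (PI - y) by ring. rewrite sin_PI_x; auto. }
    unfold opp, scal; simpl; unfold mult; simpl. rewrite ellipticK_Kint. ring. }
  rewrite E. unfold plus; simpl. rewrite ellipticK_Kint. ring.
Qed.

(** Landen's transformation, by the substitution [phi = t + psi] where
    [tan psi = c * tan t]; written with [2 t - phi] as an arctangent, the
    substitution is smooth on the whole interval. *)
Lemma landen k c : 0 < k -> 0 < c -> k ^ 2 + c ^ 2 = 1 ->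
  2 * ellipticK ((1 - c) / (1 + c)) = (1 + c) * ellipticK k.
Proof.
  intros Hk Hc Hkc.
  assert (Hk1 : k < 1) by nra. assert (Hc1 : c < 1) by nra.
  set (k1 := (1 - c) / (1 + c)).
  assert (Hk10 : 0 <= k1 < 1).
  { unfold k1. split. apply Rlt_le, Rdiv_lt_0_compat; lra.
    apply Rmult_lt_reg_r with (1 + c); [lra|]. field_simplify; lra. }
  set (D := fun t => cos t ^ 2 + c * sin t ^ 2).
  set (y := fun t => (1 - c) * (sin t * cos t) / D t).
  set (phi := fun t => 2 * t - atan (y t)).
  set (De := fun t => 1 - k ^ 2 * sin t ^ 2).
  assert (CS : forall t, cos t ^ 2 = 1 - sin t ^ 2).
  { intros t. pose proof (sin2_cos2 t) as H. unfold Rsqr in H. lra. }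
  assert (HD : forall t, 0 < D t).
  { intros t. unfold D. rewrite CS. pose proof (pow2_ge_0 (sin t)).
    pose proof (pow2_ge_0 (cos t)). rewrite CS in H0. nra. }
  assert (HDe : forall t, 0 < De t).
  { intros t. pose proof (Kint_radicand k t). unfold De. lra. }
  assert (Hy : forall t, 1 + y t ^ 2 = De t / D t ^ 2).
  { intros t. pose proof (HD t). unfold y. apply Rmult_eq_reg_r with (D t ^ 2); [|apply pow_nonzero; lra].
    replace (De t / D t ^ 2 * D t ^ 2) with (De t) by (field; lra).
    replace ((1 + ((1 - c) * (sin t * cos t) / D t) ^ 2) * D t ^ 2)
      with (D t ^ 2 + (1 - c) ^ 2 * (sin t ^ 2 * cos t ^ 2)) by (field; lra).
    unfold De, D. rewrite CS. replace (k ^ 2) with (1 - c ^ 2) by lra. ring. }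
  assert (Hphi : forall t, is_derive phi t ((1 + c) * D t / De t)).
  { intros t. pose proof (HD t). pose proof (HDe t). pose proof (Hy t) as Y.
    assert (dy : is_derive y t ((1 - c) * ((cos t ^ 2 - sin t ^ 2) * D t
        + 2 * (1 - c) * (sin t ^ 2 * cos t ^ 2)) / D t ^ 2)).
    { unfold y, D. auto_derive. unfold D in H; simpl in *; lra.
      unfold D in H. simpl in H. field. simpl; lra. }
    unfold phi. evar_last.
    - apply (is_derive_minus (fun t => 2 * t) (fun t => atan (y t))).
      + apply is_derive_scal. apply (is_derive_id t).
      + apply (is_derive_comp atan y); [apply is_derive_atan | exact dy].
    - unfold minus, plus, opp, scal; simpl; unfold mult, one; simpl.
      replace (1 + (y t)²) with (De t / D t ^ 2) by (rewrite <- Y; unfold Rsqr; ring).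
      replace ((1 + c) * D t) with (2 * De t - (1 - c) * ((cos t ^ 2 - sin t ^ 2) * D t
        + 2 * (1 - c) * (sin t ^ 2 * cos t ^ 2))).
      + field. lra.
      + unfold De, D. rewrite CS. replace (k ^ 2) with (1 - c ^ 2) by lra. ring. }
  assert (Hsin : forall t, 1 - k1 ^ 2 * sin (phi t) ^ 2 = D t ^ 2 / De t).
  { intros t. pose proof (HD t). pose proof (HDe t). pose proof (Hy t) as Y.
    unfold phi. rewrite sin_minus, sin_atan, cos_atan, sin_2a, cos_2a.
    assert (Hs : 0 < sqrt (1 + (y t)²)).
    { apply sqrt_lt_R0. unfold Rsqr. nra. }
    assert (Hs2 : sqrt (1 + (y t)²) ^ 2 = De t / D t ^ 2).
    { rewrite <- Rsqr_pow2, Rsqr_sqrt. rewrite <- Y; unfold Rsqr; ring. unfold Rsqr; nra. }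
    replace ((2 * sin t * cos t * (1 / sqrt (1 + (y t)²)) -
      (cos t * cos t - sin t * sin t) * (y t / sqrt (1 + (y t)²))) ^ 2)
      with ((2 * (sin t * cos t) - (cos t ^ 2 - sin t ^ 2) * y t) ^ 2 / sqrt (1 + (y t)²) ^ 2)
      by (field; lra).
    rewrite Hs2.
    replace (2 * (sin t * cos t) - (cos t ^ 2 - sin t ^ 2) * y t)
      with ((1 + c) * (sin t * cos t) / D t).
    2:{ unfold y. replace (2 * (sin t * cos t) - (cos t ^ 2 - sin t ^ 2) * ((1 - c) * (sin t * cos t) / D t))
         with (((2 * D t - (cos t ^ 2 - sin t ^ 2) * (1 - c)) * (sin t * cos t)) / D t) by (field; lra).
        f_equal. f_equal. unfold D. rewrite CS. ring. }
    apply Rmult_eq_reg_r with (De t); [|lra].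
    replace (D t ^ 2 / De t * De t) with (D t ^ 2) by (field; lra).
    unfold k1.
    replace ((1 - ((1 - c) / (1 + c)) ^ 2 * (((1 + c) * (sin t * cos t) / D t) ^ 2 / (De t / D t ^ 2))) * De t)
      with (De t - (1 - c) ^ 2 * (sin t ^ 2 * cos t ^ 2)) by (field; lra).
    unfold De, D. rewrite CS. replace (k ^ 2) with (1 - c ^ 2) by lra. ring. }
  assert (P0 : phi 0 = 0).
  { unfold phi, y. rewrite sin_0. replace ((1 - c) * (0 * cos 0) / D 0) with 0.
    rewrite atan_0; ring. pose proof (HD 0). field. lra. }
  assert (P1 : phi (PI / 2) = PI).
  { unfold phi, y. rewrite cos_PI2. replace ((1 - c) * (sin (PI / 2) * 0) / D (PI / 2)) with 0.
    rewrite atan_0; field. pose proof (HD (PI / 2)). field. lra. }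
  rewrite <- RInt_Kint_PI by auto. rewrite <- P0 at 1. rewrite <- P1.
  rewrite <- (RInt_comp (Kint k1) phi (fun t => (1 + c) * D t / De t)).
  - transitivity (RInt (fun t => scal (1 + c) (Kint k t)) 0 (PI / 2)).
    2: exact (RInt_scal (Kint k) 0 (PI / 2) (1 + c) (Kint_ex_RInt k _ _ ltac:(lra))).
    apply RInt_ext.
    + intros t _. unfold Kint at 1. rewrite Hsin. pose proof (HD t). pose proof (HDe t).
      change ((1 + c) * D t / De t * (1 / sqrt (D t ^ 2 / De t)) = (1 + c) * (1 / sqrt (De t))).
      assert (Hs : 0 < sqrt (De t)) by (apply sqrt_lt_R0; auto).
      rewrite sqrt_div_alt by auto.
      replace (sqrt (D t ^ 2)) with (D t) by (symmetry; apply sqrt_lem_1; simpl; nra).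
      assert (E : De t = sqrt (De t) * sqrt (De t)) by (symmetry; apply sqrt_sqrt; lra).
      set (s := sqrt (De t)) in *. rewrite E. field. lra.
  - intros t _. apply Kint_continuous; auto.
  - intros t _. split; [apply Hphi|].
    apply (ex_derive_continuous (fun t => (1 + c) * D t / De t)).
    pose proof (HDe t). unfold De, D in *. auto_derive. simpl in *; lra.
Qed.

Lemma ellipticK_lower x : 0 <= x < 1 -> PI / 2 <= ellipticK x.
Proof.
  intros Hx. rewrite ellipticK_Kint. pose proof PI2_pos.
  replace (PI / 2) with (RInt (fun _ => 1) 0 (PI / 2)) at 1.
  2:{ rewrite RInt_const. unfold scal; simpl; unfold mult; simpl. ring. }
  apply RInt_le; [lra | apply ex_RInt_const | apply Kint_ex_RInt; auto |].
  intros t _. pose proof (Kint_radicand x t Hx). unfold Kint.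
  assert (0 < sqrt (1 - x ^ 2 * sin t ^ 2)) by (apply sqrt_lt_R0; lra).
  assert (sqrt (1 - x ^ 2 * sin t ^ 2) <= 1)
    by (apply Rle_trans with (sqrt 1); [apply sqrt_le_1_alt; lra | rewrite sqrt_1; lra]).
  apply Rmult_le_reg_r with (sqrt (1 - x ^ 2 * sin t ^ 2)); auto.
  unfold Rdiv. rewrite Rmult_assoc, Rinv_l; lra.
Qed.

Lemma ellipticK_upper k c : 0 <= k -> 0 < c -> k ^ 2 + c ^ 2 = 1 -> ellipticK k <= PI / 2 / c.
Proof.
  intros Hk Hc Hkc. assert (Hx : 0 <= k < 1) by nra. rewrite ellipticK_Kint. pose proof PI2_pos.
  replace (PI / 2 / c) with (RInt (fun _ => 1 / c) 0 (PI / 2)).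
  2:{ rewrite RInt_const. unfold scal; simpl; unfold mult; simpl. field. lra. }
  apply RInt_le; [lra | apply Kint_ex_RInt; auto | apply ex_RInt_const |].
  intros t _. pose proof (Kint_radicand k t Hx). unfold Kint.
  assert (c <= sqrt (1 - k ^ 2 * sin t ^ 2)).
  { rewrite <- (sqrt_pow2 c) by lra. apply sqrt_le_1_alt. lra. }
  unfold Rdiv. rewrite !Rmult_1_l. apply Rinv_le_contravar; lra.
Qed.

Lemma ellipticK_pos x : 0 <= x < 1 -> 0 < ellipticK x.
Proof. intros Hx. pose proof (ellipticK_lower x Hx). pose proof PI2_pos. lra. Qed.

Lemma ellipticK_increasing x y : 0 <= x -> x < y -> y < 1 -> ellipticK x < ellipticK y.
Proof.
  intros Hx Hxy Hy. rewrite !ellipticK_Kint. apply RInt_lt.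
  - apply PI2_pos.
  - intros; apply Kint_continuous; lra.
  - intros; apply Kint_continuous; lra.
  - intros t Ht. pose proof (Kint_radicand x t). pose proof (Kint_radicand y t).
    assert (0 < sin t) by (apply sin_gt_0; lra).
    unfold Kint. unfold Rdiv. rewrite !Rmult_1_l. apply Rinv_lt_contravar.
    + apply Rmult_lt_0_compat; apply sqrt_lt_R0; lra.
    + apply sqrt_lt_1_alt. split; [lra|].
      assert (x ^ 2 < y ^ 2) by nra. assert (0 < sin t ^ 2) by (apply pow_lt; auto). nra.
Qed.

(** The comparison integrand [sin t / sqrt (cos^2 t + k^2)] has an elementary
    primitive and carries the whole logarithmic singularity as [k] tends to 0. *)
Lemma ellipticK_log k c : 0 < k -> 0 < c -> k ^ 2 + c ^ 2 = 1 ->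
  - ln k <= ellipticK c <= (2 - ln k) / c + PI / 2.
Proof.
  intros Hk Hc Hkc. assert (Hx : 0 <= c < 1) by nra. assert (Hk1 : k < 1) by nra.
  rewrite ellipticK_Kint. pose proof PI2_pos as HPI.
  set (h := fun t => sin t / sqrt (cos t ^ 2 + k ^ 2)).
  assert (Hrad : forall t, 0 < cos t ^ 2 + k ^ 2) by (intros t; nra).
  assert (Hrad' : forall t, 0 < sqrt (cos t ^ 2 + k ^ 2)) by (intros t; apply sqrt_lt_R0; auto).
  assert (Hprim : is_RInt h 0 (PI / 2) (ln (1 + sqrt (1 + k ^ 2)) - ln k)).
  { set (F := fun t => - ln (cos t + sqrt (cos t ^ 2 + k ^ 2))).
    assert (Hpos : forall t, 0 < cos t + sqrt (cos t ^ 2 + k ^ 2)).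
    { intros t. assert (sqrt (cos t ^ 2) < sqrt (cos t ^ 2 + k ^ 2)) by (apply sqrt_lt_1_alt; nra).
      rewrite <- (Rsqr_pow2 (cos t)), sqrt_Rsqr_abs in H at 1.
      pose proof (Rle_abs (- cos t)). rewrite Rabs_Ropp in H0. lra. }
    replace (ln (1 + sqrt (1 + k ^ 2)) - ln k) with (minus (F (PI / 2)) (F 0)).
    - apply (is_RInt_derive F h).
      + intros t _. pose proof (Hrad t). pose proof (Hrad' t). pose proof (Hpos t).
        unfold F, h. auto_derive.
        * simpl in *. repeat split; auto; try lra.
        * simpl in *. field. split; lra.
      + intros t _. pose proof (Hrad t). pose proof (Hrad' t).
        apply (ex_derive_continuous h). unfold h. auto_derive. simpl in *; repeat split; auto; lra.
    - unfold F, minus, plus, opp; simpl. rewrite cos_PI2, cos_0.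
      replace (0 * (0 * 1) + k * (k * 1)) with (k ^ 2) by ring. rewrite sqrt_pow2 by lra.
      replace (1 * (1 * 1) + k * (k * 1)) with (1 + k * (k * 1)) by ring.
      rewrite Rplus_0_l. ring. }
  assert (Hcmp : forall t, 0 < t < PI / 2 -> h t <= Kint c t <= / c * h t + 1).
  { intros t Ht. pose proof (Kint_radicand c t Hx) as Rd.
    assert (Hs : 0 < sin t) by (apply sin_gt_0; lra).
    assert (Hcs : 0 < cos t) by (apply cos_gt_0; lra).
    pose proof (sin2_cos2 t) as SC. unfold Rsqr in SC.
    assert (Hs1 : sin t <= 1) by nra.
    unfold Kint. replace (1 - c ^ 2 * sin t ^ 2) with (cos t ^ 2 + k ^ 2 * sin t ^ 2) in * by nra.
    set (Q := sqrt (cos t ^ 2 + k ^ 2 * sin t ^ 2)).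
    assert (HQ : 0 < Q) by (apply sqrt_lt_R0; lra).
    assert (Q <= sqrt (cos t ^ 2 + k ^ 2)) by (apply sqrt_le_1_alt; nra).
    assert (HcQ : c * sqrt (cos t ^ 2 + k ^ 2) <= Q).
    { rewrite <- (sqrt_pow2 c) at 1 by lra. rewrite <- sqrt_mult by nra.
      apply sqrt_le_1_alt. replace (c ^ 2) with (1 - k ^ 2) by lra.
      replace (sin t ^ 2) with (1 - cos t ^ 2) by nra.
      assert (0 <= k ^ 4) by (apply pow_le; lra). nra. }
    assert (HCQ : cos t <= Q).
    { rewrite <- (sqrt_pow2 (cos t)) by lra. apply sqrt_le_1_alt. nra. }
    assert (1 - sin t <= cos t) by nra.
    specialize (Hrad' t). unfold h. split.
    - apply Rle_trans with (1 / sqrt (cos t ^ 2 + k ^ 2)).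
      + apply Rmult_le_compat_r; [left; apply Rinv_0_lt_compat; auto | auto].
      + apply Rmult_le_compat_l; [lra|]. apply Rinv_le_contravar; auto.
    - replace (1 / Q) with (sin t / Q + (1 - sin t) / Q) by (field; lra).
      apply Rplus_le_compat.
      + replace (/ c * (sin t / sqrt (cos t ^ 2 + k ^ 2)))
          with (sin t / (c * sqrt (cos t ^ 2 + k ^ 2))) by (field; lra).
        apply Rmult_le_compat_l; [lra|]. apply Rinv_le_contravar; auto.
        apply Rmult_lt_0_compat; auto.
      + apply Rmult_le_reg_r with Q; auto. unfold Rdiv. rewrite Rmult_assoc, Rinv_l; lra. }
  assert (Hex : ex_RInt h 0 (PI / 2)) by (eexists; apply Hprim).
  assert (Hval : RInt h 0 (PI / 2) = ln (1 + sqrt (1 + k ^ 2)) - ln k)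
    by (apply is_RInt_unique; exact Hprim).
  assert (Hsq : 0 < sqrt (1 + k ^ 2)) by (apply sqrt_lt_R0; nra).
  split.
  - apply Rle_trans with (RInt h 0 (PI / 2)).
    + rewrite Hval. assert (0 <= ln (1 + sqrt (1 + k ^ 2))); [|lra].
      rewrite <- ln_1. apply Rcomplements.ln_le; lra.
    + apply RInt_le; auto; try lra. apply Kint_ex_RInt; auto. intros; apply Hcmp; auto.
  - set (v := ln (1 + sqrt (1 + k ^ 2)) - ln k) in *.
    pose proof (is_RInt_plus (V := R_NormedModule) _ _ _ _ _ _
      (is_RInt_scal (V := R_NormedModule) h 0 (PI / 2) (/ c) v Hprim)
      (is_RInt_const (V := R_NormedModule) 0 (PI / 2) 1)) as Hup.
    assert (Hc' : is_RInt (Kint c) 0 (PI / 2) (RInt (Kint c) 0 (PI / 2))).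
    { apply (RInt_correct (V := R_CompleteNormedModule)). apply Kint_ex_RInt; auto. }
    eapply Rle_trans.
    + refine (is_RInt_le _ _ _ _ _ _ _ Hc' Hup _); [lra|].
      intros t Ht. apply (Hcmp t Ht).
    + change (/ c * v + (PI / 2 - 0) * 1 <= (2 - ln k) / c + PI / 2).
      assert (sqrt (1 + k ^ 2) <= 2).
      { rewrite <- (sqrt_pow2 2) by lra. apply sqrt_le_1_alt. nra. }
      assert (ln (1 + sqrt (1 + k ^ 2)) <= 2).
      { rewrite <- (ln_exp 2). apply Rcomplements.ln_le; [lra|].
        pose proof (exp_ge_1x 2). lra. }
      assert (/ c * v <= (2 - ln k) / c).
      { unfold Rdiv. rewrite Rmult_comm. apply Rmult_le_compat_r; [left; apply Rinv_0_lt_compat; auto|].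
        unfold v. lra. }
      lra.
Qed.

(** * The nome of a modulus *)

Definition modk (t : R) : R := th2 t ^ 2 / th3 t ^ 2.
Definition modk' (t : R) : R := th4 t ^ 2 / th3 t ^ 2.

Lemma modk_pos t : 0 < t -> 0 < modk t.
Proof.
  intros Ht. apply Rdiv_lt_0_compat; apply pow_lt. apply th2_pos; auto. apply th3_pos; auto.
Qed.

Lemma modk'_pos t : 0 < t -> 0 < modk' t.
Proof.
  intros Ht. apply Rdiv_lt_0_compat; apply pow_lt. apply th4_pos; auto. apply th3_pos; auto.
Qed.

Lemma modk_sqr t : 0 < t -> modk t ^ 2 + modk' t ^ 2 = 1.
Proof.
  intros Ht. pose proof (jacobi_quartic t Ht). pose proof (th3_pos t Ht).
  unfold modk, modk'. apply Rmult_eq_reg_r with (th3 t ^ 4); [|apply pow_nonzero; lra].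
  rewrite Rmult_1_l. transitivity (th2 t ^ 4 + th4 t ^ 4); [field; lra | auto].
Qed.

Lemma modk_lt_1 t : 0 < t -> 0 < modk t < 1 /\ 0 < modk' t < 1.
Proof.
  intros Ht. pose proof (modk_pos t Ht). pose proof (modk'_pos t Ht). pose proof (modk_sqr t Ht). nra.
Qed.

Lemma sqrt_modk t : 0 < t -> sqrt (1 - modk t ^ 2) = modk' t.
Proof.
  intros Ht. pose proof (modk'_pos t Ht). replace (1 - modk t ^ 2) with (modk' t ^ 2)
    by (pose proof (modk_sqr t Ht); lra). apply sqrt_pow2; lra.
Qed.

Lemma landen_modk t : 0 < t ->
  ellipticK (modk (2 * t)) / th3 (2 * t) ^ 2 = ellipticK (modk t) / th3 t ^ 2.
Proof.
  intros Ht. pose proof (th3_pos t Ht). pose proof (th3_pos (2 * t) ltac:(lra)).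
  pose proof (landen (modk t) (modk' t) (modk_pos t Ht) (modk'_pos t Ht) (modk_sqr t Ht)) as L.
  assert (S : 0 < th3 t ^ 2) by (apply pow_lt; auto).
  assert (S2 : 0 < th3 (2 * t) ^ 2) by (apply pow_lt; auto).
  pose proof (th3_sqr t Ht) as E3. pose proof (th4_sqr t Ht) as E4.
  assert (E : 1 + modk' t = 2 * th3 (2 * t) ^ 2 / th3 t ^ 2).
  { unfold modk'. apply Rmult_eq_reg_r with (th3 t ^ 2); [|lra].
    replace (2 * th3 (2 * t) ^ 2 / th3 t ^ 2 * th3 t ^ 2) with (2 * th3 (2 * t) ^ 2) by (field; lra).
    replace ((1 + th4 t ^ 2 / th3 t ^ 2) * th3 t ^ 2) with (th3 t ^ 2 + th4 t ^ 2) by (field; lra).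
    lra. }
  replace ((1 - modk' t) / (1 + modk' t)) with (modk (2 * t)) in L.
  2:{ rewrite E. unfold modk, modk'.
      replace (th2 (2 * t) ^ 2) with ((th3 t ^ 2 - th4 t ^ 2) / 2) by lra. field. lra. }
  rewrite E in L.
  replace (ellipticK (modk (2 * t))) with (th3 (2 * t) ^ 2 / th3 t ^ 2 * ellipticK (modk t)) by lra.
  field. lra.
Qed.

Lemma landen_modk' t : 0 < t ->
  ellipticK (modk' (2 * t)) / th3 (2 * t) ^ 2 = 2 * (ellipticK (modk' t) / th3 t ^ 2).
Proof.
  intros Ht. pose proof (th3_pos t Ht). pose proof (th3_pos (2 * t) ltac:(lra)).
  assert (H2 : 0 < 2 * t) by lra.
  pose proof (landen (modk' (2 * t)) (modk (2 * t)) (modk'_pos _ H2) (modk_pos _ H2)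
    ltac:(rewrite Rplus_comm; apply modk_sqr; auto)) as L.
  assert (S : 0 < th3 t ^ 2) by (apply pow_lt; auto).
  assert (S2 : 0 < th3 (2 * t) ^ 2) by (apply pow_lt; auto).
  pose proof (th3_sqr t Ht) as E3. pose proof (th4_sqr t Ht) as E4.
  assert (E : 1 + modk (2 * t) = th3 t ^ 2 / th3 (2 * t) ^ 2).
  { unfold modk. rewrite E3. field. lra. }
  replace ((1 - modk (2 * t)) / (1 + modk (2 * t))) with (modk' t) in L.
  2:{ rewrite E. unfold modk, modk'. rewrite E4. field. lra. }
  rewrite E in L.
  replace (2 * (ellipticK (modk' t) / th3 t ^ 2)) with (2 * ellipticK (modk' t) / th3 t ^ 2) by (field; lra).
  rewrite L. field. lra.
Qed.

Lemma Eu_near_1 t : 1 <= t -> 1 - 4 * exp (- t) <= Eu t <= 1.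
Proof.
  intros Ht. split; [|apply Eu_le_1; lra].
  pose proof (Eu_lower t ltac:(lra)) as L. set (x := exp (- t)) in *.
  assert (0 < x) by apply exp_pos.
  assert (x <= / 2).
  { unfold x. rewrite exp_Ropp. apply Rinv_le_contravar; [lra|].
    pose proof (exp_ge_1x t). lra. }
  clearbody x. pose proof (exp_ge_1x (- (x / (1 - x) ^ 2))).
  assert (x / (1 - x) ^ 2 <= 4 * x).
  { apply Rmult_le_reg_r with ((1 - x) ^ 2). apply pow_lt; lra.
    assert (N : 1 - x <> 0) by lra.
    replace (x / (1 - x) ^ 2 * (1 - x) ^ 2) with x by (field; exact N).
    assert (/ 4 <= (1 - x) ^ 2) by nra. nra. }
  lra.
Qed.

Lemma is_lim_seq_value u (a b : R) : a = b -> is_lim_seq u a -> is_lim_seq u b.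
Proof. intros ->; auto. Qed.

Lemma is_lim_seq_pow u (a : R) k : is_lim_seq u a -> is_lim_seq (fun n => u n ^ k) (a ^ k).
Proof.
  intros H. induction k; simpl. apply is_lim_seq_const. apply is_lim_seq_mult'; auto.
Qed.

Lemma Eu_doubling_lim a t : 0 < a -> 0 < t -> is_lim_seq (fun n => Eu (a * (2 ^ n * t))) 1.
Proof.
  intros Ha Ht. assert (Hat : 0 < a * t) by nra.
  assert (L : is_lim_seq (fun n => a * (2 ^ n * t)) p_infty).
  { apply is_lim_seq_ext with (fun n => (a * t) * 2 ^ n). intros; ring.
    evar_last. apply is_lim_seq_scal_l. apply (is_lim_seq_geom_p 2); lra.
    simpl. destruct (Rle_dec 0 (a * t)); [|lra]. destruct (Rle_lt_or_eq_dec 0 (a * t) r); auto; lra. }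
  assert (X : is_lim_seq (fun n => exp (- (a * (2 ^ n * t)))) 0).
  { apply is_lim_seq_le_le with (fun _ => 0) (fun n => / (a * (2 ^ n * t))).
    - intros n. assert (0 < a * (2 ^ n * t)).
      { pose proof (pow_lt 2 n ltac:(lra)). apply Rmult_lt_0_compat; auto. apply Rmult_lt_0_compat; auto. }
      split. left; apply exp_pos. rewrite exp_Ropp. apply Rinv_le_contravar; auto.
      pose proof (exp_ge_1x (a * (2 ^ n * t))). lra.
    - apply is_lim_seq_const.
    - apply (is_lim_seq_inv _ p_infty); auto. discriminate. }
  apply is_lim_seq_le_le_loc with (fun n => 1 - 4 * exp (- (a * (2 ^ n * t)))) (fun _ => 1).
  - apply is_lim_seq_spec in L. destruct (L 1) as [N HN]. exists N. intros n Hn.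
    apply Eu_near_1. specialize (HN n Hn). lra.
  - replace (Finite 1) with (Finite (1 - 4 * 0)) by (f_equal; ring).
    apply is_lim_seq_minus'. apply is_lim_seq_const.
    apply is_lim_seq_mult'; [apply is_lim_seq_const | auto].
  - apply is_lim_seq_const.
Qed.

Lemma Eu_doubling_lim1 t : 0 < t -> is_lim_seq (fun n => Eu (2 ^ n * t)) 1.
Proof.
  intros Ht. apply is_lim_seq_ext with (fun n => Eu (1 * (2 ^ n * t))).
  intros; f_equal; ring. apply Eu_doubling_lim; lra.
Qed.

Lemma pow2_t_pos n t : 0 < t -> 0 < 2 ^ n * t.
Proof. intros. apply Rmult_lt_0_compat; auto. apply pow_lt; lra. Qed.

Lemma th3_doubling_lim t : 0 < t -> is_lim_seq (fun n => th3 (2 ^ n * t)) 1.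
Proof.
  intros Ht. unfold th3.
  pose proof (Eu_doubling_lim1 t Ht) as L1.
  pose proof (Eu_doubling_lim 2 t ltac:(lra) Ht) as L2.
  pose proof (Eu_doubling_lim 4 t ltac:(lra) Ht) as L4.
  refine (is_lim_seq_value _ _ _ _ (is_lim_seq_div_fin _ _ _ _ (is_lim_seq_pow _ _ 5 L2)
    (is_lim_seq_mult' _ _ _ _ (is_lim_seq_pow _ _ 2 L1) (is_lim_seq_pow _ _ 2 L4)) _)); [field | lra].
Qed.

Lemma th4_doubling_lim t : 0 < t -> is_lim_seq (fun n => th4 (2 ^ n * t)) 1.
Proof.
  intros Ht. unfold th4.
  pose proof (Eu_doubling_lim1 t Ht) as L1.
  pose proof (Eu_doubling_lim 2 t ltac:(lra) Ht) as L2.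
  refine (is_lim_seq_value _ _ _ _ (is_lim_seq_div_fin _ _ _ _ (is_lim_seq_pow _ _ 2 L1) L2 _)); [field | lra].
Qed.

Lemma modk'_doubling_lim t : 0 < t -> is_lim_seq (fun n => modk' (2 ^ n * t)) 1.
Proof.
  intros Ht. unfold modk'.
  refine (is_lim_seq_value _ _ _ _ (is_lim_seq_div_fin _ _ _ _ (is_lim_seq_pow _ _ 2 (th4_doubling_lim t Ht))
    (is_lim_seq_pow _ _ 2 (th3_doubling_lim t Ht)) _)); [field | lra].
Qed.

(** Both sides of Landen's transformation are carried by [t -> 2 t], so that the
    quotient is determined by its limit at infinity, where the modulus is 0. *)
Lemma ellipticK_modk t : 0 < t -> ellipticK (modk t) = PI / 2 * th3 t ^ 2.
Proof.
  intros Ht. pose proof (th3_pos t Ht) as H3.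
  set (c := ellipticK (modk t) / th3 t ^ 2).
  assert (Hn : forall n, ellipticK (modk (2 ^ n * t)) / th3 (2 ^ n * t) ^ 2 = c).
  { induction n. simpl. rewrite Rmult_1_l. reflexivity.
    replace (2 ^ S n * t) with (2 * (2 ^ n * t)) by (simpl; ring).
    rewrite landen_modk; auto. apply pow2_t_pos; auto. }
  assert (L3 : is_lim_seq (fun n => th3 (2 ^ n * t) ^ 2) (1 * (1 * 1))).
  { apply (is_lim_seq_value _ (1 ^ 2)); [ring|]. apply is_lim_seq_pow, th3_doubling_lim; auto. }
  assert (LK : is_lim_seq (fun n => ellipticK (modk (2 ^ n * t))) (PI / 2)).
  { apply is_lim_seq_le_le with (fun _ => PI / 2) (fun n => PI / 2 / modk' (2 ^ n * t)).
    - intros n. pose proof (pow2_t_pos n t Ht) as Hp. pose proof (modk_lt_1 _ Hp).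
      split. apply ellipticK_lower; lra. apply ellipticK_upper; try lra. apply modk_sqr; auto.
    - apply is_lim_seq_const.
    - replace (Finite (PI / 2)) with (Finite (PI / 2 / 1)) by (f_equal; field).
      apply is_lim_seq_div_fin; [apply is_lim_seq_const | apply modk'_doubling_lim; auto | lra]. }
  assert (Lc : is_lim_seq (fun n => ellipticK (modk (2 ^ n * t)) / th3 (2 ^ n * t) ^ 2) (PI / 2 / (1 * (1 * 1)))).
  { apply is_lim_seq_div_fin; auto; lra. }
  apply (is_lim_seq_ext _ (fun _ => c)) in Lc; auto.
  pose proof (lim_unique _ _ _ Lc (is_lim_seq_const c)) as E.
  replace (ellipticK (modk t)) with (c * th3 t ^ 2) by (unfold c; field; lra).
  rewrite <- E. field.
Qed.

(** [2 K'/th3^2] doubles with [t], so it is the limit of its values at [2^n t]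
    divided by [2^n]; the logarithmic singularity of [K'] gives that limit. *)
Lemma ellipticK_modk' t : 0 < t -> ellipticK (modk' t) = t / 2 * th3 t ^ 2.
Proof.
  intros Ht. pose proof (th3_pos t Ht) as H3.
  set (c := ellipticK (modk' t) / th3 t ^ 2).
  assert (Hn : forall n, ellipticK (modk' (2 ^ n * t)) / th3 (2 ^ n * t) ^ 2 = 2 ^ n * c).
  { induction n. simpl. rewrite !Rmult_1_l. reflexivity.
    replace (2 ^ S n * t) with (2 * (2 ^ n * t)) by (simpl; ring).
    rewrite landen_modk' by (apply pow2_t_pos; auto). rewrite IHn. simpl. ring. }
  assert (L3 : is_lim_seq (fun n => th3 (2 ^ n * t) ^ 2) (1 * (1 * 1))).
  { apply (is_lim_seq_value _ (1 ^ 2)); [ring|]. apply is_lim_seq_pow, th3_doubling_lim; auto. }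
  assert (G0 : is_lim_seq (fun n => (/ 2) ^ n) 0).
  { apply is_lim_seq_geom. rewrite Rabs_pos_eq; lra. }
  assert (Hinv : forall n, (/ 2) ^ n = / 2 ^ n) by (intros; apply pow_inv).
  (* [- ln (modk u) = u / 2 + O(1)] as [u] tends to infinity, from the factor
     [exp (- u / 4)] of [th2 u]. *)
  assert (Llog : is_lim_seq (fun n => (/ 2) ^ n * - ln (modk (2 ^ n * t))) (t / 2)).
  { pose (f := fun n => 2 * ln (th3 (2 ^ n * t)) - 2 * ln 2
        - 2 * ln (Eu (4 * (2 ^ n * t)) ^ 2 / Eu (2 * (2 ^ n * t)))).
    apply is_lim_seq_ext with (fun n => t / 2 + (/ 2) ^ n * f n).
    - intros n. set (u := 2 ^ n * t). assert (Hu : 0 < u) by apply (pow2_t_pos n t Ht).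
      pose proof (th3_pos u Hu). pose proof (th2_pos u Hu).
      pose proof (Eu_pos (4 * u) ltac:(lra)). pose proof (Eu_pos (2 * u) ltac:(lra)).
      assert (Q : 0 < Eu (4 * u) ^ 2 / Eu (2 * u)) by (apply Rdiv_lt_0_compat; auto; apply pow_lt; auto).
      assert (E2 : ln (th2 u) = ln 2 + - (u / 4) + ln (Eu (4 * u) ^ 2 / Eu (2 * u))).
      { unfold th2. replace (2 * exp (- (u / 4)) * Eu (4 * u) ^ 2 / Eu (2 * u))
          with (2 * exp (- (u / 4)) * (Eu (4 * u) ^ 2 / Eu (2 * u))) by (field; lra).
        rewrite !ln_mult, ln_exp; auto; try lra. apply exp_pos.
        apply Rmult_lt_0_compat; [lra | apply exp_pos]. }
      assert (E : ln (modk u) = 2 * ln (th2 u) - 2 * ln (th3 u)).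
      { unfold modk. rewrite ln_div by (apply pow_lt; auto). simpl. rewrite !Rmult_1_r, !ln_mult; auto. ring. }
      fold u. rewrite E, E2. unfold f. fold u. rewrite Hinv.
      replace (t / 2) with (/ 2 ^ n * (u / 2)).
      2:{ unfold u. field. apply pow_nonzero; lra. }
      field. apply pow_nonzero; lra.
    - replace (Finite (t / 2)) with (Finite (t / 2 + 0 * (2 * ln 1 - 2 * ln 2 - 2 * ln ((1 * (1 * 1)) / 1))))
        by (f_equal; ring).
      apply is_lim_seq_plus'; [apply is_lim_seq_const|]. apply is_lim_seq_mult'; auto.
      assert (Lln : forall v (b : R), 0 < b -> is_lim_seq v b -> is_lim_seq (fun n => ln (v n)) (ln b)).
      { intros v b Hb Hv. apply (is_lim_seq_continuous ln v b); auto.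
        apply derivable_continuous_pt. exists (/ b). apply derivable_pt_lim_ln; auto. }
      unfold f. apply is_lim_seq_minus'; [apply is_lim_seq_minus'|];
        try (apply is_lim_seq_mult'; [apply is_lim_seq_const|]); try apply is_lim_seq_const.
      + apply Lln; [lra|]. apply th3_doubling_lim; auto.
      + apply Lln; [lra|].
        apply (is_lim_seq_div_fin (fun n => Eu (4 * (2 ^ n * t)) ^ 2) (fun n => Eu (2 * (2 ^ n * t)))); [| |lra].
        * apply (is_lim_seq_value _ (1 ^ 2)); [ring|]. apply is_lim_seq_pow, Eu_doubling_lim; lra.
        * apply Eu_doubling_lim; lra. }
  assert (LK : is_lim_seq (fun n => (/ 2) ^ n * ellipticK (modk' (2 ^ n * t))) (t / 2)).
  { apply is_lim_seq_le_le with (fun n => (/ 2) ^ n * - ln (modk (2 ^ n * t)))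
      (fun n => ((/ 2) ^ n * 2 + (/ 2) ^ n * - ln (modk (2 ^ n * t))) / modk' (2 ^ n * t) + (/ 2) ^ n * (PI / 2)).
    - intros n. pose proof (pow2_t_pos n t Ht) as Hp. pose proof (modk_lt_1 _ Hp) as [Hk Hk'].
      destruct (ellipticK_log (modk (2 ^ n * t)) (modk' (2 ^ n * t))) as [A B]; try lra.
      { apply modk_sqr; auto. }
      assert (0 < (/ 2) ^ n) by (apply pow_lt; lra). split.
      + apply Rmult_le_compat_l; lra.
      + apply Rle_trans with ((/ 2) ^ n * ((2 - ln (modk (2 ^ n * t))) / modk' (2 ^ n * t) + PI / 2)).
        apply Rmult_le_compat_l; lra. right. field. lra.
    - auto.
    - replace (Finite (t / 2)) with (Finite ((0 * 2 + t / 2) / 1 + 0 * (PI / 2))) by (f_equal; field).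
      apply is_lim_seq_plus'.
      + apply is_lim_seq_div_fin; [|apply modk'_doubling_lim; auto|lra].
        apply is_lim_seq_plus'; auto. apply is_lim_seq_mult'; auto. apply is_lim_seq_const.
      + apply is_lim_seq_mult'; auto. apply is_lim_seq_const. }
  pose proof (is_lim_seq_div_fin _ _ _ _ LK L3 ltac:(lra)) as Lc.
  apply (is_lim_seq_ext _ (fun _ => c)) in Lc.
  - pose proof (lim_unique _ _ _ Lc (is_lim_seq_const c)) as E.
    replace (ellipticK (modk' t)) with (c * th3 t ^ 2) by (unfold c; field; lra).
    rewrite <- E. field.
  - intros n. pose proof (th3_pos _ (pow2_t_pos n t Ht)).
    replace (ellipticK (modk' (2 ^ n * t))) with
      (2 ^ n * c * th3 (2 ^ n * t) ^ 2) by (rewrite <- Hn; field; lra).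
    rewrite Hinv. field. repeat split; try lra; apply pow_nonzero; lra.
Qed.

Lemma K_ratio_modk t : 0 < t -> ellipticK (sqrt (1 - modk t ^ 2)) / ellipticK (modk t) = t / PI.
Proof.
  intros Ht. rewrite sqrt_modk, ellipticK_modk, ellipticK_modk' by auto.
  pose proof (th3_pos t Ht). pose proof PI_RGT_0. field. lra.
Qed.

Lemma K_ratio_decreasing x y : 0 < x -> x < y -> y < 1 ->
  ellipticK (sqrt (1 - y ^ 2)) / ellipticK y < ellipticK (sqrt (1 - x ^ 2)) / ellipticK x.
Proof.
  intros Hx Hxy Hy.
  assert (B : forall z, 0 < z < 1 -> 0 <= sqrt (1 - z ^ 2) < 1).
  { intros z Hz. split. apply sqrt_pos. rewrite <- sqrt_1 at 2. apply sqrt_lt_1_alt. nra. }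
  pose proof (B x ltac:(lra)). pose proof (B y ltac:(lra)).
  assert (sqrt (1 - y ^ 2) < sqrt (1 - x ^ 2)) by (apply sqrt_lt_1_alt; nra).
  pose proof (ellipticK_increasing x y ltac:(lra) Hxy Hy).
  pose proof (ellipticK_increasing _ _ (proj1 H0) H1 (proj2 H)).
  pose proof (ellipticK_pos x ltac:(lra)). pose proof (ellipticK_pos y ltac:(lra)).
  pose proof (ellipticK_pos _ H0).
  apply Rlt_trans with (ellipticK (sqrt (1 - y ^ 2)) / ellipticK x).
  - apply Rmult_lt_compat_l; auto. apply Rinv_lt_contravar; auto. apply Rmult_lt_0_compat; auto.
  - apply Rmult_lt_compat_r; auto. apply Rinv_0_lt_compat; auto.
Qed.

Lemma K_ratio_inj x y : 0 < x < 1 -> 0 < y < 1 ->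
  ellipticK (sqrt (1 - x ^ 2)) / ellipticK x = ellipticK (sqrt (1 - y ^ 2)) / ellipticK y -> x = y.
Proof.
  intros Hx Hy E. destruct (Rtotal_order x y) as [L|[L|L]]; auto; exfalso.
  - pose proof (K_ratio_decreasing x y). lra.
  - pose proof (K_ratio_decreasing y x). lra.
Qed.

Lemma K_ratio_pos x : 0 < x < 1 -> 0 < ellipticK (sqrt (1 - x ^ 2)) / ellipticK x.
Proof.
  intros Hx. apply Rdiv_lt_0_compat; apply ellipticK_pos; [|lra].
  split. apply sqrt_pos. rewrite <- sqrt_1 at 2. apply sqrt_lt_1_alt. nra.
Qed.

Lemma singular_modulus_spec r : 0 < r -> 0 < singular_modulus r < 1 /\
  ellipticK (sqrt (1 - singular_modulus r ^ 2)) / ellipticK (singular_modulus r) = sqrt r.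
Proof.
  intros Hr. unfold singular_modulus.
  apply (iota_correct (V := R_CompleteNormedModule) (fun k : R =>
    0 < k < 1 /\ ellipticK (sqrt (1 - k ^ 2)) / ellipticK k = sqrt r)).
  assert (Hs : 0 < sqrt r) by (apply sqrt_lt_R0; auto). pose proof PI_RGT_0.
  assert (Ht : 0 < PI * sqrt r) by (apply Rmult_lt_0_compat; auto).
  exists (modk (PI * sqrt r)). split.
  - split. apply modk_lt_1; auto. rewrite K_ratio_modk by auto. field. lra.
  - intros k [Hk Ek]. apply K_ratio_inj; auto. apply modk_lt_1; auto.
    rewrite K_ratio_modk by auto. rewrite Ek. field. lra.
Qed.

Lemma singular_modulus_inv_value x : 0 < x < 1 ->
  singular_modulus_inv x = (ellipticK (sqrt (1 - x ^ 2)) / ellipticK x) ^ 2.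
Proof.
  intros Hx. unfold singular_modulus_inv. pose proof (K_ratio_pos x Hx) as Hp.
  apply (iota_unique (V := R_CompleteNormedModule)).
  - intros r [Hr <-]. destruct (singular_modulus_spec r Hr) as [_ E]. rewrite E. simpl.
    rewrite Rmult_1_r, sqrt_sqrt; lra.
  - assert (H2 : 0 < (ellipticK (sqrt (1 - x ^ 2)) / ellipticK x) ^ 2) by (apply pow_lt; auto).
    split; auto. destruct (singular_modulus_spec _ H2) as [B E].
    apply K_ratio_inj; auto. rewrite E. apply sqrt_pow2. lra.
Qed.

(** Every modulus is [modk t] for its own nome, because [modk t] has the same ratio
    [K'/K] and that ratio is injective. *)
Lemma modk_surjective x : 0 < x < 1 -> exists t, 0 < t /\ x = modk t /\
  PI * sqrt (singular_modulus_inv x) = t.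
Proof.
  intros Hx. pose proof (K_ratio_pos x Hx) as Hp. pose proof PI_RGT_0.
  exists (PI * (ellipticK (sqrt (1 - x ^ 2)) / ellipticK x)).
  assert (Ht : 0 < PI * (ellipticK (sqrt (1 - x ^ 2)) / ellipticK x)) by (apply Rmult_lt_0_compat; auto).
  split; auto. split.
  - apply K_ratio_inj; auto. apply modk_lt_1; auto. rewrite K_ratio_modk by auto.
    field. pose proof (ellipticK_pos x). lra.
  - rewrite singular_modulus_inv_value, sqrt_pow2; auto. lra.
Qed.

(** * The derivative in terms of the modulus *)

Lemma modk_decr t : 0 < t -> modk (5 * t) < modk t.
Proof.
  intros Ht. apply Rnot_le_lt. intros N.
  assert (H5 : 0 < 5 * t) by lra.
  pose proof (K_ratio_modk t Ht) as E1. pose proof (K_ratio_modk (5 * t) H5) as E5.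
  pose proof PI_RGT_0 as HPI.
  assert (t / PI < 5 * t / PI).
  { apply Rmult_lt_compat_r; [apply Rinv_0_lt_compat; auto | lra]. }
  destruct N as [N|N].
  - pose proof (K_ratio_decreasing (modk t) (modk (5 * t)) (modk_pos t Ht) N
      (proj2 (proj1 (modk_lt_1 _ H5)))). lra.
  - rewrite N in E1. lra.
Qed.

Lemma theta_ratio_order t : 0 < t -> th2 (5 * t) / th2 t < th3 (5 * t) / th3 t.
Proof.
  intros Ht. pose proof (modk_decr t Ht) as M. unfold modk in M.
  pose proof (th2_pos t Ht). pose proof (th3_pos t Ht).
  pose proof (th2_pos (5 * t) ltac:(lra)). pose proof (th3_pos (5 * t) ltac:(lra)).
  assert (Q : th2 (5 * t) / th3 (5 * t) < th2 t / th3 t).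
  { apply Rnot_le_lt. intros N.
    assert (0 < th2 t / th3 t) by (apply Rdiv_lt_0_compat; auto).
    assert ((th2 t / th3 t) ^ 2 <= (th2 (5 * t) / th3 (5 * t)) ^ 2) by (apply pow_incr; lra).
    replace ((th2 t / th3 t) ^ 2) with (th2 t ^ 2 / th3 t ^ 2) in * by (field; lra).
    replace ((th2 (5 * t) / th3 (5 * t)) ^ 2) with (th2 (5 * t) ^ 2 / th3 (5 * t) ^ 2) in * by (field; lra).
    lra. }
  apply (Rmult_lt_compat_r (th3 (5 * t) / th2 t)) in Q; [|apply Rdiv_lt_0_compat; auto].
  replace (th2 (5 * t) / th3 (5 * t) * (th3 (5 * t) / th2 t)) with (th2 (5 * t) / th2 t) in Q by (field; lra).
  replace (th2 t / th3 t * (th3 (5 * t) / th2 t)) with (th3 (5 * t) / th3 t) in Q by (field; lra).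
  exact Q.
Qed.

(** Divided by [v^2], the third conclusion expresses the multiplier
    [1/v^2 = K(k)/K(l)] by square roots of ratios of the moduli [k], [l] and of
    their complements. *)
Lemma degree5 t : 0 < t ->
  let u := th2 (5 * t) / th2 t in
  let v := th3 (5 * t) / th3 t in
  let g := th4 (5 * t) / th4 t in
  0 < u < v /\ 0 < g /\ v * (u + g) - u * g = 1 /\ modular5 (modk t) (sqrt (u / v)) = 0.
Proof.
  intros Ht u v g. assert (H5 : 0 < 5 * t) by lra.
  pose proof (th2_pos t Ht) as Ha. pose proof (th3_pos t Ht) as Hb. pose proof (th4_pos t Ht) as Hc.
  pose proof (th2_pos _ H5) as HA. pose proof (th3_pos _ H5) as HB. pose proof (th4_pos _ H5) as HC.
  pose proof (theta_ratio_order t Ht) as Huv. fold u v in Huv.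
  assert (Hu : 0 < u) by (apply Rdiv_lt_0_compat; auto).
  assert (Hg : 0 < g) by (apply Rdiv_lt_0_compat; auto).
  assert (Hv1 : v < 1).
  { unfold v. apply Rmult_lt_reg_r with (th3 t); auto.
    replace (th3 (5 * t) / th3 t * th3 t) with (th3 (5 * t)) by (field; lra).
    rewrite Rmult_1_l. apply th3_decr; auto. }
  assert (EA : th2 (5 * t) = u * th2 t) by (unfold u; field; lra).
  assert (EB : th3 (5 * t) = v * th3 t) by (unfold v; field; lra).
  assert (EC : th4 (5 * t) = g * th4 t) by (unfold g; field; lra).
  pose proof (jacobi_quartic t Ht) as J1. pose proof (jacobi_quartic _ H5) as J5.
  pose proof (th2_th3_product t Ht) as T. pose proof (th2_th3_ratio t Ht) as Rt.
  rewrite EA, EB, EC in J5. rewrite EA, EB in T, Rt.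
  assert (Ek : modk t = th2 t ^ 2 / th3 t ^ 2) by reflexivity.
  set (a := th2 t) in *. set (b := th3 t) in *. set (c := th4 t) in *.
  clearbody a b c. clearbody u v g.
  assert (T' : (1 - u ^ 2) * (1 - v ^ 2) = 4 * (u * v) * (1 - u * v)).
  { apply Rmult_eq_reg_l with (a ^ 2 * b ^ 2).
    2:{ apply Rgt_not_eq, Rmult_lt_0_compat; apply pow_lt; auto. }
    replace (a ^ 2 * b ^ 2 * ((1 - u ^ 2) * (1 - v ^ 2)))
      with ((a ^ 2 - (u * a) ^ 2) * (b ^ 2 - (v * b) ^ 2)) by ring.
    rewrite T. ring. }
  assert (Rt' : a ^ 4 * (u * (1 - u ^ 2) ^ 2) = b ^ 4 * (v * (1 - v ^ 2) ^ 2)).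
  { apply Rmult_eq_reg_l with (a * b).
    2:{ apply Rgt_not_eq, Rmult_lt_0_compat; auto. }
    replace (a * b * (a ^ 4 * (u * (1 - u ^ 2) ^ 2))) with ((a ^ 2 - (u * a) ^ 2) ^ 2 * (u * a * b)) by ring.
    rewrite Rt. ring. }
  split; [lra|]. split; auto. split.
  - apply (theta_ratio_relation a b c); auto; lra.
  - assert (Hq : 0 < u / v) by (apply Rdiv_lt_0_compat; lra).
    apply (modular5_of_ratios _ u v); auto; try lra.
    + apply modk_pos; auto.
    + apply sqrt_lt_R0; auto.
    + rewrite <- Rsqr_pow2, Rsqr_sqrt by lra. field. lra.
    + rewrite Ek.
      replace ((a ^ 2 / b ^ 2) ^ 2 * (u * (1 - u ^ 2) ^ 2)) with (a ^ 4 * (u * (1 - u ^ 2) ^ 2) / b ^ 4)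
        by (field; lra).
      rewrite Rt'. field. lra.
Qed.

Lemma th_product t : 0 < t ->
  th2 t * th3 t * th4 t ^ 4 = 2 * exp (- (t / 4)) * Eu t ^ 6.
Proof.
  intros Ht. unfold th2, th3, th4.
  pose proof (Eu_pos t Ht). pose proof (Eu_pos (2 * t) ltac:(lra)).
  pose proof (Eu_pos (4 * t) ltac:(lra)). field. lra.
Qed.

Lemma pow6_inj x y : 0 < x -> 0 < y -> x ^ 6 = y ^ 6 -> x = y.
Proof.
  intros Hx Hy H.
  assert (E : (x - y) * (x ^ 5 + x ^ 4 * y + x ^ 3 * y ^ 2 + x ^ 2 * y ^ 3 + x * y ^ 4 + y ^ 5) = 0)
    by (ring_simplify; lra).
  apply Rmult_integral in E. destruct E as [E|E]; [lra|]. exfalso.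
  assert (0 < x ^ 5 /\ 0 < x ^ 4 * y /\ 0 < x ^ 3 * y ^ 2 /\ 0 < x ^ 2 * y ^ 3 /\ 0 < x * y ^ 4 /\ 0 < y ^ 5).
  { repeat split; try (apply pow_lt; auto); apply Rmult_lt_0_compat; auto; apply pow_lt; auto. }
  lra.
Qed.

Lemma Rpower_pow6 x (y : R) : Rpower x y ^ 6 = Rpower x (6 * y).
Proof.
  rewrite <- Rpower_pow by apply exp_pos. rewrite Rpower_mult. f_equal. simpl; ring.
Qed.

(** The Euler quotient of the logarithmic derivative, in terms of the moduli
    [x], [w^2/x] and their complements; sixth powers remove the roots. *)
Lemma euler_quotient t w w' : 0 < t ->
  w = th2 t * th2 (5 * t) / (th3 t * th3 (5 * t)) ->
  w' = th4 t * th4 (5 * t) / (th3 t * th3 (5 * t)) ->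
  Eu t ^ 5 / Eu (5 * t) =
    Rpower 2 (4 / 3) * (th2 t / th3 t) * (th4 t ^ 4 / th3 t ^ 4) / (Rpower w (1 / 6) * Rpower w' (2 / 3))
      * (th3 t / th3 (5 * t)) * (th3 t ^ 4 / 4).
Proof.
  intros Ht Ew Ew'. assert (H5 : 0 < 5 * t) by lra.
  pose proof (th2_pos t Ht) as Ha. pose proof (th3_pos t Ht) as Hb. pose proof (th4_pos t Ht) as Hc.
  pose proof (th2_pos _ H5) as HA. pose proof (th3_pos _ H5) as HB. pose proof (th4_pos _ H5) as HC.
  pose proof (Eu_pos t Ht) as E1. pose proof (Eu_pos _ H5) as E5.
  pose proof (th_product t Ht) as P1. pose proof (th_product _ H5) as P5.
  set (a := th2 t) in *. set (b := th3 t) in *. set (c := th4 t) in *.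
  set (A := th2 (5 * t)) in *. set (B := th3 (5 * t)) in *. set (C := th4 (5 * t)) in *.
  clearbody a b c A B C.
  assert (Hw : 0 < w) by (rewrite Ew; apply Rdiv_lt_0_compat; apply Rmult_lt_0_compat; auto).
  assert (Hw' : 0 < w') by (rewrite Ew'; apply Rdiv_lt_0_compat; apply Rmult_lt_0_compat; auto).
  assert (Q2 : 0 < Rpower 2 (4 / 3)) by apply exp_pos.
  assert (Qw : 0 < Rpower w (1 / 6)) by apply exp_pos.
  assert (Qw' : 0 < Rpower w' (2 / 3)) by apply exp_pos.
  apply pow6_inj.
  - apply Rdiv_lt_0_compat; auto. apply pow_lt; auto.
  - assert (0 < c ^ 4) by (apply pow_lt; auto). assert (0 < b ^ 4) by (apply pow_lt; auto).
    unfold Rdiv. repeat apply Rmult_lt_0_compat; auto; try apply Rinv_0_lt_compat; auto; try lra.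
    apply Rmult_lt_0_compat; auto.
  - assert (R2 : Rpower 2 (4 / 3) ^ 6 = 256).
    { rewrite Rpower_pow6. replace (6 * (4 / 3)) with (INR 8) by (simpl; field).
      rewrite Rpower_pow by lra. ring. }
    assert (Rw : Rpower w (1 / 6) ^ 6 = w).
    { rewrite Rpower_pow6. replace (6 * (1 / 6)) with 1 by field. apply Rpower_1; auto. }
    assert (Rw' : Rpower w' (2 / 3) ^ 6 = w' ^ 4).
    { rewrite Rpower_pow6. replace (6 * (2 / 3)) with (INR 4) by (simpl; field).
      apply Rpower_pow; auto. }
    transitivity (Rpower 2 (4 / 3) ^ 6 * (a / b * (c ^ 4 / b ^ 4) * (b / B) * (b ^ 4 / 4)) ^ 6
      / (Rpower w (1 / 6) ^ 6 * Rpower w' (2 / 3) ^ 6)).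
    2:{ field. repeat split; lra. }
    rewrite R2, Rw, Rw', Ew, Ew'.
    transitivity ((a * b * c ^ 4) ^ 5 / (16 * (A * B * C ^ 4))).
    2:{ field. repeat split; lra. }
    rewrite P1, P5.
    replace (exp (- (5 * t / 4))) with (exp (- (t / 4)) ^ 5)
      by (rewrite exp_pow; f_equal; simpl; field).
    pose proof (exp_pos (- (t / 4))). field. split; lra.
Qed.

Theorem theorem1 (w L M x w' : R)
  (hw : 0 < w < 1)
  (hL : 0 < L)
  (hwL : w = sqrt (L * (18 + L) / (6 * (64 + 3 * L))))
  (hM : M = (18 + L) / (64 + 3 * L))
  (hx : 0 < x)
  (hwx : sqrt w / sqrt x =
     1 / 2 * sqrt (4 + 2 / 3 *
        (Rpower L (1 / 6) / Rpower M (1 / 6)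
         - 4 * (Rpower M (1 / 6) / Rpower L (1 / 6))) ^ 2)
     + 1 / 2 * sqrt (2 / 3) *
        (Rpower L (1 / 6) / Rpower M (1 / 6)
         - 4 * (Rpower M (1 / 6) / Rpower L (1 / 6))))
  (hx1 : 0 < x < 1)
  (hw' : w' = sqrt (sqrt (1 - x ^ 2) * sqrt (1 - w ^ 4 / x ^ 2))) :
  is_derive rogers_ramanujan
    (exp (- PI * sqrt (singular_modulus_inv x)))
    (Rpower 2 (4 / 3) * sqrt x * (1 - x ^ 2)
       / (5 * Rpower w (1 / 6) * Rpower w' (2 / 3))
     * sqrt (w / x + w' / sqrt (1 - x ^ 2) - w * w' / (x * sqrt (1 - x ^ 2)))
     * rogers_ramanujan (exp (- PI * sqrt (singular_modulus_inv x)))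
     * (ellipticK x ^ 2 * exp (PI * sqrt (singular_modulus_inv x)) / PI ^ 2)).
Proof.
  destruct (modk_surjective x hx1) as [t [Ht [Ex Et]]].
  replace (- PI * sqrt (singular_modulus_inv x)) with (- t) by (rewrite <- Et; ring).
  rewrite Et.
  destruct (modular5_param w L M x hw hL hwL hM hx hwx) as [Hp1 Hm1].
  destruct (degree5 t Ht) as [[Hu Huv] [Hg [Hmul Hm2]]].
  assert (H5 : 0 < 5 * t) by lra.
  pose proof (th2_pos t Ht) as Ha. pose proof (th3_pos t Ht) as Hb. pose proof (th4_pos t Ht) as Hc.
  pose proof (th2_pos _ H5) as HA. pose proof (th3_pos _ H5) as HB. pose proof (th4_pos _ H5) as HC.
  (* [sqrt (w / x)] and [sqrt (u / v)] are roots in [(0,1)] of the same modular equation. *)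
  assert (Ewx : w / x = th2 (5 * t) / th2 t / (th3 (5 * t) / th3 t)).
  { set (u := th2 (5 * t) / th2 t) in *. set (v := th3 (5 * t) / th3 t) in *.
    assert (Huv1 : 0 < u / v < 1).
    { split. apply Rdiv_lt_0_compat; lra. apply Rmult_lt_reg_r with v; [lra|].
      unfold Rdiv. rewrite Rmult_assoc, Rinv_l; lra. }
    apply sqrt_inj.
    - left; apply Rdiv_lt_0_compat; lra.
    - lra.
    - apply (modular5_inj x); auto.
      + split. apply sqrt_lt_R0; lra. rewrite <- sqrt_1. apply sqrt_lt_1_alt; lra.
      + rewrite Ex at 1. exact Hm2. }
  assert (Ew : w = th2 t * th2 (5 * t) / (th3 t * th3 (5 * t))).
  { replace w with (x * (w / x)) by (field; lra). rewrite Ewx, Ex. unfold modk. field. lra. }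
  assert (Esx : sqrt (1 - x ^ 2) = th4 t ^ 2 / th3 t ^ 2) by (rewrite Ex; apply sqrt_modk; auto).
  assert (Ew' : w' = th4 t * th4 (5 * t) / (th3 t * th3 (5 * t))).
  { rewrite hw', Esx.
    replace (w ^ 4 / x ^ 2) with (modk (5 * t) ^ 2).
    2:{ rewrite Ew, Ex. unfold modk. field. lra. }
    rewrite sqrt_modk by auto. unfold modk'.
    apply sqrt_lem_1.
    - left. apply Rmult_lt_0_compat; apply Rdiv_lt_0_compat; apply pow_lt; auto.
    - left. apply Rdiv_lt_0_compat; apply Rmult_lt_0_compat; auto.
    - field. lra. }
  assert (Esq : sqrt x = th2 t / th3 t).
  { rewrite Ex. apply sqrt_lem_1; unfold modk.
    - left. apply Rdiv_lt_0_compat; apply pow_lt; auto.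
    - left. apply Rdiv_lt_0_compat; auto.
    - field. lra. }
  assert (Ex2 : 1 - x ^ 2 = th4 t ^ 4 / th3 t ^ 4).
  { rewrite Ex. replace (1 - modk t ^ 2) with (modk' t ^ 2) by (pose proof (modk_sqr t Ht); lra).
    unfold modk'. field. lra. }
  assert (Em : sqrt (w / x + w' / sqrt (1 - x ^ 2) - w * w' / (x * sqrt (1 - x ^ 2))) = th3 t / th3 (5 * t)).
  { set (u := th2 (5 * t) / th2 t) in *. set (v := th3 (5 * t) / th3 t) in *.
    set (g := th4 (5 * t) / th4 t) in *.
    replace (w / x + w' / sqrt (1 - x ^ 2) - w * w' / (x * sqrt (1 - x ^ 2)))
      with ((v * (u + g) - u * g) / v ^ 2).
    2:{ rewrite Esx, Ew', Ew, Ex. unfold modk, u, v, g. field. lra. }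
    rewrite Hmul. replace (1 / v ^ 2) with ((th3 t / th3 (5 * t)) ^ 2) by (unfold v; field; lra).
    apply sqrt_pow2. left. apply Rdiv_lt_0_compat; auto. }
  pose proof (euler_quotient t w w' Ht Ew Ew') as Q.
  rewrite Em, Esq, Ex2, Ex, ellipticK_modk by auto.
  pose proof PI_RGT_0. pose proof (exp_pos (1 / 6 * ln w)) as W1. pose proof (exp_pos (2 / 3 * ln w')) as W2.
  fold (Rpower w (1 / 6)) in W1. fold (Rpower w' (2 / 3)) in W2.
  evar_last; [apply rogers_ramanujan_derive; auto|].
  rewrite Q. field. repeat split; lra.
Qed.
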